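(* (Bass–Ihara formula.) Let $X$ be a connected weighted graph of bounded valency, possibly infinite, of finite total weight, and let $Z(u)$ be its Ihara zeta function. Then, with the Fredholm determinant taken on $C_0\oplus C_1=\ell^2(VX)\oplus\ell^2(\mathrm{OE})$, $$Z(u)^{-1}=\det\left[1+u\begin{pmatrix}uB_2-A & u\tau J^2\\ \sigma & J\end{pmatrix}\right].$$
   Context: Graph: $X$ is a connected (simple, undirected) graph with vertex set $VX$ and edge set $EX$ consisting of two-element subsets of $VX$; $X$ may be infinite, but has bounded valency (there is $M>0$ such that every vertex has at most $M$ neighbours). $\mathrm{OE}$ is the set of oriented edges (each edge gives two); for $e\in \mathrm{OE}$, $o(e)$ is the starting vertex, $\tau(e)$ the terminal vertex, $e^{-1}$ the reverse of $e$. Weight: $w:\mathrm{OE}\to(0,\infty)$ with finite total weight $\sum_{e\in \mathrm{OE}}w(e)<\infty$. For adjacent $x,x'$, $w(x,x')$ is the weight of the oriented edge from $x$ to $x'$, and $W(x,x')=w(x,x')w(x',x)$. A path is a sequence $p=(x_0,\dots,x_n)$ of vertices with consecutive vertices adjacent; its length is $l(p)=n$ and its weight is $w(p)=w(x_0,x_1)\cdots w(x_{n-1},x_n)$. Cycles: a path of length $n\ge1$ is closed if $x_n=x_0$. It is reduced if $x_{j-1}\ne x_{j+1}$ for all $1\le j\le n-1$. A closed path has a tail if $x_1=x_{n-1}$. A cycle is an equivalence class of closed paths under the equivalence relation generated by $(x_0,x_1,\dots,x_n)\sim(x_1,x_2,\dots,x_n,x_1)$. A regular cycle is a cycle all of whose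 members are reduced and without tail. A cycle is prime if it is not a power of a shorter one. Zeta function: $Z(u)=\prod_p(1-w(p)u^{l(p)})^{-1}$ over all regular prime cycles $p$; the product converges for small $|u|$, and $Z(u)^{-1}$ denotes also its extension to an entire function. Operators: $C_0=\ell^2(VX)$ and $C_1=\ell^2(\mathrm{OE})$ are the Hilbert spaces with orthonormal bases the vertices, respectively the oriented edges. On $C_0$: $Ax=\sum_{x'}w(x,x')x'$ and $B_2x=\sum_{x'}W(x,x')x$, sums over all neighbours $x'$ of $x$. $\sigma:C_0\to C_1$, $\sigma(x)=\sum_{e:\,o(e)=x}w(e)e$; $\tau:C_1\to C_0$ is the linear extension of $e\mapsto\tau(e)$; $J:C_1\to C_1$, $J(e)=w(e^{-1})e^{-1}$. The Fredholm determinant of $1+S$, $S$ trace class, is $\sum_{k\ge0}\operatorname{tr}\bigwedge^kS$. *)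

(* Defs.v *)
From HB Require Import structures.
From mathcomp Require Import all_boot all_order all_algebra finmap.
From mathcomp Require Import generic_quotient complex.
From mathcomp Require Import boolp classical_sets functions fsbigop reals ereal.
From mathcomp Require Import topology normedtype summability sequences derive esum.
From Stdlib Require Import Relation_Operators.

Set Implicit Arguments.
Unset Strict Implicit.
Unset Printing Implicit Defensive.

Import Order.TTheory GRing.Theory Num.Theory.
Import numFieldNormedType.Exports.
Local Open Scope classical_set_scope.
Local Open Scope complex_scope.
Local Open Scope ring_scope.
Local Open Scope quotient_scope.

(* Two-element edge sets are encoded as a symmetric irreflexive relation. The
   vertex type may be infinite; [choiceType] is no restriction classically. *)
Structure sgraph := SGraph {
  vertex :> choiceType;
  adj : rel vertex;
  adj_sym : symmetric adj;
  adj_irr : irreflexive adj }.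

Definition oedge (X : sgraph) := {p : X * X | adj p.1 p.2}.
HB.instance Definition _ (X : sgraph) := Choice.on (oedge X).

Section Graph.
Variable X : sgraph.

Definition orig (e : oedge X) : X := (val e).1.
Definition term (e : oedge X) : X := (val e).2.

Lemma einv_subproof (e : oedge X) : adj (term e) (orig e).
Proof. by rewrite adj_sym; exact: (valP e). Qed.

Definition einv (e : oedge X) : oedge X :=
  exist (fun p : X * X => adj p.1 p.2) (term e, orig e) (einv_subproof e).

Definition connected_graph : Prop :=
  forall x y : X, exists s : seq X, path (@adj X) x s /\ last x s = y.

Definition bounded_valency : Prop :=
  exists M : nat, forall (x : X) (s : seq X),
    uniq s -> all (adj x) s -> (size s <= M)%N.

(* The path (x_0, x_1, ..., x_n) is the pair (x_0, [:: x_1; ...; x_n]). *)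
Definition plen (p : X * seq X) : nat := size p.2.

Definition pvtx (p : X * seq X) (j : nat) : X := nth p.1 (p.1 :: p.2) j.

Definition closed_path (p : X * seq X) : bool :=
  [&& path (@adj X) p.1 p.2, (1 <= plen p)%N & last p.1 p.2 == p.1].

Definition reduced (p : X * seq X) : Prop :=
  forall j, (1 <= j <= plen p - 1)%N -> pvtx p (j - 1) <> pvtx p (j + 1).

Definition has_tail (p : X * seq X) : Prop := pvtx p 1 = pvtx p (plen p - 1).

(* (x_0, x_1, ..., x_n) |-> (x_1, ..., x_n, x_1) *)
Definition shift_path (p : X * seq X) : X * seq X :=
  if p.2 is y :: s then (y, rcons s y) else p.

Definition path_power (p : X * seq X) (m : nat) : X * seq X :=
  (p.1, flatten (nseq m p.2)).

Definition cpath := {p : X * seq X | closed_path p}.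
HB.instance Definition _ := Choice.on cpath.

Definition cycle_equiv (p q : cpath) : bool :=
  `[< clos_refl_sym_trans cpath
        (fun p' q' => val q' = shift_path (val p')) p q >].

Lemma cycle_equiv_refl : reflexive cycle_equiv.
Proof. by move=> p; apply/asboolP; exact: rst_refl. Qed.

Lemma cycle_equiv_sym : symmetric cycle_equiv.
Proof.
by move=> p q; apply/asboolP/asboolP => h; exact: rst_sym.
Qed.

Lemma cycle_equiv_trans : transitive cycle_equiv.
Proof.
move=> q p r /asboolP pq /asboolP qr; apply/asboolP; exact: rst_trans pq qr.
Qed.

Canonical cycle_equivRel :=
  EquivRel cycle_equiv cycle_equiv_refl cycle_equiv_sym cycle_equiv_trans.

Definition pcycle := {eq_quot cycle_equivRel}.
HB.instance Definition _ := Choice.on pcycle.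
HB.instance Definition _ := Quotient.on pcycle.

Definition regular_cycle (c : pcycle) : Prop :=
  forall p : cpath, \pi_pcycle p = c ->
    reduced (val p) /\ ~ has_tail (val p).

Definition cycle_len (c : pcycle) : nat := plen (val (repr c)).

Definition is_cycle_power (c d : pcycle) : Prop :=
  exists (p q : cpath) (m : nat),
    [/\ \pi_pcycle p = d, \pi_pcycle q = c & val q = path_power (val p) m].

Definition prime_cycle (c : pcycle) : Prop :=
  ~ exists d : pcycle, (cycle_len d < cycle_len c)%N /\ is_cycle_power c d.

Definition rpcycle := {c : pcycle | `[< regular_cycle c /\ prime_cycle c >]}.
HB.instance Definition _ := Choice.on rpcycle.

End Graph.

Section Hilbert.
Variable R : realType.
Local Notation C := (R[i]).

(* Sum along the net of finite subsets of I. Here and below C^o is C regarded as a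
   normed module over itself, which carries the topology of C. *)
Definition usum (I : choiceType) (x : I -> C) : C := @sum I C C^o x.

(* l^2(I) is the set of functions f : I -> C satisfying [ell2 f]. *)
Definition ell2 (I : choiceType) (f : I -> C) : Prop :=
  summable [set: I] (fun i => (ComplexField.Normc.normc (f i) ^+ 2)%:E).

Definition ell2_norm (I : choiceType) (f : I -> C) : R :=
  Num.sqrt (fine (\esum_(i in [set: I]) (ComplexField.Normc.normc (f i) ^+ 2)%:E)).

Definition inner (I : choiceType) (f g : I -> C) : C :=
  usum (fun i => f i * (g i)^*).

Definition delta (I : choiceType) (i : I) : I -> C := fun j => (j == i)%:R.

(* The bounded operator l^2(I) -> l^2(J) with value [c i] at the basis vector
   [delta i]. *)
Definition lin_ext (I J : choiceType) (c : I -> (J -> C)) (f : I -> C) : J -> C :=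
  fun j => usum (fun i => f i * c i j).

(* Trace class, i.e. nuclear: S f = sum_n <f, a_n> b_n in l^2(I), with
   sum_n |a_n| |b_n| finite; this includes that S is bounded linear on l^2(I). *)
Definition trace_class (I : choiceType) (S : (I -> C) -> (I -> C)) : Prop :=
  exists a b : nat -> I -> C,
    [/\ forall n, ell2 (a n) /\ ell2 (b n),
        cvgn (series (fun n => ell2_norm (a n) * ell2_norm (b n)))
      & forall f, ell2 f -> ell2 (S f) /\
          (fun N : nat => ell2_norm
             (fun i => S f i - \sum_(n < N) inner f (a n) * b n i)) @ \oo
            --> (0 : R)].

(* The inner product of the decomposable vectors v_1 /\ ... /\ v_k and
   v'_1 /\ ... /\ v'_k in the k-th exterior power of l^2(I). *)
Definition wedge_inner (I : choiceType) (k : nat) (v v' : 'I_k -> (I -> C)) : C :=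
  \det (\matrix_(a, b) inner (v a) (v' b)).

Definition ksubset (I : choiceType) (k : nat) := {F : {fset I} | #|` F| == k}.
HB.instance Definition _ I k := Choice.on (@ksubset I k).

Definition basis_wedge (I : choiceType) (F : {fset I}) (a : 'I_(size F)) : I -> C :=
  delta (tnth (in_tuple F) a).

(* The trace of the k-th exterior power of S, computed in the orthonormal basis
   e_F = delta_{i_1} /\ ... /\ delta_{i_k}, F = {i_1, ..., i_k}, on which it acts
   by v_1 /\ ... /\ v_k |-> S v_1 /\ ... /\ S v_k. *)
Definition trace_wedge (I : choiceType) (S : (I -> C) -> (I -> C)) (k : nat) : C :=
  usum (fun F : ksubset I k =>
    wedge_inner (fun a => S (basis_wedge (F := val F) a))
                (basis_wedge (F := val F))).

(* det (1 + S) is the sum over k of the traces of the exterior powers of S. *)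
Definition fredholm_det1p (I : choiceType) (S : (I -> C) -> (I -> C)) : C :=
  lim (series (trace_wedge S : C^o ^nat) @ \oo).

(* The derivative is taken over the scalar field C, so this is holomorphy. *)
Definition entire (f : C -> C) : Prop :=
  forall u : C, derivable (f : C^o -> C^o) u 1.

(* l^2(I) (+) l^2(J) is identified with l^2(I + J). *)
Definition block_op (I J : choiceType)
    (a : (I -> C) -> (I -> C)) (b : (J -> C) -> (I -> C))
    (c : (I -> C) -> (J -> C)) (d : (J -> C) -> (J -> C))
    (f : (I + J)%type -> C) : (I + J)%type -> C :=
  fun k => match k with
  | inl i => a (f \o inl) i + b (f \o inr) i
  | inr j => c (f \o inl) j + d (f \o inr) j
  end.

Definition scale_op (I J : choiceType) (u : C) (S : (I -> C) -> (J -> C)) :=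
  fun (f : I -> C) (j : J) => u * S f j.

Definition sub_op (I J : choiceType) (S T : (I -> C) -> (J -> C)) :=
  fun (f : I -> C) (j : J) => S f j - T f j.

End Hilbert.

Section Ihara.
Variables (R : realType) (X : sgraph) (w : oedge X -> R).
Local Notation C := (R[i]).

(* w(x, x'), with value 0 if x and x' are not adjacent. *)
Definition wt (x x' : X) : R :=
  if insub (x, x') is Some e then w e else 0.

Definition W (x x' : X) : R := wt x x' * wt x' x.

Definition pweight (p : X * seq X) : R :=
  \prod_(j < plen p) wt (pvtx p j) (pvtx p j.+1).

Definition cycle_weight (c : pcycle X) : R := pweight (val (repr c)).

Definition zeta_factor (u : C) (c : pcycle X) : C :=
  (1 - (cycle_weight c)%:C * u ^+ cycle_len c)^-1.

Definition zeta_partial (u : C) (F : {fset rpcycle X}) : C^o :=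
  \prod_(c <- F) zeta_factor u (val c).

Definition zeta (u : C) : C := lim (zeta_partial u @ totally).

(* Convergence to a nonzero limit, as usual for infinite products. *)
Definition zeta_converges (u : C) : Prop :=
  cvg (zeta_partial u @ totally) /\ zeta u <> 0.

(* f is the entire extension of 1/Z from a neighbourhood of 0; it is unique by the
   identity theorem. *)
Definition is_zeta_inverse (f : C -> C) : Prop :=
  entire f /\
  \forall u \near (0 : C^o), zeta_converges u /\ f u = (zeta u)^-1.

Definition opA : (X -> C) -> (X -> C) :=
  lin_ext (fun x y => \sum_(x' \in [set x' | adj x x'])
                        (wt x x')%:C * delta R x' y).

Definition opB2 : (X -> C) -> (X -> C) :=
  lin_ext (fun x y => \sum_(x' \in [set x' | adj x x'])
                        (W x x')%:C * delta R x y).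

Definition op_sigma : (X -> C) -> (oedge X -> C) :=
  lin_ext (fun x e' => \sum_(e \in [set e | orig e = x])
                         (w e)%:C * delta R e e').

Definition op_tau : (oedge X -> C) -> (X -> C) :=
  lin_ext (fun e => delta R (term e)).

Definition opJ : (oedge X -> C) -> (oedge X -> C) :=
  lin_ext (fun e e' => (w (einv e))%:C * delta R (einv e) e').

Definition ihara_op (u : C) :
    ((X + oedge X)%type -> C) -> ((X + oedge X)%type -> C) :=
  scale_op u
    (block_op (sub_op (scale_op u opB2) opA)
              (scale_op u (op_tau \o (opJ \o opJ)))
              op_sigma
              opJ).

End Ihara.

(* Main.v *)
Require Import Defs.
From mathcomp Require Import all_boot all_order all_algebra finmap.
From mathcomp Require Import generic_quotient complex ring lra perm.
From mathcomp Require Import boolp classical_sets functions cardinality fsbigop reals ereal.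
From Stdlib Require Import Relation_Operators.
From mathcomp Require Import topology normedtype summability sequences derive esum exp.

(* With [T = tau sigma - J] the edge operator forbidding backtracking, both sides
   equal [det (1 - u T)].

   The matrices of the Ihara operator and of [T] have rows whose l^1-norms are
   summable, so each principal minor is bounded by the product of its row norms;
   hence the Fredholm determinants are limits of determinants of finite sections.
   For the sections over a finite set of vertices (with [B_2] truncated to these
   vertices) the identity [det (1 + ihara) = det (1 - u T)] is a unipotent column
   operation. The same bound makes [det (1 - u T)] a power series in [u] with
   coefficients decaying faster than any geometric sequence, so it is entire.

   For the Euler product, fix a finite set [A] of edges and a length [N]. The
   polynomials [det (1 - X T_A)] and [prod_c (1 - w(c) X^l(c))], [c] ranging over the
   regular prime cycles in [A] of length at most [N], have the same logarithmic
   derivative modulo [X^(N+1)]: the trace of [T_A^n] sums the weights of the words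
   of length [n] that are cyclically without backtracking, and each such word is a
   power of one of the [l(c)] rotations of a unique prime cycle [c]. So the two
   polynomials agree up to degree [N], and Cauchy estimates uniform in [A] and [N]
   give the limit as [A] and [N] grow. *)

Set Implicit Arguments.
Unset Strict Implicit.
Unset Printing Implicit Defensive.

Import Order.TTheory GRing.Theory Num.Theory.
Import numFieldNormedType.Exports.
Local Open Scope ring_scope.

(* One inequality drives both halves. If the numbers [r i >= 0] have finite sums at most [s], the
   products of [r] over finite subsets sum to at most [exp s], and the tail of this sum is
   controlled by [r] alone. It is applied to row norms of matrices and to absolute values of Euler
   terms. Its uniformity in the matrix makes truncation harmless. Truncation cannot be avoided: on a
   finite set of vertices the product of [sigma], [J] and [tau] misses the edges that leave the set,
   so the section of the true [B_2] does not fit the Bass identity. The row of [T] at [e] has norm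
   the out-weight of the head of [e]; the valency bound [M] makes these norms sum to at most [M]
   times the total weight. The cut-off in length is needed because finitely many edges can carry
   infinitely many prime cycles, so a determinant is matched with a finite Euler product only modulo
   a power of [X]. The limit runs along finite sets of cycles; [A] and [N] are therefore chosen
   after such a set is given. All matrices act on rows, so composition reads from left to right. *)
#[local] Existing Instance totally_filter.

(** * Limits and sums in the complex numbers *)

Section ComplexNorm.
Variable R : realType.
Local Notation C := R[i].
Local Notation nc := (@ComplexField.Normc.normc R).

Lemma norm_nc (x : C) : `|x| = (nc x)%:C%C.
Proof. by []. Qed.

Lemma nc_ge0 (x : C) : 0 <= nc x.
Proof. by case: x => a b; apply: sqrtr_ge0. Qed.

Lemma nc_real (x : R) : nc x%:C%C = `|x|.
Proof. by rewrite /= expr0n addr0 sqrtr_sqr. Qed.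

Lemma nc_real_ge0 (x : R) : 0 <= x -> nc x%:C%C = x.
Proof. by move=> x0; rewrite nc_real ger0_norm. Qed.

Lemma ncD (x y : C) : nc (x + y) <= nc x + nc y.
Proof. by rewrite -lecR rmorphD; exact: (@ler_normD _ R[i]). Qed.

Lemma ncM (x y : C) : nc (x * y) = nc x * nc y.
Proof. exact: ComplexField.Normc.normcM. Qed.

Lemma ncN (x : C) : nc (- x) = nc x.
Proof. by apply: (@complexI R); exact: (@normrN R[i] R[i]). Qed.

Lemma nc0 : nc 0 = 0.
Proof. exact: ComplexField.Normc.normc0. Qed.

Lemma nc1 : nc 1 = 1.
Proof. exact: ComplexField.Normc.normc1. Qed.

Lemma ncV (x : C) : nc x^-1 = (nc x)^-1.
Proof. exact: ComplexField.Normc.normcV. Qed.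

Lemma nc_eq0 (x : C) : (nc x == 0) = (x == 0).
Proof.
by apply/eqP/eqP => [/ComplexField.Normc.eq0_normc|->] //; exact: nc0.
Qed.

Lemma ncB (x y : C) : nc (x - y) = nc (y - x).
Proof. by rewrite -ncN opprB. Qed.

Lemma ncX (x : C) n : nc (x ^+ n) = nc x ^+ n.
Proof. by elim: n => [|n IH]; rewrite ?expr0 ?nc1 // !exprS ncM IH. Qed.

Lemma nc_sum (I : Type) (s : seq I) (P : pred I) (f : I -> C) :
  nc (\sum_(i <- s | P i) f i) <= \sum_(i <- s | P i) nc (f i).
Proof.
elim/big_rec2: _ => [|i y x _ h]; first by rewrite nc0.
by apply: le_trans (ncD _ _) _; rewrite lerD2l.
Qed.

Lemma nc_prod (I : Type) (s : seq I) (P : pred I) (f : I -> C) :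
  nc (\prod_(i <- s | P i) f i) = \prod_(i <- s | P i) nc (f i).
Proof. by apply: big_morph; [exact: ncM|exact: nc1]. Qed.

Lemma nc_Re (x : C) : `|complex.Re x| <= nc x.
Proof. by have := normc_ge_Re x; rewrite norm_nc lecR. Qed.

Lemma nc_Im (x : C) : `|complex.Im x| <= nc x.
Proof.
case: x => a b /=; rewrite -sqrtr_sqr ler_wsqrtr // lerDr; exact: sqr_ge0.
Qed.

Lemma nc_ReIm (x : C) : nc x <= `|complex.Re x| + `|complex.Im x|.
Proof.
case: x => a b /=.
rewrite -[leRHS]ger0_norm ?addr_ge0 // -sqrtr_sqr ler_wsqrtr //.
rewrite -[a ^+ 2]real_normK ?num_real // -[b ^+ 2]real_normK ?num_real //.
by rewrite sqrrD addrAC lerDl mulrn_wge0 // mulr_ge0.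
Qed.

End ComplexNorm.

Section ComplexLimits.
Variable R : realType.
Local Notation C := R[i].
Local Notation nc := (@ComplexField.Normc.normc R).
Local Open Scope classical_set_scope.

(** The norm on [C^o] is [C]-valued, so its epsilons are complex. A positive complex number is real,
    which permits real epsilons and the real modulus [nc]. *)
Lemma cvgCP (T : Type) (F : set_system T) (FF : Filter F) (f : T -> C^o) (l : C^o) :
  (f @ F --> l) <->
  (forall eps : R, 0 < eps -> \forall x \near F, nc (l - f x) <= eps).
Proof.
split=> [/cvgrPdist_le h e e0|h].
  have e0' : 0 < (e%:C%C : C) by rewrite ltcR.
  by apply: filterS (h _ e0') => x; rewrite norm_nc lecR.
apply/cvgrPdist_le => e e0.
have eR : e \is Num.real by rewrite gtr0_real.
have eE : e = (complex.Re e)%:C%C by rewrite RRe_real.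
move: e0; rewrite eE ltcR => e0.
by apply: filterS (h _ e0) => x; rewrite norm_nc lecR.
Qed.

Lemma nbhsCP (x : C) (P : C -> Prop) :
  (\forall y \near (x : C^o), P y) <->
  exists2 e : R, 0 < e & forall y, nc (y - x) <= e -> P y.
Proof.
split; last first.
  case=> e e0 h; have /cvgCP/(_ _ e0) : (fun y : C^o => y) @ nbhs (x : C^o) --> (x : C^o) by exact: cvg_id.
  by apply: filterS => y; rewrite ncB; apply: h.
move/nbhs_ballP => [e /= e0 h].
have eR : e \is Num.real by rewrite gtr0_real.
have eE : e = (complex.Re e)%:C%C by rewrite RRe_real.
move: e0; rewrite eE ltcR => e0.
(* Balls are given by a strict inequality, the statement by a weak one; half the radius fits
   between. *)
exists (complex.Re e / 2) => [|y hy]; first by rewrite divr_gt0.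
apply: h; rewrite -ball_normE /ball_ /= distrC norm_nc eE ltcR.
by apply: le_lt_trans hy _; rewrite ltr_pdivrMr // ltr_pMr // ltr1n.
Qed.

(** Follows from completeness of the reals through the 1-Lipschitz maps [Re] and [Im]. Asking only
    for some centre [z] per [eps] suits nets as well as sequences. *)
Lemma cvgC_complete (T : Type) (F : set_system T) (FF : ProperFilter F) (f : T -> C^o) :
  (forall eps : R, 0 < eps ->
     exists z : C, \forall x \near F, nc (f x - z) <= eps) -> cvg (f @ F).
Proof.
move=> h.
have aux (g : C -> R) : (forall x y, `|g x - g y| <= nc (x - y)) ->
    cvg ((fun x => g (f x)) @ F).
  move=> gL; apply: cauchy_cvg; apply: cauchy_exP => e e0.
  have e2 : 0 < e / 2 by rewrite divr_gt0.
  have [z hz] := h _ e2.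
  exists (g z); rewrite /= /nbhs /=; apply: filterS hz => x hx.
  rewrite -ball_normE /ball_ /=; apply: le_lt_trans (gL _ _) _.
  rewrite ncB; apply: le_lt_trans hx _.
  by rewrite ltr_pdivrMr // ltr_pMr // ltr1n.
have /cvg_ex [a ha] : cvg ((fun x => complex.Re (f x)) @ F).
  by apply: aux => x y; rewrite -raddfB; exact: nc_Re.
have /cvg_ex [b hb] : cvg ((fun x => complex.Im (f x)) @ F).
  by apply: aux => x y; rewrite -raddfB; exact: nc_Im.
apply/cvg_ex; exists (Complex a b : C^o); apply/cvgCP => e e0.
have e2 : 0 < e / 2 by rewrite divr_gt0.
move/cvgrPdist_le/(_ _ e2) : ha => ha; move/cvgrPdist_le/(_ _ e2) : hb => hb.
apply: filterS2 ha hb => x ha hb.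
apply: le_trans (nc_ReIm _) _; rewrite !raddfB /= (splitr e).
exact: lerD.
Qed.

Lemma near_totally (I : choiceType) (P : {fset I} -> Prop) :
  (\forall F \near @totally I, P F) <->
  exists F0 : {fset I}, forall F, (F0 `<=` F)%fset -> P F.
Proof.
split=> [[F0 _ h]|[F0 h]]; first by exists F0 => F; apply: h.
by exists F0 => // F; apply: h.
Qed.

Lemma psumE (I : choiceType) (x : I -> C) (F : {fset I}) :
  @partial_sum I C^o x F = \sum_(i <- F) x i.
Proof. by rewrite /partial_sum -(big_seq_fsetE _ _ xpredT x). Qed.

Lemma usum_cvgP (I : choiceType) (x : I -> C) (l : C) :
  (forall eps : R, 0 < eps -> exists F0 : {fset I}, forall F, (F0 `<=` F)%fset ->
     nc (l - \sum_(i <- F) x i) <= eps) -> usum x = l.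
Proof.
move=> h; apply: (@cvg_lim C^o) => //; apply/cvgCP => e e0.
apply/near_totally; have [F0 hF0] := h e e0; exists F0 => F hF.
by rewrite psumE; apply: hF0.
Qed.

Lemma usum_fset (I : choiceType) (x : I -> C) (F0 : {fset I}) :
  (forall i, i \notin F0 -> x i = 0) -> usum x = \sum_(i <- F0) x i.
Proof.
move=> h; apply: usum_cvgP => e e0; exists F0 => F sF.
rewrite (big_fset_incl _ sF) ?subrr ?nc0 ?ltW // => i _ /h //.
Qed.

Lemma usum1 (I : choiceType) (x : I -> C) (a : I) :
  (forall i, i != a -> x i = 0) -> usum x = x a.
Proof.
move=> h; rewrite (@usum_fset _ _ [fset a]%fset) ?big_seq_fset1 // => i.
by rewrite inE; apply: h.
Qed.

End ComplexLimits.

(** * Principal minors *)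

Section Determinants.
Variable K : comNzRingType.

(** Schur complement: left multiplication by the unipotent matrix with lower-left block [- B] clears
    [B]. *)
Lemma det_block1 m n (A : 'M[K]_(m, n)) (B : 'M_(n, m)) (D : 'M_n) :
  \det (block_mx 1%:M A B D) = \det (D - B *m A).
Proof.
have := mulmx_block (1%:M : 'M_m) 0 (- B) (1%:M : 'M_n) 1%:M A B D.
rewrite !mul1mx !mul0mx !addr0 mulmx1 addNr mulNmx [- _ + D]addrC.
move/(congr1 determinant); rewrite det_mulmx det_lblock det_ublock.
by rewrite !det1 !mul1r.
Qed.

(** Sylvester's identity. Both sides are the determinant of the block matrix [1, A; - B, 1],
    computed once by a Schur complement and once by a column operation that clears [- B]. *)
Lemma det_add1_mulC m n (A : 'M[K]_(m, n)) (B : 'M_(n, m)) :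
  \det (1%:M + A *m B) = \det (1%:M + B *m A).
Proof.
have -> : \det (1%:M + B *m A) = \det (block_mx 1%:M A (- B) 1%:M).
  by rewrite det_block1 mulNmx opprK.
have := mulmx_block (1%:M : 'M_m) A (- B) (1%:M : 'M_n) 1%:M 0 B 1%:M.
rewrite !mulmx1 !mul1mx !mulmx0 !add0r addNr.
move/(congr1 determinant); rewrite det_mulmx det_lblock det_ublock.
by rewrite !det1 !mulr1 => <-.
Qed.

(** For each permutation the product over the rows of a sum of two entries is expanded; [G] records
    the rows in which the entry of [M] is chosen. *)
Lemma det_add1_subsets n (M : 'M[K]_n) :
  \det (1%:M + M) =
  \sum_(G : {set 'I_n})
    \det (\matrix_(i, j) if i \in G then M i j else (i == j)%:R).
Proof.
rewrite /determinant exchange_big /=; apply: eq_bigr => s _.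
rewrite -big_distrr /=; congr (_ * _).
under eq_bigr do rewrite !mxE addrC.
rewrite bigA_distr; apply: eq_bigr => G _; apply: eq_bigr => i _.
by rewrite !mxE.
Qed.

(* Replacing the rows outside [G] by those of the identity changes [1] into
   [1 + E *m B] with [E] the 0/1 matrix of [psi], so that [det_add1_mulC]
   applies. *)
Lemma det_principal_minor n k (psi : 'I_k -> 'I_n) (G : {set 'I_n}) (M : 'M[K]_n) :
  injective psi -> (forall i, (i \in G) = [exists a, psi a == i]) ->
  \det (\matrix_(i, j) if i \in G then M i j else (i == j)%:R) =
  \det (\matrix_(a, b) M (psi a) (psi b)).
Proof.
move=> psi_inj GE.
pose E := \matrix_(i < n, a < k) (i == psi a)%:R : 'M[K]_(n, k).
pose B := \matrix_(a < k, j < n) (M (psi a) j - (psi a == j)%:R) : 'M[K]_(k, n).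
transitivity (\det (1%:M + E *m B)); last rewrite det_add1_mulC; congr determinant.
  apply/matrixP => i j; rewrite !mxE; case: ifPn.
    rewrite GE => /existsP[a /eqP <-]; rewrite (bigD1 a) //= !mxE eqxx mul1r.
    rewrite big1 ?addr0 => [|b ba]; first by rewrite addrC subrK.
    by rewrite !mxE (inj_eq psi_inj) eq_sym (negPf ba) mul0r.
  rewrite GE negb_exists => /forallP h; rewrite big1 ?addr0 // => a _.
  by rewrite !mxE eq_sym (negPf (h a)) mul0r.
apply/matrixP => a b; rewrite !mxE (bigD1 (psi b)) //= !mxE eqxx mulr1.
rewrite big1 ?addr0 => [|j /negPf jb]; last by rewrite !mxE jb mulr0.
by rewrite (inj_eq psi_inj) addrC subrK.
Qed.

End Determinants.

Section DetBound.
Variable R : realType.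
Local Notation nc := (@ComplexField.Normc.normc R).

(** The product of row sums expands over all functions from rows to columns. Permutations are some
    of these, and the remaining terms are nonnegative. *)
Lemma sum_perm_prod_le n (a : 'I_n -> 'I_n -> R) : (forall i j, 0 <= a i j) ->
  \sum_(s : 'S_n) \prod_i a i (s i) <= \prod_i \sum_j a i j.
Proof.
move=> a0; rewrite bigA_distr_bigA /=.
pose F (f : {ffun 'I_n -> 'I_n}) := \prod_i a i (f i).
have F0 f : 0 <= F f by exact: prodr_ge0.
have -> : \sum_(s : 'S_n) \prod_i a i (s i) =
    \sum_(s in @finset.setTfor 'S_n) F (pval s).
  apply: eq_big => [s|s _]; first by rewrite finset.inE.
  by apply: eq_bigr => i _; rewrite pvalE.
rewrite -(big_imset F) => [|s t _ _]; last exact: val_inj.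
rewrite big_mkcond ler_sum // => f _; case: ifP => // _; exact: F0.
Qed.

Lemma nc_det_le n (M : 'M[R[i]]_n) : nc (\det M) <= \prod_i \sum_j nc (M i j).
Proof.
apply: le_trans (sum_perm_prod_le _); last by move=> i j; exact: nc_ge0.
apply: le_trans (nc_sum _ _ _) _; apply: ler_sum => s _.
by rewrite ncM nc_prod ncX ncN nc1 expr1n mul1r.
Qed.

End DetBound.

(** * Sums over the finite subsets of an index set *)

Section SubsetSums.
Variable I : choiceType.
Local Open Scope fset_scope.

Lemma tnth_fset_inj (F : {fset I}) : injective (tnth (in_tuple F)).
Proof.
move=> b c; have x0 : I := tnth (in_tuple F) b.
by move/eqP; rewrite !(tnth_nth x0) /= nth_uniq ?fset_uniq ?ltn_ord // => /eqP/val_inj.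
Qed.

(** Moves sums over finite subsets of a possibly infinite type to [{set 'I_n}], where distributivity
    over choices of subsets applies. *)
Lemma big_fpowerset (V : nmodType) n (phi : 'I_n -> I) (F : {fset I}) (g : {fset I} -> V) :
  injective phi -> (forall i, (i \in F) = [exists a, phi a == i]) ->
  \sum_(G <- fpowerset F) g G =
  \sum_(S : {set 'I_n}) g [fset phi a | a in S].
Proof.
move=> phi_inj FE.
rewrite -big_enum -(big_map (fun S : {set 'I_n} => [fset phi a | a in S]) xpredT g).
apply: perm_big; apply: uniq_perm; first exact: fset_uniq.
  rewrite map_inj_uniq ?enum_uniq // => S S' /fsetP e; apply/setP => a.
  have := e (phi a); rewrite !mem_imfset /=; last 2 first.
  - by move=> x y; apply: phi_inj.
  - by move=> x y; apply: phi_inj.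
  by [].
move=> G; rewrite fpowersetE; apply/idP/mapP => [/fsubsetP sGF|[S _ ->]].
  exists (finset (fun a => phi a \in G)); first by rewrite mem_enum.
  apply/fsetP => i; apply/idP/imfsetP => /= [iG|[a + ->]]; last by rewrite inE.
  have := sGF _ iG; rewrite FE => /existsP[a /eqP ai].
  by exists a; rewrite ?inE ai.
apply/fsubsetP => i /imfsetP[/= a _ ->]; rewrite FE; apply/existsP.
by exists a.
Qed.

Variable K : comNzRingType.

Lemma sum_prod_fpowerset (r : I -> K) (F : {fset I}) :
  \sum_(G <- fpowerset F) \prod_(i <- G) r i = \prod_(i <- F) (1 + r i).
Proof.
pose phi := tnth (in_tuple F).
have phi_inj : injective phi := @tnth_fset_inj F.
have FE i : (i \in F) = [exists a, phi a == i].
  apply/idP/existsP => [iF|[b /eqP <-]]; last exact: mem_tnth.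
  by have /tnthP[b e] : i \in in_tuple F by []; exists b; apply/eqP.
rewrite (big_fpowerset _ phi_inj FE).
have -> : \prod_(i <- F) (1 + r i) = \prod_a (r (phi a) + 1).
  by rewrite big_tnth; apply: eq_bigr => a _; rewrite addrC.
rewrite bigA_distr; apply: eq_bigr => S _; rewrite -big_mkcond /=.
by rewrite big_imfset /= ?big_enum //= => x y _ _; apply: phi_inj.
Qed.

Definition minor (M : I -> I -> K) (F : {fset I}) : K :=
  \det (\matrix_(a < size F, b < size F)
          M (tnth (in_tuple F) a) (tnth (in_tuple F) b)).

(** Principal minors do not depend on the ordering, so the enumeration [phi] is free; sections of a
    sum type can then be listed in block order. *)
Lemma det_add1_minors n (phi : 'I_n -> I) (F : {fset I}) (M : I -> I -> K) :
  injective phi -> (forall i, (i \in F) = [exists a, phi a == i]) ->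
  \det (1%:M + \matrix_(a, b) M (phi a) (phi b)) =
  \sum_(G <- fpowerset F) minor M G.
Proof.
move=> phi_inj FE; rewrite (big_fpowerset _ phi_inj FE) det_add1_subsets.
apply: eq_bigr => S _; set G := [fset phi a | a in S].
have ex (b : 'I_(size G)) : {a : 'I_n | phi a = tnth (in_tuple G) b}.
  apply: cid; have /imfsetP[/= a _ e] : tnth (in_tuple G) b \in G by exact: mem_tnth.
  by exists a.
pose psi b := sval (ex b).
have psiE b : phi (psi b) = tnth (in_tuple G) b by rewrite /psi; case: (ex b).
rewrite (@det_principal_minor _ _ _ psi S); first last.
- move=> i; have -> : (i \in S) = (phi i \in G).
    by rewrite mem_imfset //= => x y; apply: phi_inj.
  apply/idP/existsP => [iG|[b /eqP <-]]; last by rewrite psiE mem_tnth.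
  have /tnthP[b e] : phi i \in in_tuple G by [].
  by exists b; apply/eqP/phi_inj; rewrite psiE.
- by move=> b c e; apply: (@tnth_fset_inj G); rewrite -!psiE e.
by congr determinant; apply/matrixP => a b; rewrite !mxE !psiE.
Qed.

Lemma minorZ c (M : I -> I -> K) (F : {fset I}) :
  minor (fun i j => c * M i j) F = c ^+ #|` F| * minor M F.
Proof.
rewrite /minor -detZ; congr determinant; apply/matrixP => a b; by rewrite !mxE.
Qed.

Lemma eq_minor (M M' : I -> I -> K) (F : {fset I}) :
  {in F &, M =2 M'} -> minor M F = minor M' F.
Proof.
move=> e; congr determinant; apply/matrixP => a b; rewrite !mxE.
by apply: e; exact: mem_tnth.
Qed.

End SubsetSums.

Section SubsetProducts.
Variables (R : realType) (I : choiceType).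
Local Open Scope fset_scope.

Variables (r : I -> R) (s : R).
Hypothesis r_ge0 : forall i, 0 <= r i.
Hypothesis r_sum : forall F : {fset I}, \sum_(i <- F) r i <= s.

Lemma prod_add1_le_expR (F : {fset I}) : \prod_(i <- F) (1 + r i) <= expR s.
Proof.
apply: (@le_trans _ _ (expR (\sum_(i <- F) r i))); last by rewrite ler_expR.
rewrite expR_sum; apply: ler_prod => i _; rewrite expR_ge1Dx addr_ge0 //.
Qed.

Lemma sum_fset_le_subset (J : choiceType) (f : J -> R) (F G : {fset J}) (P : pred J) :
  (forall j, 0 <= f j) -> F `<=` G -> \sum_(j <- F | P j) f j <= \sum_(j <- G | P j) f j.
Proof.
move=> f0 sFG; rewrite big_mkcond [leRHS]big_mkcond.
rewrite [leRHS](big_fsetID _ (mem F) G) /=.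
have -> : [fset x in G | x \in F] = F.
  apply/fsetP => x; rewrite !inE /= andbC; case: (boolP (x \in F)) => //=.
  by move/(fsubsetP sFG).
by rewrite lerDl sumr_ge0 // => j _; case: ifP.
Qed.

(** The sets in [GG] are subsets of their union, and the sum over all subsets of the union factors
    into terms [1 + r i <= exp (r i)]. *)
Lemma sum_prod_le_expR (GG : {fset {fset I}}) :
  \sum_(G <- GG) \prod_(i <- G) r i <= expR s.
Proof.
pose F := \bigcup_(G <- GG) G.
apply: (@le_trans _ _ (\sum_(G <- fpowerset F) \prod_(i <- G) r i)).
  apply: sum_fset_le_subset => [G|]; first by rewrite prodr_ge0.
  apply/fsubsetP => G GGG; rewrite fpowersetE.
  exact: (bigfcup_sup (P := xpredT) id).
by rewrite sum_prod_fpowerset prod_add1_le_expR.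
Qed.

(** The products of [1 + r i] over finite sets are bounded, and [F0] comes within [eps] of their
    supremum. Enlarging [F0] adds exactly the contributions of the sets not contained in [F0]. Only
    [r] and [eps] determine [F0]. *)
Lemma sum_prod_tail (eps : R) : 0 < eps ->
  exists F0 : {fset I}, forall GG : {fset {fset I}},
    \sum_(G <- GG | ~~ (G `<=` F0)) \prod_(i <- G) r i <= eps.
Proof.
move=> e0; pose A := [set \prod_(i <- F) (1 + r i) | F in [set: {fset I}]]%classic.
have supA : has_sup A.
  split; first by exists (\prod_(i <- fset0) (1 + r i)); exists fset0.
  by exists (expR s) => _ [F _ <-]; exact: prod_add1_le_expR.
have [_ [F0 _ <-] hF0] := sup_adherent e0 supA.
exists F0 => GG; pose F := F0 `|` \bigcup_(G <- GG) G.
have sF0F : fpowerset F0 `<=` fpowerset F.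
  by apply/fsubsetP => G; rewrite !fpowersetE => /fsubset_trans; apply; exact: fsubsetUl.
apply: (@le_trans _ _ (\sum_(G <- fpowerset F | ~~ (G `<=` F0)) \prod_(i <- G) r i)).
  apply: sum_fset_le_subset => [G|]; first by rewrite prodr_ge0.
  apply/fsubsetP => G GGG; rewrite fpowersetE; apply: fsubset_trans (fsubsetUr _ _).
  exact: (bigfcup_sup (P := xpredT) id).
have -> : \sum_(G <- fpowerset F | ~~ (G `<=` F0)) \prod_(i <- G) r i =
    \prod_(i <- F) (1 + r i) - \prod_(i <- F0) (1 + r i).
  rewrite -!sum_prod_fpowerset [X in _ = X - _](bigID (fun G => G `<=` F0)) /=.
  rewrite [X in X + _ - _](_ : _ = \sum_(G <- fpowerset F0) \prod_(i <- G) r i).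
    by rewrite addrAC subrr add0r.
  rewrite -big_filter; apply: perm_big; apply: uniq_perm.
  - by rewrite filter_uniq // fset_uniq.
  - exact: fset_uniq.
  move=> G; rewrite mem_filter !fpowersetE andb_idr // => sG.
  by rewrite (fsubset_trans sG) // fsubsetUl.
have : \prod_(i <- F) (1 + r i) <= sup A.
  by apply: sup_upper_bound => //; exists F.
lra.
Qed.

End SubsetProducts.

(** * Fredholm determinants of dominated matrices *)

Section UsumCauchy.
Variables (R : realType) (J : choiceType) (x : J -> R[i]).
Local Notation C := R[i].
Local Notation nc := (@ComplexField.Normc.normc R).
Local Open Scope fset_scope.

Lemma usum_approx :
  (forall eps : R, 0 < eps -> exists F0 : {fset J}, forall F, F0 `<=` F ->
     nc (\sum_(j <- F) x j - \sum_(j <- F0) x j) <= eps) ->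
  forall eps : R, 0 < eps -> exists F0 : {fset J}, forall F, F0 `<=` F ->
     nc (usum x - \sum_(j <- F) x j) <= eps.
Proof.
move=> h e e0.
have : cvg (@partial_sum J C^o x @ totally)%classic.
  apply: cvgC_complete => e1 /h[F0 hF0]; exists (\sum_(j <- F0) x j).
  by apply/near_totally; exists F0 => F /hF0; rewrite psumE.
move/cvgCP/(_ e e0)/near_totally => [F0 hF0].
by exists F0 => F /hF0; rewrite psumE.
Qed.

Hypothesis x_cauchy : forall eps : R, 0 < eps -> exists F0 : {fset J},
  forall F, F0 `<=` F -> nc (\sum_(j <- F) x j - \sum_(j <- F0) x j) <= eps.

Lemma usum_le (b : R) (F1 : {fset J}) :
  (forall F, F1 `<=` F -> nc (\sum_(j <- F) x j) <= b) -> nc (usum x) <= b.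
Proof.
move=> h; apply/ler_addgt0Pr => e e0; have [F0 hF0] := usum_approx x_cauchy e0.
have := hF0 _ (fsubsetUl F0 F1); have := h _ (fsubsetUr F0 F1) => h1 h2.
rewrite -[usum x](subrK (\sum_(j <- F0 `|` F1) x j)).
by apply: le_trans (ncD _ _) _; rewrite addrC lerD.
Qed.

Lemma usumZ (c : C) : usum (fun j => c * x j) = c * usum x.
Proof.
apply: usum_cvgP => e e0.
have d0 : 0 < e / (1 + nc c) by rewrite divr_gt0 // ltr_wpDr ?nc_ge0.
have [F0 hF0] := usum_approx x_cauchy d0; exists F0 => F /hF0 h.
rewrite -mulr_sumr -mulrBr ncM.
apply: (@le_trans _ _ ((1 + nc c) * (e / (1 + nc c)))).
  by rewrite ler_pM ?nc_ge0 // lerDr.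
by rewrite mulrC divfK // gt_eqF // ltr_wpDr ?nc_ge0.
Qed.

End UsumCauchy.

Section Fredholm.
Variables (R : realType) (I : choiceType) (r : I -> R) (s : R).
Local Notation C := R[i].
Local Notation nc := (@ComplexField.Normc.normc R).
Local Open Scope fset_scope.

Definition dominated (M : I -> I -> C) :=
  forall i (F : {fset I}), \sum_(j <- F) nc (M i j) <= r i.

Definition trace_minors (M : I -> I -> C) (k : nat) : C :=
  usum (fun F : ksubset I k => minor M (val F)).

Definition fredholm_minors (M : I -> I -> C) : C :=
  lim (series (trace_minors M : C^o ^nat)%classic @ \oo)%classic.

Hypothesis r_ge0 : forall i, 0 <= r i.
Hypothesis r_sum : forall F : {fset I}, \sum_(i <- F) r i <= s.

Lemma minor_le (M : I -> I -> C) (F : {fset I}) :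
  dominated M -> nc (minor M F) <= \prod_(i <- F) r i.
Proof.
move=> dM; apply: le_trans (nc_det_le _) _; rewrite [leRHS]big_tnth.
apply: ler_prod => a _; apply/andP; split.
  by apply: sumr_ge0 => b _; exact: nc_ge0.
apply: le_trans (dM _ F); rewrite [leRHS]big_tnth.
by apply: ler_sum => b _; rewrite mxE.
Qed.

Lemma sum_minor_le (M : I -> I -> C) (GG : {fset {fset I}}) (P : pred {fset I}) :
  dominated M ->
  nc (\sum_(G <- GG | P G) minor M G) <= \sum_(G <- GG | P G) \prod_(i <- G) r i.
Proof.
move=> dM; apply: le_trans (nc_sum _ _ _) _; apply: ler_sum => G _.
exact: minor_le.
Qed.

Definition ksubsets k (F : {fset I}) : {fset ksubset I k} :=
  [fset G | G in pmap insub (fpowerset F)].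

Lemma in_ksubsets k (F : {fset I}) (G : ksubset I k) :
  (G \in ksubsets k F) = (val G `<=` F).
Proof. by rewrite !inE /= mem_pmap_sub /= fpowersetE. Qed.

Lemma sum_ksubset (V : nmodType) k (KK : {fset ksubset I k}) (P : pred {fset I})
    (f : {fset I} -> V) :
  \sum_(G <- KK | P (val G)) f (val G) = \sum_(G <- val @` KK | P G) f G.
Proof.
rewrite big_mkcond [RHS]big_mkcond.
by rewrite (big_imfset _ _ (fun G => if P G then f G else 0)) //= => G H _ _; apply: val_inj.
Qed.

Lemma trace_minors_cauchy (M : I -> I -> C) k : dominated M ->
  forall eps : R, 0 < eps -> exists F0 : {fset ksubset I k},
  forall F, F0 `<=` F ->
  nc (\sum_(G <- F) minor M (val G) - \sum_(G <- F0) minor M (val G)) <= eps.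
Proof.
move=> dM e /(sum_prod_tail r_ge0 r_sum)[F0 hF0]; exists (ksubsets k F0) => F sF.
rewrite (bigID (fun G => val G `<=` F0)) /=.
rewrite [X in X + _ - _](_ : _ = \sum_(G <- ksubsets k F0) minor M (val G)).
  rewrite addrAC subrr add0r (sum_ksubset F (fun G => ~~ (G `<=` F0))).
  apply: le_trans (hF0 (val @` F)); exact: sum_minor_le.
rewrite -big_filter; apply: perm_big; apply: uniq_perm.
- by rewrite filter_uniq // fset_uniq.
- exact: fset_uniq.
move=> G; rewrite mem_filter in_ksubsets andb_idr // => sG.
by apply: (fsubsetP sF); rewrite in_ksubsets.
Qed.

Lemma trace_minorsZ (M : I -> I -> C) c k : dominated M ->
  trace_minors (fun i j => c * M i j) k = c ^+ k * trace_minors M k.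
Proof.
move=> dM; rewrite /trace_minors -(usumZ (trace_minors_cauchy _ dM)).
congr usum; apply/funext => G; rewrite minorZ.
by have /eqP -> := valP G.
Qed.

(** On subsets of size [k] the factor [rho ^+ k] is absorbed into the row bounds, which turns
    [exp s] into [exp (rho * s)]. As [rho] is arbitrary, this is the growth condition for an entire
    function. *)
Lemma trace_minors_le (M : I -> I -> C) (rho : R) k : dominated M -> 0 <= rho ->
  nc (trace_minors M k) * rho ^+ k <= expR (rho * s).
Proof.
(* The main argument divides by [rho ^+ k]. For [rho = 0] only [k = 0] has content, where
   [0 ^+ 0 = 1]. *)
move=> dM rho0; have [->|rho_neq0] := eqVneq rho 0.
  rewrite mul0r expR0; case: k => [|k]; last by rewrite expr0n mulr0.
  rewrite expr0 mulr1 /trace_minors; apply: (usum_le (trace_minors_cauchy _ dM) (F1 := fset0)).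
  move=> F _; rewrite (sum_ksubset F xpredT (minor M)) /=.
  apply: le_trans (sum_minor_le _ _ dM) _.
  apply: (@le_trans _ _ (\sum_(G <- val @` F) \prod_(i <- G) (0 * r i))).
    rewrite big_seq [leRHS]big_seq; apply: ler_sum => G /imfsetP[/= H _ ->].
    by have /eqP/cardfs0_eq -> := valP H; rewrite !big_seq_fset0.
  rewrite -[leRHS]expR0; apply: sum_prod_le_expR => [i|F']; first by rewrite mul0r.
  by rewrite big1 // => i _; rewrite mul0r.
have rho_gt0 : 0 < rho by rewrite lt_neqAle eq_sym rho_neq0.
rewrite -ler_pdivlMr ?exprn_gt0 //.
apply: (usum_le (trace_minors_cauchy _ dM) (F1 := fset0)) => F _.
rewrite ler_pdivlMr ?exprn_gt0 // (sum_ksubset F xpredT (minor M)).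
apply: (@le_trans _ _ (\sum_(G <- val @` F) \prod_(i <- G) (rho * r i))); last first.
  apply: sum_prod_le_expR => [i|F']; first by rewrite mulr_ge0.
  by rewrite -mulr_sumr ler_wpM2l.
rewrite (eq_big_seq (fun G : {fset I} => rho ^+ k * \prod_(i <- G) r i)); last first.
  move=> _ /imfsetP[/= [G kG] _ ->] /=; rewrite -(eqP kG).
  by rewrite big_split /= big_const_seq count_predT -Monoid.iteropE.
rewrite -mulr_sumr mulrC ler_wpM2l ?exprn_ge0 //; exact: sum_minor_le.
Qed.

(** Each trace is itself a limit over finite families, so a partial sum of the determinant series is
    first approximated by one family [GG]. As [GG] contains all subsets of [F] of size below [N], it
    can then be compared with the power set of [F]. *)
Lemma trace_minors_partial (M : I -> I -> C) (F : {fset I}) N : dominated M ->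
  forall eps : R, 0 < eps -> exists GG : {fset {fset I}},
  [/\ forall G, G \in GG -> (#|` G| < N)%N,
      forall G, G `<=` F -> (#|` G| < N)%N -> G \in GG &
      nc (\sum_(k < N) trace_minors M k - \sum_(G <- GG) minor M G) <= eps].
Proof.
move=> dM; elim: N => [|N IH] e e0.
  exists fset0; split => //; by rewrite big_ord0 big_seq_fset0 subrr nc0 ltW.
have e2 : 0 < e / 2 by rewrite divr_gt0.
have [GG [h1 h2 h3]] := IH _ e2.
have [K0 hK0] := usum_approx (trace_minors_cauchy N dM) e2.
pose KK := K0 `|` ksubsets N F.
exists (GG `|` val @` KK); split.
- move=> G; rewrite inE => /orP[/h1/ltnW //|/imfsetP[/= H _ ->]].
  by have /eqP -> := valP H.
- move=> G sG; rewrite ltnS leq_eqVlt inE => /orP[/eqP kG|/h2-> //].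
  apply/orP; right; apply/imfsetP.
  have kG' : #|` G| == N by apply/eqP.
  exists (exist _ G kG') => //=; rewrite inE in_ksubsets /= sG orbT //.
rewrite big_ord_recr /= (big_fsetID _ (mem GG)) /=.
have -> : [fset x in GG `|` val @` KK | x \in GG] = GG.
  by apply/fsetP => x; rewrite !inE /=; case: (x \in GG); rewrite ?andbF.
have -> : [fset x in GG `|` val @` KK | x \notin GG] = val @` KK.
  apply/fsetP => x; rewrite !inE /=; case: (boolP (x \in GG)) => //= xGG; last first.
    by rewrite andbT.
  apply/esym/imfsetP => -[/= H _ xH].
  by have := h1 _ xGG; rewrite xH; have /eqP -> := valP H; rewrite ltnn.
rewrite -(sum_ksubset KK xpredT (minor M)) /= opprD addrACA.
apply: le_trans (ncD _ _) _; rewrite (splitr e) lerD //.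
by apply: hK0; exact: fsubsetUl.
Qed.

(** [F0] is chosen before [M]: the tail of the products of row bounds controls the error for all
    dominated matrices at once. *)
Lemma fredholm_minors_approx (eps : R) : 0 < eps ->
  exists F0 : {fset I}, forall M, dominated M -> forall F, F0 `<=` F ->
    nc (fredholm_minors M - \sum_(G <- fpowerset F) minor M G) <= eps.
Proof.
have key e : 0 < e -> exists F0 : {fset I}, forall M, dominated M ->
    forall F, F0 `<=` F -> forall N, (#|` F| < N)%N ->
    nc (\sum_(k < N) trace_minors M k - \sum_(G <- fpowerset F) minor M G) <= e.
  move=> /(sum_prod_tail r_ge0 r_sum)[F0 hF0]; exists F0 => M dM F sF N FN.
  apply/ler_addgt0Pr => e1 /(trace_minors_partial F N dM)[GG [h1 h2 h3]].
  rewrite -(subrKA (\sum_(G <- GG) minor M G)).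
  apply: le_trans (ncD _ _) _; rewrite addrC lerD // (bigID (fun G => G `<=` F)) /=.
  rewrite [X in X + _ - _](_ : _ = \sum_(G <- fpowerset F) minor M G).
    rewrite addrAC subrr add0r; apply: le_trans (sum_minor_le _ _ dM) _.
    apply: le_trans (hF0 GG); rewrite big_mkcond [leRHS]big_mkcond.
    apply: ler_sum => G _; case: ifPn => [nGF|_]; last by case: ifP; rewrite ?prodr_ge0.
    by rewrite ifT //; apply: contra nGF => /fsubset_trans; apply.
  rewrite -big_filter; apply: perm_big; apply: uniq_perm.
  - by rewrite filter_uniq // fset_uniq.
  - exact: fset_uniq.
  move=> G; rewrite mem_filter fpowersetE andb_idr // => sG; apply: h2 => //.
  exact: leq_ltn_trans (fsubset_leq_card sG) FN.
move=> e0; have e2 : 0 < eps / 2 by rewrite divr_gt0.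
have [F0 hF0] := key _ e2; exists F0 => M dM F sF.
have serE N : series (trace_minors M : C^o ^nat)%classic N = \sum_(k < N) trace_minors M k.
  by rewrite /series /= big_mkord.
have : cvg (series (trace_minors M : C^o ^nat)%classic @ \oo)%classic.
  apply: cvgC_complete => e1 /key[F1 hF1].
  exists (\sum_(G <- fpowerset F1) minor M G).
  exists #|` F1|.+1 => // N /= hN; rewrite serE; exact: hF1.
(* The number of terms exceeds both the threshold of convergence and the size of [F], so every
   subset of [F] is counted. *)
move/cvgCP/(_ _ e2) => [N0 _ /(_ (maxn N0 #|` F|.+1))] h.
have {h} := h (leq_maxl _ _); rewrite serE => h.
rewrite -(subrKA (\sum_(k < maxn N0 #|` F|.+1) trace_minors M k)).
apply: le_trans (ncD _ _) _; rewrite (splitr eps) lerD //; apply: hF0 => //.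
exact: leq_maxr.
Qed.

(* [M'] may differ from [M] far away, which allows sections of the Ihara matrix with
   truncated [B_2]. *)
Lemma fredholm_minors_section (eps : R) : 0 < eps ->
  exists F0 : {fset I}, forall M M', dominated M -> dominated M' ->
    {in F0 &, M =2 M'} -> forall n (phi : 'I_n -> I), injective phi ->
    (forall i, i \in F0 -> exists a, phi a = i) ->
    nc (fredholm_minors M - \det (1%:M + \matrix_(a, b) M' (phi a) (phi b))) <= eps.
Proof.
move=> e0; have e3 : 0 < eps / 3 by rewrite divr_gt0.
have [F0 hF0] := fredholm_minors_approx e3; exists F0 => M M' dM dM' MM' n phi phi_inj F0phi.
pose F := [fset phi a | a in 'I_n].
have FE i : (i \in F) = [exists a, phi a == i].
  apply/imfsetP/existsP => /= [[a _ ->]|[a /eqP <-]]; [by exists a|by exists a].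
have sF : F0 `<=` F.
  by apply/fsubsetP => i /F0phi[a ai]; rewrite FE; apply/existsP; exists a; apply/eqP.
rewrite (det_add1_minors M' phi_inj FE).
(* Three comparisons: the determinant of [M] with the minors inside [F0], which [M] and [M'] share;
   these with the determinant of [M']; and that with the minors of [M'] inside [F]. *)
have h1 := hF0 _ dM _ (fsubset_refl _); have h2 := hF0 _ dM' _ (fsubset_refl _).
have h3 := hF0 _ dM' _ sF.
rewrite -(subrKA (\sum_(G <- fpowerset F0) minor M G)).
apply: le_trans (ncD _ _) _; have -> : eps = (eps / 3 + (eps / 3 + eps / 3))%R by lra.
apply: lerD => //; rewrite -(subrKA (fredholm_minors M')).
apply: le_trans (ncD _ _) _; apply: lerD => //; rewrite ncB.
rewrite [X in _ - X](_ : _ = \sum_(G <- fpowerset F0) minor M' G) //.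
apply: eq_big_seq => G; rewrite fpowersetE => /fsubsetP sG; apply: eq_minor.
by move=> i j /sG iG /sG jG; apply: MM'.
Qed.

End Fredholm.

(** * Power series *)

Section PowerSeries.
Variable R : realType.
Local Notation C := R[i].
Local Notation nc := (@ComplexField.Normc.normc R).
Local Open Scope classical_set_scope.

Lemma half_pow_small (K eps : R) : 0 < eps ->
  exists N, forall n, (N <= n)%N -> K * (2^-1) ^+ n <= eps.
Proof.
move=> e0; exists (Num.bound (K / eps)) => n hn.
have h : K / eps <= n%:R.
  apply: le_trans (ler_norm _) _; apply/ltW/(lt_le_trans (archi_boundP (normr_ge0 _))).
  by rewrite ler_nat; move: hn; rewrite /Num.bound normr_id.
rewrite exprVn ler_pdivrMr ?exprn_gt0 // -ler_pdivrMl // mulrC.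
apply: le_trans h _; rewrite -natrX ler_nat; exact/ltnW/ltn_expl.
Qed.

Lemma sum_half_pow n m : (n <= m)%N ->
  \sum_(n <= k < m) (2^-1 : R) ^+ k <= 2 * (2^-1) ^+ n.
Proof.
move=> nm; suff -> : \sum_(n <= k < m) (2^-1 : R) ^+ k = 2 * (2^-1) ^+ n - 2 * (2^-1) ^+ m.
  by rewrite gerBl mulr_ge0 // exprn_ge0 // invr_ge0.
elim: m nm => [|m IH]; first by rewrite leqn0 => /eqP ->; rewrite big_geq // subrr.
rewrite leq_eqVlt => /orP[/eqP->|]; first by rewrite big_geq // subrr.
by rewrite ltnS => nm; rewrite big_nat_recr //= IH // exprS; lra.
Qed.

Lemma series_diff_le (a : nat -> C) (K : R) n m : 0 <= K ->
  (forall k, nc (a k) <= K * (2^-1) ^+ k) -> (n <= m)%N ->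
  nc (\sum_(0 <= k < m) a k - \sum_(0 <= k < n) a k) <= 2 * K * (2^-1) ^+ n.
Proof.
move=> K0 h nm; rewrite (big_cat_nat (leq0n n) nm) /= addrAC subrr add0r.
apply: le_trans (nc_sum _ _ _) _.
apply: (@le_trans _ _ (\sum_(n <= k < m) K * (2^-1) ^+ k)).
  by apply: ler_sum => k _; exact: h.
by rewrite -mulr_sumr [2 * K]mulrC -mulrA ler_wpM2l // sum_half_pow.
Qed.

Lemma series_geometric_cvg (a : nat -> C) (K : R) : 0 <= K ->
  (forall k, nc (a k) <= K * (2^-1) ^+ k) -> cvg (series (a : C^o ^nat) @ \oo).
Proof.
move=> K0 h; apply: cvgC_complete => e e0.
have [N hN] := half_pow_small (2 * K) e0.
exists (series (a : C^o ^nat) N); exists N => // n /= Nn.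
apply: le_trans (hN _ (leqnn N)); exact: series_diff_le.
Qed.

Lemma series_lim_le (a : nat -> C) (b : R) : cvg (series (a : C^o ^nat) @ \oo) ->
  (forall n, nc (\sum_(0 <= k < n) a k) <= b) ->
  nc (lim (series (a : C^o ^nat) @ \oo)) <= b.
Proof.
move=> ca h; apply/ler_addgt0Pr => e e0.
have /cvgCP/(_ _ e0)[N _ /(_ N (leqnn N)) hN] := ca.
rewrite -[lim _](subrK (series (a : C^o ^nat) N)).
by apply: le_trans (ncD _ _) _; rewrite addrC lerD // /series; exact: h.
Qed.

Lemma nc_nat n : nc n%:R = n%:R.
Proof. by rewrite -[RHS](nc_real_ge0 (ler0n R n)) rmorph_nat. Qed.

(** For [n > 0] the left side is a single term of the binomial expansion of the right side. *)
Lemma natr_exp_le (v : R) n : 0 <= v -> n%:R * v ^+ n.-1 <= (v + 1) ^+ n.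
Proof.
move=> v0; elim: n => [|n IH]; first by rewrite mul0r expr0.
have -> : n.+1%:R * v ^+ n = v * (n%:R * v ^+ n.-1) + v ^+ n.
  case: n {IH} => [|n]; first by rewrite mul0r mulr0 add0r mul1r.
  by rewrite mulrCA -exprS -[n.+2%:R]natr1 mulrDl mul1r.
rewrite exprS mulrDl mul1r lerD //; first by rewrite ler_wpM2l.
by rewrite lerXn2r ?nnegrE ?addr_ge0 // lerDl.
Qed.

(** Induction on [n]: the old remainder is multiplied by [u + h], of modulus at most [nc u + 1], and
    a new term of size at most [nc h ^+ 2 * (nc u + 1) ^+ n] appears. The base [nc u + 2] leaves
    room for both. *)
Lemma taylor1_bound (u h : C) n : nc h <= 1 ->
  nc ((u + h) ^+ n - u ^+ n - h * (n%:R * u ^+ n.-1)) <= nc h ^+ 2 * (nc u + 2) ^+ n.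
Proof.
move=> h1; elim: n => [|n IH].
  by rewrite !expr0 mul0r mulr0 !subrr nc0 mulr1 exprn_ge0 // nc_ge0.
have -> : (u + h) ^+ n.+1 - u ^+ n.+1 - h * (n.+1%:R * u ^+ n) =
   (u + h) * ((u + h) ^+ n - u ^+ n - h * (n%:R * u ^+ n.-1))
   + h ^+ 2 * (n%:R * u ^+ n.-1).
  case: n {IH} => [|n]; first by rewrite !expr0 !expr1; ring.
  by rewrite !exprS -[n.+2%:R]natr1 /=; ring.
apply: le_trans (ncD _ _) _; rewrite !ncM ncX.
have -> : nc h ^+ 2 * (nc u + 2) ^+ n.+1 =
    (nc u + 1) * (nc h ^+ 2 * (nc u + 2) ^+ n) + nc h ^+ 2 * (nc u + 2) ^+ n.
  by rewrite [_ ^+ n.+1]exprS; ring.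
have nu := nc_ge0 u; have nh := nc_ge0 h.
apply: lerD.
  apply: ler_pM; rewrite ?nc_ge0 //; apply: le_trans (ncD _ _) _.
  by rewrite lerD2l.
rewrite ler_wpM2l ?mulr_ge0 //.
rewrite nc_nat.
apply: le_trans (natr_exp_le _ nu) _.
by rewrite lerXn2r ?nnegrE ?addr_ge0 // lerD2l ler1n.
Qed.

(** The derivative is exhibited as the termwise derivative [g]: summing second-order remainders
    gives [|f (u + h) - f u - h g| <= 2 K |h|^2] for [|h| <= 1]. *)
Lemma entire_power_series (e : nat -> C) :
  (forall rho : R, 0 <= rho -> exists K, forall n, nc (e n) * rho ^+ n <= K) ->
  entire (fun u => lim (series ((fun n => u ^+ n * e n) : C^o ^nat) @ \oo)).
Proof.
move=> he u; set f := fun u => _.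
(* The coefficient bound at radius [2 * rho] supplies the factor [2^-n] that makes the series at
   radius [rho] geometric. *)
have geo (b : nat -> R) (rho c : R) : 0 <= rho -> 0 <= c ->
    (forall n, 0 <= b n <= c * rho ^+ n) ->
    exists K, 0 <= K /\ forall n, b n * nc (e n) <= c * K * (2^-1) ^+ n.
  move=> rho0 c0 hb; have [|K hK] := he (2 * rho); first by rewrite mulr_ge0.
  exists K; split; first by have := hK 0%N; rewrite expr0 mulr1; apply: le_trans; exact: nc_ge0.
  move=> n; have := hK n; have /andP[b0 bn] := hb n => hKn.
  apply: (@le_trans _ _ (c * rho ^+ n * nc (e n))); first by rewrite ler_wpM2r ?nc_ge0.
  rewrite -!mulrA ler_wpM2l // exprVn ler_pdivlMr ?exprn_gt0 //.
  by move: hKn; rewrite exprMn; apply: le_trans; rewrite le_eqVlt; apply/orP; left; apply/eqP; ring.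
have cf v : cvg (series ((fun n => v ^+ n * e n) : C^o ^nat) @ \oo).
  have [|K [K0 hK]] := geo (fun n => nc v ^+ n) (nc v) 1 (nc_ge0 _) ler01.
    by move=> n; rewrite mul1r lexx exprn_ge0 ?nc_ge0.
  apply: (@series_geometric_cvg _ (1 * K)); rewrite ?mul1r // => k.
  by rewrite ncM ncX -[leRHS]mul1r mulrA.
pose g := lim (series ((fun n => (n%:R * u ^+ n.-1) * e n) : C^o ^nat) @ \oo).
have cg : cvg (series ((fun n => (n%:R * u ^+ n.-1) * e n) : C^o ^nat) @ \oo).
  have [|||K [K0 hK]] := geo (fun n => n%:R * nc u ^+ n.-1) (nc u + 1) 1.
  - by rewrite addr_ge0 ?nc_ge0.
  - exact: ler01.
  - move=> n; rewrite mul1r natr_exp_le ?nc_ge0 // andbT.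
    by rewrite mulr_ge0 // exprn_ge0 ?nc_ge0.
  apply: (@series_geometric_cvg _ (1 * K)); rewrite ?mul1r // => k.
  rewrite !ncM ncX nc_nat.
  by rewrite -[leRHS]mul1r mulrA.
have [||K [K0 hK]] := geo (fun n => (nc u + 2) ^+ n) (nc u + 2) 1 _ ler01.
- by rewrite addr_ge0 ?nc_ge0.
- by move=> n; rewrite mul1r lexx exprn_ge0 // addr_ge0 ?nc_ge0.
have key h : nc h <= 1 -> nc (f (u + h) - f u - h * g) <= 2 * K * nc h ^+ 2.
  move=> h1.
  pose d n := ((u + h) ^+ n - u ^+ n - h * (n%:R * u ^+ n.-1)) * e n.
  have cd : series (d : C^o ^nat) @ \oo --> (f (u + h) - f u - h * g : C^o).
    have -> : series (d : C^o ^nat) =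
       (fun n => series ((fun n => (u + h) ^+ n * e n) : C^o ^nat) n -
         series ((fun n => u ^+ n * e n) : C^o ^nat) n -
         h *: series ((fun n => (n%:R * u ^+ n.-1) * e n) : C^o ^nat) n).
      apply/funext => n; rewrite /series /= -[_ *: _]/(_ * _) mulr_sumr -!sumrB.
      by apply: eq_bigr => i _; rewrite /d; ring.
    apply: cvgB; last by apply: cvgZr; exact: cg.
    by apply: cvgB; exact: cf.
  rewrite -(cvg_lim _ cd) //; apply: series_lim_le; first by apply/cvg_ex; eexists; exact: cd.
  move=> n; apply: le_trans (nc_sum _ _ _) _.
  apply: (@le_trans _ _ (\sum_(0 <= k < n) (nc h ^+ 2 * K) * (2^-1) ^+ k)).
    apply: ler_sum => k _; rewrite ncM -mulrA; have := hK k; rewrite mul1r => hk.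
    apply: le_trans (ler_wpM2l _ hk); last by rewrite exprn_ge0 ?nc_ge0.
    by rewrite [leRHS]mulrA ler_wpM2r ?nc_ge0 // taylor1_bound.
  rewrite -mulr_sumr.
  have -> : 2 * K * nc h ^+ 2 = (nc h ^+ 2 * K) * (2 * (2^-1) ^+ 0) by rewrite expr0; ring.
  by rewrite ler_wpM2l ?sum_half_pow // mulr_ge0 // exprn_ge0 ?nc_ge0.
apply/cvg_ex; exists (g : C^o); apply/cvgCP => eps eps0.
(* The summand 1 keeps the denominator positive when [K = 0]; the minimum with 1 keeps [h] where the
   remainder bound applies. *)
have d0 : 0 < Num.min 1 (eps / (2 * K + 1)).
  by rewrite lt_min ltr01 divr_gt0 // ltr_wpDl // mulr_ge0.
apply/nbhsCP; exists (Num.min 1 (eps / (2 * K + 1))) => // h.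
rewrite subr0 le_min => /andP[h1 heps] h0.
have nh : 0 < nc h by rewrite lt_neqAle eq_sym nc_eq0 h0 nc_ge0.
rewrite -[_ *: _]/(_ * _) -[h *: 1]/(h * 1) mulr1 /= [h + u]addrC ncB.
have -> : h^-1 * (f (u + h) - f u) - g = h^-1 * (f (u + h) - f u - h * g).
  by rewrite [RHS]mulrBr mulKf.
rewrite ncM ncV -ler_pdivlMl ?invr_gt0 // invrK; apply: le_trans (key _ h1) _.
rewrite expr2 mulrA mulrC; apply: ler_wpM2l; first exact: ltW.
have K1 : 0 < 2 * K + 1 by rewrite ltr_wpDl // mulr_ge0.
move: heps; rewrite ler_pdivlMr // => /(le_trans _); apply.
lra.
Qed.

End PowerSeries.

(** * The finite Bass identity *)

Section BassDeterminant.
Variable K : comNzRingType.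

(* Right multiplication by the unipotent [1, 0; Y, 1] with [Y = t - u J t] turns
   the matrix on the left into [1, u s; t, 1 + u J]. *)
Lemma bass_determinant p q (s : 'M[K]_(p, q)) (t : 'M_(q, p)) (J : 'M_q) (u : K) :
  \det (1%:M + block_mx (u *: (u *: (s *m J *m t) - s *m t)) (u *: s)
                        (u *: (u *: (J *m J *m t))) (u *: J)) =
  \det (1%:M - u *: (t *m s - J)).
Proof.
pose Y := t - u *: (J *m t).
have := mulmx_block (1%:M + u *: (u *: (s *m J *m t) - s *m t)) (u *: s)
  (u *: (u *: (J *m J *m t))) (1%:M + u *: J) 1%:M 0 Y 1%:M.
rewrite !mulmx1 !mulmx0 !add0r.
have -> : 1%:M + u *: (u *: (s *m J *m t) - s *m t) + u *: s *m Y = 1%:M.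
  rewrite /Y mulmxBr -!scalemxAl -scalemxAr mulmxA.
  move: (s *m J *m t) (s *m t) => a b.
  by apply/matrixP => i j; rewrite !mxE; ring.
have -> : u *: (u *: (J *m J *m t)) + (1%:M + u *: J) *m Y = t.
  rewrite /Y mulmxDl mul1mx mulmxBr -!scalemxAl -!scalemxAr mulmxA.
  move: (J *m J *m t) (J *m t) => a b.
  by apply/matrixP => i j; rewrite !mxE; ring.
move/(congr1 determinant); rewrite det_mulmx det_lblock !det1 !mulr1 det_block1.
rewrite (scalar_mx_block _ _ 1) add_block_mx !add0r => ->; congr determinant.
rewrite -scalemxAr; move: (t *m s) => a.
by apply/matrixP => i j; rewrite !mxE; ring.
Qed.

End BassDeterminant.

Section UniqSums.
Variable R : realType.

Lemma ler_sum_uniq_sub (T : eqType) (s t : seq T) (f : T -> R) (P : pred T) :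
  uniq s -> {subset s <= t} -> (forall x, 0 <= f x) ->
  \sum_(x <- s | P x) f x <= \sum_(x <- t | P x) f x.
Proof.
move=> us; elim: s us t => [|x s IH] /= => [_ t _ f0|/andP[xs us] t st f0].
  by rewrite big_nil sumr_ge0.
have xt : x \in t by apply: st; rewrite inE eqxx.
rewrite (perm_big _ (perm_to_rem xt)) !big_cons.
have h : \sum_(j <- s | P j) f j <= \sum_(j <- rem x t | P j) f j.
  apply: IH => // y ys; have : y \in t by apply: st; rewrite inE ys orbT.
  rewrite (perm_mem (perm_to_rem xt)) inE => /orP[/eqP yx|//].
  by rewrite yx (negPf xs) in ys.
by case: ifP; rewrite ?lerD2l.
Qed.

Lemma sum_uniq_indicator (T : eqType) (s : seq T) (a : T) (c : R) (p : pred T) :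
  uniq s -> 0 <= c -> (forall x, p x -> x = a) ->
  \sum_(x <- s) c * (p x)%:R <= c.
Proof.
move=> us c0 pa.
apply: (@le_trans _ _ (\sum_(x <- s | x == a) c)).
  rewrite [leRHS]big_mkcond; apply: ler_sum => x _.
  case: (boolP (p x)) => [/pa ->|_]; first by rewrite eqxx mulr1.
  by rewrite mulr0; case: ifP.
rewrite big_const_seq iter_addr addr0 (count_uniq_mem _ us).
by case: (a \in s).
Qed.

(** A duplicate-free list that is not exhaustive can be lengthened, and the bound [M] stops this;
    the induction is on the room [M - size s] that is left. *)
Lemma exists_uniq_enum (T : eqType) (P : pred T) (M : nat) :
  (forall s, uniq s -> all P s -> (size s <= M)%N) ->
  exists s, [/\ uniq s, forall x, (x \in s) = P x & (size s <= M)%N].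
Proof.
move=> h; suff : forall n s, uniq s -> all P s -> (M - size s <= n)%N ->
    exists s, [/\ uniq s, forall x, (x \in s) = P x & (size s <= M)%N].
  by move=> /(_ M [::] isT isT); apply; rewrite leq_subr.
elim=> [|n IH] s us Ps hs.
all: have sM := h s us Ps.
all: case: (pselect (exists2 x, P x & x \notin s)) => [[x Px xs]|nx]; last first.
1,3: exists s; split=> // x; apply/idP/idP => [|Px]; [exact: (allP Ps)|];
  by apply/negPn/negP => xs; apply: nx; exists x.
all: have := h (x :: s); rewrite /= xs us Px Ps => /(_ isT isT) h1.
  by move: hs; rewrite leqn0 subn_eq0 leqNgt h1.
apply: (IH (x :: s)); rewrite /= ?xs ?Px //.
by rewrite subnS -ltnS prednK // subn_gt0.
Qed.

End UniqSums.

(** * Weighted graphs *)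

Section Edges.
Variable X : sgraph.
Implicit Types (x y : X) (e f : oedge X).

Lemma edge_eq e f : orig e = orig f -> term e = term f -> e = f.
Proof.
move: e f => [[a b] /= ab] [[c d] /= cd]; rewrite /orig /term /= => ac bd.
by apply: val_inj => /=; rewrite ac bd.
Qed.

Lemma orig_einv e : orig (einv e) = term e. Proof. by []. Qed.
Lemma term_einv e : term (einv e) = orig e. Proof. by []. Qed.

Lemma einvK : involutive (@einv X).
Proof. by move=> e; apply: edge_eq. Qed.

Lemma einv_inj : injective (@einv X).
Proof. exact: (can_inj einvK). Qed.

Lemma adj_edge e : adj (orig e) (term e).
Proof. exact: (valP e). Qed.

Lemma edge_exists x y : adj x y -> exists2 e, orig e = x & term e = y.
Proof. by move=> xy; exists (exist (fun p : X * X => adj p.1 p.2) (x, y) xy). Qed.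

Lemma exists_out_edges : bounded_valency X ->
  exists (M : nat) (out : X -> seq (oedge X)),
  [/\ forall x, uniq (out x), forall x e, (e \in out x) = (orig e == x) &
      forall x, (size (out x) <= M)%N].
Proof.
case=> M hM; exists M.
have h x : {s : seq (oedge X) | [/\ uniq s, forall e, (e \in s) = (orig e == x) &
    (size s <= M)%N]}.
  apply: cid; apply: exists_uniq_enum => s us /allP sx.
  rewrite -(size_map (@term X)); apply: (hM x).
    rewrite map_inj_in_uniq // => e f /sx/eqP ex /sx/eqP fx.
    by apply: edge_eq; rewrite ex fx.
  by apply/allP => y /mapP[e /sx/eqP <- ->]; exact: adj_edge.
by exists (fun x => sval (h x)); split=> x; case: (svalP (h x)).
Qed.

Variables (R : realType) (w : oedge X -> R).

Lemma wt_edge e : wt w (orig e) (term e) = w e.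
Proof.
rewrite /wt; case: insubP => [f _ fe|]; last by rewrite adj_edge.
by congr w; apply: val_inj; rewrite fe /orig /term -surjective_pairing.
Qed.

Lemma wt_nadj x y : ~~ adj x y -> wt w x y = 0.
Proof. by move=> xy; rewrite /wt insubF //=; apply/negbTE. Qed.

(** Replaces sums in the extended reals by a bound on finite sums, the form in which finite total
    weight and square summability are used below. *)
Lemma summable_uniq_sums (I : choiceType) (f : I -> R) : (forall i, 0 <= f i) ->
  esum.summable [set: I] (fun i => (f i)%:E) ->
  exists s : R, forall t : seq I, uniq t -> \sum_(i <- t) f i <= s.
Proof.
move=> f0; rewrite /esum.summable => fin.
have fE : (\esum_(i in [set: I]) (f i)%:E)%E \is a fin_num.
  rewrite ge0_fin_numE; last by apply: esum_ge0 => i _; rewrite lee_fin.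
  by apply: le_lt_trans fin; apply: le_esum => i _; rewrite lee_fin ler_norm.
exists (fine (\esum_(i in [set: I]) (f i)%:E)%E) => t ut.
rewrite -lee_fin fineK //; apply: esum_ge; exists [set` t]%classic.
  by split => //; exact: finite_seq.
by rewrite -fsbig_seq // sumEFin.
Qed.

End Edges.

Section Weights.
Variables (R : realType) (X : sgraph) (w : oedge X -> R).
Variables (M : nat) (out : X -> seq (oedge X)) (sW : R).
Hypothesis w_gt0 : forall e, 0 < w e.
Hypothesis out_uniq : forall x, uniq (out x).
Hypothesis out_mem : forall x e, (e \in out x) = (orig e == x).
Hypothesis out_size : forall x, (size (out x) <= M)%N.
Hypothesis w_sum : forall t, uniq t -> \sum_(e <- t) w e <= sW.

Let w_ge0 e : 0 <= w e. Proof. exact: ltW. Qed.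

Lemma sW_ge0 : 0 <= sW.
Proof. by have := w_sum (t := [::]) isT; rewrite big_nil. Qed.

Lemma w_le_total e : w e <= sW.
Proof. by have := w_sum (t := [:: e]) isT; rewrite big_seq1. Qed.

Lemma w_einv_sum t : uniq t -> \sum_(e <- t) w (einv e) <= sW.
Proof.
move=> ut; rewrite -(big_map (@einv X) xpredT w); apply: w_sum.
by rewrite map_inj_uniq //; exact: einv_inj.
Qed.

Definition out_weight x := \sum_(e <- out x) w e.
(** The diagonal entry of [B_2] at [x], written over edges instead of neighbours. *)
Definition back_weight x := \sum_(e <- out x) w e * w (einv e).

Lemma out_weight_ge0 x : 0 <= out_weight x.
Proof. exact: sumr_ge0. Qed.

Lemma back_weight_ge0 x : 0 <= back_weight x.
Proof. by apply: sumr_ge0 => e _; rewrite mulr_ge0. Qed.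

Lemma back_weight_le x : back_weight x <= sW * out_weight x.
Proof.
rewrite /out_weight mulr_sumr; apply: ler_sum => e _.
by rewrite mulrC ler_wpM2r // w_le_total.
Qed.

Lemma sum_orig_le x t : uniq t -> \sum_(e <- t | orig e == x) w e <= out_weight x.
Proof.
move=> ut; rewrite -big_filter -[leRHS]big_filter filter_predT.
apply: (ler_sum_uniq_sub xpredT) => //; first by rewrite filter_uniq.
by move=> e; rewrite mem_filter out_mem => /andP[].
Qed.

Lemma out_weightE x (t : seq (oedge X)) : uniq t -> {subset out x <= t} ->
  out_weight x = \sum_(e <- t | orig e == x) w e.
Proof.
move=> ut st; rewrite -big_filter; apply: perm_big; apply: uniq_perm => //.
  exact: filter_uniq.
by move=> e; rewrite mem_filter -out_mem andb_idr //; apply: st.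
Qed.

Lemma sum_wt_le x s : uniq s -> \sum_(y <- s) wt w x y <= out_weight x.
Proof.
move=> us; apply: (@le_trans _ _ (\sum_(y <- s) \sum_(e <- out x) w e * (term e == y)%:R)).
  apply: ler_sum => y _; case: (boolP (adj x y)) => [|/wt_nadj->]; last first.
    by apply: sumr_ge0 => e _; rewrite mulr_ge0.
  case/edge_exists => e ex ey; rewrite -ex -ey wt_edge.
  have eo : e \in out x by rewrite out_mem ex.
  rewrite ex (big_rem e) //= eqxx mulr1 lerDl sumr_ge0 // => f _.
  by rewrite mulr_ge0.
rewrite exchange_big /=; apply: ler_sum => e _.
by apply: (sum_uniq_indicator (a := term e)) => // y /eqP ->.
Qed.

Lemma sum_out_weight_le s : uniq s -> \sum_(x <- s) out_weight x <= sW.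
Proof.
move=> us; pose t := undup (flatten [seq out x | x <- s]).
have ut : uniq t by exact: undup_uniq.
rewrite (eq_big_seq (fun x => \sum_(e <- t) w e * (orig e == x)%:R)); last first.
  move=> x xs; rewrite (@out_weightE x t) //; last first.
    by move=> e ex; rewrite mem_undup; apply/flatten_mapP; exists x.
  by rewrite big_mkcond; apply: eq_bigr => e _; case: ifP; rewrite ?mulr1 ?mulr0.
rewrite exchange_big /=; apply: le_trans (w_sum ut); apply: ler_sum => e _.
by apply: (sum_uniq_indicator (a := orig e)) => // y /eqP ->.
Qed.

(** Exchanging the sums counts [w f] once for every listed edge that ends at the origin of [f].
    Reversal maps these edges injectively into [out (orig f)], so there are at most [M] of them. *)
Lemma sum_out_weight_term_le s : uniq s ->
  \sum_(e <- s) out_weight (term e) <= M%:R * sW.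
Proof.
move=> us; pose t := undup (flatten [seq out (term e) | e <- s]).
have ut : uniq t by exact: undup_uniq.
rewrite (eq_big_seq (fun e => \sum_(f <- t) w f * (orig f == term e)%:R)); last first.
  move=> x xs; rewrite (@out_weightE _ t) //; last first.
    by move=> e ex; rewrite mem_undup; apply/flatten_mapP; exists x.
  by rewrite big_mkcond; apply: eq_bigr => e _; case: ifP; rewrite ?mulr1 ?mulr0.
rewrite exchange_big /=.
apply: (@le_trans _ _ (\sum_(f <- t) M%:R * w f)); last first.
  by rewrite -mulr_sumr ler_wpM2l // w_sum.
apply: ler_sum => f _; rewrite -mulr_sumr mulrC ler_wpM2r //.
have -> : \sum_(e <- s) ((orig f == term e)%:R : R) = (count (fun e => orig f == term e) s)%:R.
  by rewrite -sum1_count natr_sum [RHS]big_mkcond; apply: eq_bigr => e _; case: ifP.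
rewrite ler_nat; apply: leq_trans (out_size (orig f)).
rewrite -size_filter -(size_map (@einv X)); apply: uniq_leq_size.
  by rewrite map_inj_uniq ?filter_uniq //; exact: einv_inj.
by move=> _ /mapP[e + ->]; rewrite mem_filter out_mem orig_einv eq_sym => /andP[].
Qed.

End Weights.

(** * The matrix of the Ihara operator *)

Section SumType.
Variables (A B : eqType) (V : nmodType).

Definition inl_part (s : seq (A + B)) : seq A :=
  pmap (fun k => if k is inl a then Some a else None) s.
Definition inr_part (s : seq (A + B)) : seq B :=
  pmap (fun k => if k is inr b then Some b else None) s.

Lemma mem_inl_part s a : (a \in inl_part s) = (inl a \in s).
Proof. by elim: s => [//|[c|c] s IH] /=; rewrite !inE IH. Qed.

Lemma mem_inr_part s b : (b \in inr_part s) = (inr b \in s).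
Proof. by elim: s => [//|[c|c] s IH] /=; rewrite !inE IH. Qed.

Lemma inl_part_uniq s : uniq s -> uniq (inl_part s).
Proof.
elim: s => [//|[c|c] s IH] /= /andP[cs /IH us] //.
by rewrite us mem_inl_part cs.
Qed.

Lemma inr_part_uniq s : uniq s -> uniq (inr_part s).
Proof.
elim: s => [//|[c|c] s IH] /= /andP[cs /IH us] //.
by rewrite us mem_inr_part cs.
Qed.

Lemma sum_inl_inr s (g : A + B -> V) :
  \sum_(k <- s) g k = \sum_(a <- inl_part s) g (inl a) + \sum_(b <- inr_part s) g (inr b).
Proof.
elim: s => [|[c|c] s IH] /=; first by rewrite !big_nil addr0.
  by rewrite !big_cons IH addrA.
by rewrite !big_cons IH addrCA.
Qed.

End SumType.

Section IharaMatrix.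
Variables (R : realType) (X : sgraph) (w : oedge X -> R).
Variables (M : nat) (out : X -> seq (oedge X)) (sW : R).
Hypothesis w_gt0 : forall e, 0 < w e.
Hypothesis out_uniq : forall x, uniq (out x).
Hypothesis out_mem : forall x e, (e \in out x) = (orig e == x).
Hypothesis out_size : forall x, (size (out x) <= M)%N.
Hypothesis w_sum : forall t, uniq t -> \sum_(e <- t) w e <= sW.
Local Notation C := R[i].
Local Notation nc := (@ComplexField.Normc.normc R).
Local Notation I := (X + oedge X)%type.
Local Notation om := (out_weight w out).
Local Notation bm := (back_weight w out).
Local Notation rc x := (x : R)%:C%C.

Let w_ge0 e : 0 <= w e. Proof. exact: ltW. Qed.

(* The entries at [(i, j)] are the [j]-coordinates of the images of the basis
   vectors [i]; the diagonal of [B_2] is a parameter [b] so that it can be truncated. *)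
Definition ihara_mx (b : X -> R) (u : C) (i j : I) : C :=
  match i, j with
  | inl x, inl y => u * (u * (rc (b x) * (x == y)%:R) - rc (wt w x y))
  | inl x, inr e => u * (rc (w e) * (orig e == x)%:R)
  | inr e, inl y => u * (u * (rc (w e * w (einv e)) * (term e == y)%:R))
  | inr e, inr f => u * (rc (w (einv e)) * (f == einv e)%:R)
  end.

(** The norms of the blocks of a row: [B_2], [A] and [sigma] at a vertex, so that [om x] occurs
    twice; [tau J^2] and [J] at an edge. *)
Definition ihara_bound (u : C) (i : I) : R :=
  match i with
  | inl x => nc u * (nc u * bm x) + nc u * om x + nc u * om x
  | inr e => nc u * (nc u * (w e * w (einv e))) + nc u * w (einv e)
  end.

Lemma ihara_bound_ge0 u i : 0 <= ihara_bound u i.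
Proof.
have nu := nc_ge0 u; have hom := out_weight_ge0 out w_gt0.
have hbm := back_weight_ge0 out w_gt0.
case: i => [x|e] /=.
  by rewrite !addr_ge0 // !mulr_ge0.
by rewrite !addr_ge0 // !mulr_ge0.
Qed.

Lemma ihara_bound_sum u : exists s, forall F : {fset I},
  \sum_(i <- F) ihara_bound u i <= s.
Proof.
exists (nc u * (nc u * (sW * sW)) + nc u * sW + nc u * sW
        + (nc u * (nc u * (sW * sW)) + nc u * sW)) => F.
have nu := nc_ge0 u; have s0 := sW_ge0 w_sum.
rewrite sum_inl_inr /= !big_split /= -!mulr_sumr.
have uX := inl_part_uniq (fset_uniq F); have uE := inr_part_uniq (fset_uniq F).
have hm := sum_out_weight_le w_gt0 out_uniq out_mem w_sum uX.
have hv := w_einv_sum w_sum uE.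
have hb : \sum_(x <- inl_part F) bm x <= sW * sW.
  apply: le_trans (ler_wpM2l s0 hm); rewrite mulr_sumr; apply: ler_sum => x _.
  exact: back_weight_le.
have hw : \sum_(e <- inr_part F) w e * w (einv e) <= sW * sW.
  apply: le_trans (ler_wpM2l s0 hv); rewrite mulr_sumr; apply: ler_sum => e _.
  by rewrite ler_wpM2r // (w_le_total w_sum).
by rewrite !lerD // !ler_wpM2l.
Qed.

Lemma ihara_mx_dominated b u : (forall x, 0 <= b x <= bm x) ->
  dominated (ihara_bound u) (ihara_mx b u).
Proof.
move=> hb i F; rewrite sum_inl_inr.
have uX := inl_part_uniq (fset_uniq F); have uE := inr_part_uniq (fset_uniq F).
have nu := nc_ge0 u; have s0 := sW_ge0 w_sum.
have ncb (c : bool) : nc c%:R = c%:R by rewrite nc_nat.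
case: i => [x|e] /=.
  have /andP[b0 bx] := hb x.
  apply: lerD.
    apply: (@le_trans _ _ (\sum_(y <- inl_part F) (nc u * (nc u * (b x * (x == y)%:R)) + nc u * wt w x y))).
      apply: ler_sum => y _; rewrite ncM -mulrDr ler_wpM2l //.
      apply: le_trans (ncD _ _) _; rewrite ncN !ncM ncb !nc_real_ge0 //.
      by case: (boolP (adj x y)) => [/edge_exists[e <- <-]|/wt_nadj->] //; rewrite wt_edge.
    rewrite big_split /= -!mulr_sumr; apply: lerD; rewrite ler_wpM2l //.
      rewrite mulr_sumr ler_wpM2l // -mulr_sumr; apply: le_trans bx.
      rewrite mulr_sumr; apply: (sum_uniq_indicator (a := x)) => // y /eqP-> //.
    exact: (sum_wt_le w_gt0 out_mem).
  rewrite (eq_bigr (fun e => nc u * (w e * (orig e == x)%:R))); last first.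
    by move=> e _; rewrite !ncM ncb nc_real_ge0.
  rewrite -mulr_sumr ler_wpM2l //.
  apply: le_trans (sum_orig_le w_gt0 out_mem x uE).
  by rewrite [leRHS]big_mkcond; apply: ler_sum => e _; case: ifP => _; rewrite ?mulr1 ?mulr0.
apply: lerD.
  rewrite (eq_bigr (fun y => nc u * (nc u * (w e * w (einv e) * (term e == y)%:R)))); last first.
    by move=> y _; rewrite !ncM ncb nc_real_ge0 // mulr_ge0.
  rewrite -!mulr_sumr !ler_wpM2l //.
  rewrite mulr_sumr; apply: (sum_uniq_indicator (a := term e)) => // [|y /eqP-> //].
  by rewrite mulr_ge0.
rewrite (eq_bigr (fun f => nc u * (w (einv e) * (f == einv e)%:R))); last first.
  by move=> y _; rewrite !ncM ncb nc_real_ge0.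
rewrite -!mulr_sumr !ler_wpM2l // mulr_sumr.
by apply: (sum_uniq_indicator (a := einv e)) => // f /eqP-> //.
Qed.

(** Row [e] is the image of [e] under [T]: each edge that continues [e] without reversing it, with
    the weight of that new edge. *)
Definition edge_mx (e f : oedge X) : C :=
  rc (w f * ((term e == orig f) && (f != einv e))%:R).

Lemma edge_mxE e f : edge_mx e f =
  rc (w f) * (term e == orig f)%:R - rc (w (einv e)) * (f == einv e)%:R.
Proof.
rewrite /edge_mx; case: (eqVneq f (einv e)) => [->|fe].
  by rewrite orig_einv eqxx /= mulr0 !mulr1 subrr.
by rewrite andbT mulr0 subr0; case: eqP; rewrite ?mulr1 ?mulr0.
Qed.

Lemma edge_mx_dominated : dominated (fun e => om (term e)) edge_mx.
Proof.
move=> e F.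
apply: le_trans (sum_orig_le w_gt0 out_mem (term e) (fset_uniq F)).
rewrite [leRHS]big_mkcond; apply: ler_sum => f _; rewrite nc_real_ge0 ?mulr_ge0 //.
rewrite eq_sym; case: eqP => _ /=; last by rewrite mulr0.
by case: (_ != _); rewrite ?mulr1 ?mulr0.
Qed.

Section FiniteSection.
Variable V : {fset X}.
Local Open Scope fset_scope.

(** Requiring both ends in [V] makes the set stable under reversal, so [J] restricts to it, and puts
    every origin in [V], so the sum over vertices in [tau sigma] loses nothing. *)
Definition edges_in : {fset oedge X} :=
  [fset e | e in [seq e <- flatten [seq out x | x <- V] | term e \in V]].

Lemma mem_edges_in e : (e \in edges_in) = (orig e \in V) && (term e \in V).
Proof.
rewrite /edges_in in_fset /= mem_filter andbC; congr (_ && _).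
apply/flatten_mapP/idP => [[x xV]|eV]; first by rewrite out_mem => /eqP ->.
by exists (orig e) => //; rewrite out_mem.
Qed.

(** The diagonal that the finite product [sg *m Jm *m ta] produces; the edges from [x] that leave
    [V] are missing. *)
Definition back_weight_in (x : X) : R :=
  \sum_(e <- edges_in | orig e == x) w e * w (einv e).

Lemma back_weight_in_le x : 0 <= back_weight_in x <= bm x.
Proof.
rewrite /back_weight_in sumr_ge0 => [|e _]; last by rewrite mulr_ge0.
rewrite -big_filter; apply: (ler_sum_uniq_sub xpredT) => [||e].
- by rewrite filter_uniq ?fset_uniq.
- by move=> e; rewrite mem_filter out_mem => /andP[].
- by rewrite mulr_ge0.
Qed.

Lemma back_weight_in_eq x : x \in V -> (forall e, orig e = x -> term e \in V) ->
  back_weight_in x = bm x.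
Proof.
move=> xV h; rewrite /back_weight_in -big_filter; apply: perm_big.
apply: uniq_perm => //; first by rewrite filter_uniq ?fset_uniq.
move=> e; rewrite mem_filter out_mem mem_edges_in andb_idr //.
by move=> /eqP ex; rewrite ex xV h.
Qed.

Local Notation nV := (size V).
Local Notation nE := (size edges_in).

Definition vertex_of (a : 'I_nV) : X := tnth (in_tuple V) a.
Definition edge_of (a : 'I_nE) : oedge X := tnth (in_tuple edges_in) a.

Definition section_index (a : 'I_(nV + nE)) : I :=
  match fintype.split a with inl x => inl (vertex_of x) | inr e => inr (edge_of e) end.

Lemma section_index_inj : injective section_index.
Proof.
move=> a b; rewrite /section_index => h; apply: (can_inj (@splitK _ _)); move: h.
by case: (fintype.split a) (fintype.split b) => [x|e] [y|f] // [] /tnth_fset_inj ->.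
Qed.

Lemma section_index_onto i :
  (match i with inl x => x \in V | inr e => e \in edges_in end) ->
  exists a, section_index a = i.
Proof.
case: i => [x xV|e eV].
  have /tnthP[a ->] : x \in in_tuple V by [].
  by exists (lshift _ a); rewrite /section_index (unsplitK (inl a)).
have /tnthP[a ->] : e \in in_tuple edges_in by [].
by exists (rshift _ a); rewrite /section_index (unsplitK (inr a)).
Qed.

Let sg : 'M[C]_(nV, nE) := \matrix_(a, b) (rc (w (edge_of b)) * (orig (edge_of b) == vertex_of a)%:R).
Let ta : 'M[C]_(nE, nV) := \matrix_(b, a) (term (edge_of b) == vertex_of a)%:R.
Let Jm : 'M[C]_nE := \matrix_(b, c) (rc (w (einv (edge_of b))) * (edge_of c == einv (edge_of b))%:R).

Lemma sum_edge_of (f : oedge X -> C) : \sum_b f (edge_of b) = \sum_(e <- edges_in) f e.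
Proof. by rewrite [RHS]big_tnth. Qed.

Lemma Jm_row (b : 'I_nE) (g : oedge X -> C) :
  \sum_c Jm b c * g (edge_of c) = rc (w (einv (edge_of b))) * g (einv (edge_of b)).
Proof.
have /tnthP[c ec] : einv (edge_of b) \in in_tuple edges_in.
  have : edge_of b \in edges_in by exact: mem_tnth.
  by rewrite /= !mem_edges_in /= andbC.
rewrite (bigD1 c) //= big1 ?addr0 => [|d dc].
  by rewrite mxE [edge_of c]/(edge_of c) -ec eqxx mulr1.
rewrite mxE ec (inj_eq (@tnth_fset_inj _ _)) (negPf dc) mulr0 mul0r //.
Qed.

Lemma vertex_of_in a : vertex_of a \in V.
Proof. exact: mem_tnth. Qed.

Lemma edge_of_in a : edge_of a \in edges_in.
Proof. exact: mem_tnth. Qed.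

Lemma sg_ta x y : (sg *m ta) x y = rc (wt w (vertex_of x) (vertex_of y)).
Proof.
rewrite mxE.
under eq_bigr do rewrite !mxE.
rewrite (sum_edge_of (fun e => rc (w e) * (orig e == vertex_of x)%:R * (term e == vertex_of y)%:R)).
case: (boolP (adj (vertex_of x) (vertex_of y))) => [|nxy]; last first.
  rewrite wt_nadj // big1 // => e _; case: (eqVneq (orig e)) => [ex|_]; last by rewrite mulr0 mul0r.
  case: (eqVneq (term e)) => [ey|_]; last by rewrite mulr0.
  by rewrite -ex -ey adj_edge in nxy.
case/edge_exists => e ex ey; rewrite -ex -ey wt_edge.
have eV : e \in edges_in by rewrite mem_edges_in ex ey !vertex_of_in.
rewrite (bigD1_seq e) ?fset_uniq //= big1 ?addr0 ?eqxx ?mulr1 // => f fe.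
case: (eqVneq (orig f)) => [fx|_]; last by rewrite mulr0 mul0r.
case: (eqVneq (term f)) => [fy|_]; last by rewrite mulr0.
by rewrite (edge_eq fx fy) eqxx in fe.
Qed.

Lemma Jm_ta b y : (Jm *m ta) b y =
  rc (w (einv (edge_of b))) * (orig (edge_of b) == vertex_of y)%:R.
Proof.
rewrite mxE -(Jm_row b (fun e => (term e == vertex_of y)%:R)).
by apply: eq_bigr => c _; rewrite [ta _ _]mxE.
Qed.

Lemma sg_Jm_ta x y :
  (sg *m Jm *m ta) x y = rc (back_weight_in (vertex_of x)) * (vertex_of x == vertex_of y)%:R.
Proof.
rewrite -mulmxA mxE.
under eq_bigr do rewrite Jm_ta mxE.
rewrite (sum_edge_of (fun e => rc (w e) * (orig e == vertex_of x)%:R *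
   (rc (w (einv e)) * (orig e == vertex_of y)%:R))).
rewrite /back_weight_in rmorph_sum mulr_suml [RHS]big_mkcond; apply: eq_bigr => e _.
case: (eqVneq (orig e) (vertex_of x)) => [->|_]; last by rewrite mulr0 mul0r.
by rewrite rmorphM mulr1 mulrA.
Qed.

Lemma Jm_Jm_ta b y : (Jm *m Jm *m ta) b y =
  rc (w (edge_of b) * w (einv (edge_of b))) * (term (edge_of b) == vertex_of y)%:R.
Proof.
rewrite -mulmxA mxE.
under eq_bigr do rewrite Jm_ta.
rewrite (Jm_row b (fun e => rc (w (einv e)) * (orig e == vertex_of y)%:R)).
by rewrite einvK orig_einv rmorphM /= mulrA [X in X * _]mulrC.
Qed.

(** In the row convention [sg *m ta] is [A], [sg *m Jm *m ta] the truncated [B_2] and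
    [Jm *m Jm *m ta] is [tau J^2], so the section has the shape that [bass_determinant] requires. *)
Lemma bass_section u :
  \det (1%:M + \matrix_(a, b) ihara_mx back_weight_in u (section_index a) (section_index b))
  = \det (1%:M + \matrix_(a, b) (- u * edge_mx (edge_of a) (edge_of b))).
Proof.
have -> : \matrix_(a, b) (- u * edge_mx (edge_of a) (edge_of b)) = - (u *: (ta *m sg - Jm)).
  apply/matrixP => a b; rewrite !mxE mulNr edge_mxE; congr (- (u * (_ - _))).
  have /tnthP[c ec] : orig (edge_of b) \in in_tuple V.
    by have := edge_of_in b; rewrite /= mem_edges_in => /andP[].
  rewrite (bigD1 c) //= big1 ?addr0 => [|d dc].
    by rewrite !mxE -[vertex_of c]ec eqxx mulr1 mulrC.
  by rewrite !mxE ec (inj_eq (@tnth_fset_inj _ _)) (eq_sym c) (negPf dc) !mulr0.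
rewrite -(bass_determinant sg ta Jm u); congr (\det (_ + _)).
apply/matrixP => a b; rewrite mxE /section_index.
rewrite -[a in RHS]splitK -[b in RHS]splitK.
case: (fintype.split a) => [x|e]; case: (fintype.split b) => [y|f] /=.
- rewrite block_mxEul; transitivity (u * (u * (sg *m Jm *m ta) x y - (sg *m ta) x y)).
    by rewrite sg_ta sg_Jm_ta.
  by move: (sg *m Jm *m ta) (sg *m ta) => A B; rewrite !mxE.
- by rewrite block_mxEur !mxE.
- rewrite block_mxEdl; transitivity (u * (u * (Jm *m Jm *m ta) e y)).
    by rewrite Jm_Jm_ta.
  by move: (Jm *m Jm *m ta) => A; rewrite !mxE.
- by rewrite block_mxEdr !mxE.
Qed.

End FiniteSection.

(** Both sides lie within [e / 2] of one finite determinant, that of the truncated section on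
    [V]. *)
Lemma fredholm_ihara (u : C) :
  fredholm_minors (ihara_mx bm u) = fredholm_minors (fun e f => - u * edge_mx e f).
Proof.
apply/eqP; rewrite -subr_eq0 -nc_eq0 eq_le nc_ge0 andbT; apply/ler_addgt0Pr => e e0.
rewrite add0r; have e2 : 0 < e / 2 by rewrite divr_gt0.
have [s1 hs1] := ihara_bound_sum u.
have [F1 hF1] := fredholm_minors_section (ihara_bound_ge0 u) hs1 e2.
have om0 := out_weight_ge0 out w_gt0.
have t0 e' : 0 <= nc u * om (term e') by rewrite mulr_ge0 ?nc_ge0.
have hs2 (F : {fset oedge X}) : \sum_(e <- F) nc u * om (term e) <= nc u * (M%:R * sW).
  rewrite -mulr_sumr ler_wpM2l ?nc_ge0 //.
  exact: sum_out_weight_term_le (fset_uniq F).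
have [F2 hF2] := fredholm_minors_section t0 hs2 e2.
pose xs : seq X := inl_part F1.
(* The out-edges of the vertices in [F1] are added so that their heads lie in [V]; at these vertices
   the truncated [B_2] has the same diagonal as [B_2]. *)
pose es : seq (oedge X) := inr_part F1 ++ F2 ++ flatten [seq out x | x <- xs].
pose V : {fset X} := [fset x | x in xs ++ [seq orig e | e <- es] ++ [seq term e | e <- es]]%fset.
have esV f : f \in es -> f \in edges_in V.
  move=> fe; rewrite mem_edges_in !in_fset /= !mem_cat.
  by rewrite (map_f (@orig X) fe) (map_f (@term X) fe) !orbT.
have xsV x : x \in xs -> x \in V by move=> xx; rewrite in_fset /= mem_cat xx.
have bE x : x \in xs -> back_weight_in V x = bm x.
  move=> xx; apply: back_weight_in_eq => [|f fx]; first exact: xsV.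
  have : f \in edges_in V.
    apply: esV; rewrite !mem_cat; apply/orP; right; apply/orP; right.
    by apply/flatten_mapP; exists x; rewrite // out_mem fx.
  by rewrite mem_edges_in => /andP[].
rewrite (splitr e) -(subrKA (\det (1%:M +
  \matrix_(a, b) ihara_mx (back_weight_in V) u (section_index (V := V) a) (section_index b)))).
apply: le_trans (ncD _ _) _; apply: lerD.
  apply: hF1.
  - by apply: ihara_mx_dominated => x; rewrite lexx back_weight_ge0.
  - by apply: ihara_mx_dominated => x; exact: back_weight_in_le.
  - by move=> [x|f] [y|g] //= iF jF; rewrite bE // mem_inl_part.
  - exact: section_index_inj.
  - move=> i iF; apply: section_index_onto; case: i iF => [x|f] h.
      by apply: xsV; rewrite mem_inl_part.
    by apply: esV; rewrite mem_cat mem_inr_part h.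
rewrite bass_section ncB.
have dT : dominated (fun e => nc u * om (term e)) (fun e f => - u * edge_mx e f).
  move=> f F; under eq_bigr do rewrite ncM ncN.
  by rewrite -mulr_sumr ler_wpM2l ?nc_ge0 // edge_mx_dominated.
apply: (hF2 _ _ dT dT) => // [|f fF]; first exact: tnth_fset_inj.
have /tnthP[a ->] : f \in in_tuple (edges_in V).
  by apply: esV; rewrite !mem_cat fF orbT.
by exists a.
Qed.

End IharaMatrix.

(** * Trace class *)

Section TraceClass.
Variables (R : realType) (I : choiceType).
Local Notation C := R[i].
Local Notation nc := (@ComplexField.Normc.normc R).

Lemma sum_sqr_le (s : seq I) (g : I -> R) : (forall i, 0 <= g i) ->
  \sum_(i <- s) g i ^+ 2 <= (\sum_(i <- s) g i) ^+ 2.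
Proof.
move=> g0; elim: s => [|i s IH]; first by rewrite !big_nil expr0n.
rewrite !big_cons sqrrD -addrA lerD2l; apply: le_trans IH _.
by rewrite lerDr mulrn_wge0 // mulr_ge0 // sumr_ge0.
Qed.

Lemma ell2_of_ell1 (g : I -> C) (c : R) : 0 <= c ->
  (forall F : {fset I}, \sum_(i <- F) nc (g i) <= c) -> ell2 g /\ ell2_norm g <= c.
Proof.
move=> c0 h.
have hE : (\esum_(i in [set: I]%classic) (nc (g i) ^+ 2)%:E <= (c ^+ 2)%:E)%E.
  apply: ge_ereal_sup => _ [A [finA _] <-]; rewrite fsbig_finite // sumEFin lee_fin.
  apply: le_trans (sum_sqr_le _ _) _ => [i|]; first exact: nc_ge0.
  by rewrite lerXn2r ?nnegrE ?sumr_ge0 // => i _; exact: nc_ge0.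
have E0 : (0 <= \esum_(i in [set: I]%classic) (nc (g i) ^+ 2)%:E)%E.
  by apply: esum_ge0 => i _; rewrite lee_fin sqr_ge0.
split.
  rewrite /ell2 /summable; apply: le_lt_trans (ltry (c ^+ 2)).
  apply: le_trans hE; by apply: le_esum => i _; rewrite lee_fin ger0_norm ?sqr_ge0.
rewrite /ell2_norm -[leRHS]ger0_norm // -sqrtr_sqr ler_wsqrtr // -lee_fin fineK //.
by rewrite ge0_fin_numE //; apply: le_lt_trans hE (ltry _).
Qed.

Lemma ell2_bounded (f : I -> C) : ell2 f -> exists2 B, 0 <= B & forall i, nc (f i) <= B.
Proof.
move=> /(summable_uniq_sums (fun i => sqr_ge0 _))[s hs].
have s0 : 0 <= s by have := hs [::] isT; rewrite big_nil.
(* [x ^+ 2 <= s] implies [x <= s + 1], so no square root is needed. *)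
exists (s + 1) => [|i]; first by rewrite addr_ge0.
have := hs [:: i] isT; rewrite big_seq1; have := nc_ge0 (f i); nra.
Qed.

Variables (r : I -> R) (s : R).
Hypothesis r_ge0 : forall i, 0 <= r i.
Hypothesis r_sum : forall F : {fset I}, \sum_(i <- F) r i <= s.

Let sums := [set \sum_(i <- F) r i | F in [set: {fset I}]]%classic.

Let has_sup_sums : has_sup sums.
Proof.
split; first by exists (\sum_(i <- fset0) r i); exists fset0.
by exists s => _ [F _ <-].
Qed.

Lemma fset_sum_tail eps : 0 < eps -> exists F0 : {fset I},
  forall t, uniq t -> \sum_(i <- t | i \notin F0) r i <= eps.
Proof.
move=> e0; have [_ [F0 _ <-] hF0] := sup_adherent e0 has_sup_sums.
exists F0 => t ut.
have : \sum_(i <- F0) r i + \sum_(i <- t | i \notin F0) r i <= sup sums.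
  have -> : \sum_(i <- F0) r i + \sum_(i <- t | i \notin F0) r i =
     \sum_(i <- [fset i in F0 ++ [seq i <- t | i \notin F0]]%fset) r i.
    rewrite -[X in _ + X]big_filter -big_cat; apply: perm_big.
    apply: uniq_perm => [||i]; [|exact: fset_uniq|by rewrite in_fset].
    rewrite cat_uniq fset_uniq filter_uniq // andbT /=.
    by apply/hasPn => i; rewrite mem_filter => /andP[].
  by apply: sup_upper_bound => //; eexists.
lra.
Qed.

Lemma support_enum : exists idx : nat -> option I,
  (forall n m i, idx n = Some i -> idx m = Some i -> n = m) /\
  forall i, r i != 0 -> exists n, idx n = Some i.
Proof.
have ctb : countable [set i | r i != 0].
  have h n : {F0 : {fset I} | forall t, uniq t -> \sum_(i <- t | i \notin F0) r i <= n.+1%:R^-1}.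
    by apply: cid; apply: fset_sum_tail; rewrite invr_gt0.
  apply: (@sub_countable _ _ _ (\bigcup_n [set` sval (h n)])%classic); last first.
    by apply: bigcup_countable => // n _; exact: countable_fset.
  apply: subset_card_le => i /= ri; apply: contrapT => nF.
  have ri0 : 0 < r i by rewrite lt_neqAle eq_sym ri r_ge0.
  have inF n : i \notin sval (h n) by apply/negP => iF; apply: nF; exists n.
  have hr n : r i <= n.+1%:R^-1.
    by have := svalP (h n) [:: i] isT; rewrite big_cons big_nil inF addr0.
  have := hr (Num.bound (r i)^-1); apply/negP; rewrite -ltNge.
  rewrite invf_plt ?posrE //; apply: (lt_trans (archi_boundP _)).
    by rewrite invr_ge0 ltW.
  by rewrite ltr_nat.
have /countable_injP[f finj] := ctb.
exists (fun n => if pselect (exists2 i, r i != 0 & f i = n) is left h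
  then Some (sval (cid2 h)) else None).
split=> [n m i|i ri].
  case: pselect => // h1 []; case: (cid2 h1) => /= i1 _ <- ->.
  by case: pselect => // h2 []; case: (cid2 h2) => /= i2 _ <- ->.
exists (f i); case: pselect => [h|]; last by case; exists i.
congr Some; case: (cid2 h) => j rj fj /=; apply: finj => //; exact/mem_set.
Qed.

(** The nuclear decomposition is [S f = sum_i <f, delta_i> m_i] over the support of [r], with norms
    at most [1] and [r i]. The second hypothesis makes the columns of [m] finite, so each coordinate
    of [S f] is a finite sum. *)
Lemma trace_class_of_rows (S : (I -> C) -> (I -> C)) (m : I -> I -> C) :
  dominated r m ->
  (forall j, exists L : seq I, [/\ uniq L, forall i, i \notin L -> m i j = 0 &
     forall f, S f j = \sum_(i <- L) f i * m i j]) ->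
  trace_class S.
Proof.
move=> dm hS; have [idx [idx_inj idx_onto]] := support_enum.
pose ids N := pmap idx (iota 0 N).
have ids_uniq N : uniq (ids N).
  rewrite /ids; elim: N 0%N => [//|N IH] k /=.
  case e: (idx k) => [i|] //=; rewrite IH andbT.
  apply/negP; rewrite mem_pmap => /mapP[k' + e'].
  by rewrite mem_iota (idx_inj _ _ _ e (esym e')) ltnn.
have ids_sum (V : nmodType) (g : I -> V) N :
    \sum_(n < N) (if idx n is Some i then g i else 0) = \sum_(i <- ids N) g i.
  rewrite -(big_mkord xpredT (fun n => if idx n is Some i then g i else 0)).
  rewrite /ids /index_iota subn0; elim: (iota 0 N) => [|k l IH] /=; first by rewrite !big_nil.
  by rewrite big_cons IH; case: (idx k) => [i|] /=; rewrite ?big_cons ?add0r.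
have ids_mem i N n : idx n = Some i -> (n < N)%N -> i \in ids N.
  by move=> e nN; rewrite mem_pmap -e map_f // mem_iota.
have rseq t : uniq t -> \sum_(i <- t) r i <= s.
  move=> ut; have -> : \sum_(i <- t) r i = \sum_(i <- [fset i in t]%fset) r i; last exact: r_sum.
  by apply: perm_big; apply: uniq_perm => [||i]; [|exact: fset_uniq|rewrite in_fset].
pose a n : I -> C := if idx n is Some i then delta R i else fun=> 0.
pose b n : I -> C := if idx n is Some i then m i else fun=> 0.
have ell0 : ell2 ((fun=> 0) : I -> C) /\ ell2_norm ((fun=> 0) : I -> C) <= 0.
  by apply: ell2_of_ell1 => // F; rewrite big1 // => i _; rewrite nc0.
have ha n : ell2 (a n) /\ ell2_norm (a n) <= 1.
  rewrite /a; case: (idx n) => [i|]; last by split; [exact: ell0.1|apply: le_trans ell0.2 _].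
  apply: ell2_of_ell1 => // F.
  rewrite (eq_bigr (fun j => 1 * (j == i)%:R)); last by move=> j _; rewrite nc_nat mul1r.
  by apply: (sum_uniq_indicator (a := i)); rewrite ?fset_uniq // => j /eqP.
have hb n : ell2 (b n) /\ ell2_norm (b n) <= (if idx n is Some i then r i else 0).
  rewrite /b; case: (idx n) => [i|]; last exact: ell0.
  exact: ell2_of_ell1.
have norm0 g : 0 <= ell2_norm (g : I -> C) by exact: sqrtr_ge0.
have hab n : ell2_norm (a n) * ell2_norm (b n) <= (if idx n is Some i then r i else 0).
  by rewrite -[leRHS]mul1r ler_pM ?(ha n).2 ?(hb n).2.
exists a, b; split.
- by move=> n; split; [exact: (ha n).1|exact: (hb n).1].
- apply: nondecreasing_is_cvgn.
    by apply: nondecreasing_series => n _ _; rewrite mulr_ge0.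
  exists s => _ [N _ <-]; rewrite /series /= big_mkord.
  apply: le_trans (ler_sum _ (fun (n : 'I_N) _ => hab n)) _.
  by rewrite ids_sum rseq.
move=> f /ell2_bounded[B B0 hB].
have inner_a n : forall j, inner f (a n) * b n j = if idx n is Some i then f i * m i j else 0.
  move=> j; rewrite /a /b; case: (idx n) => [i|]; last by rewrite mulr0.
  congr (_ * _); rewrite /inner (usum1 (a := i)); first by rewrite /delta eqxx rmorph1 mulr1.
  by move=> k ki; rewrite /delta (negPf ki) rmorph0 mulr0.
(* The remainder after [N] terms has [l^1] norm at most a sup bound [B] of [f] times the tail of
   [r]. [N = 0] yields [ell2 (S f)], large [N] the convergence. *)
have rem N c : (forall t, uniq t -> \sum_(i <- t | i \notin ids N) r i <= c) ->
    let g := fun j => S f j - \sum_(n < N) inner f (a n) * b n j in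
    ell2 g /\ ell2_norm g <= B * c.
  move=> hc g; apply: ell2_of_ell1 => [|F].
    by rewrite mulr_ge0 //; have := hc [::] isT; rewrite big_nil.
  pose L j := sval (cid (hS j)).
  have LP j : [/\ uniq (L j), forall i, i \notin L j -> m i j = 0 &
     forall f, S f j = \sum_(i <- L j) f i * m i j] by exact: svalP (cid (hS j)).
  pose t := undup (flatten [seq L j | j <- F]).
  have ut : uniq t by exact: undup_uniq.
  have gE j : j \in F -> nc (g j) <= \sum_(i <- t | i \notin ids N) B * nc (m i j).
    move=> jF; have [uL L0 LS] := LP j; rewrite /g LS.
    under [X in _ - X]eq_bigr do rewrite inner_a.
    rewrite ids_sum (bigID (mem (ids N))) /=.
    have -> : \sum_(i <- L j | i \in ids N) f i * m i j = \sum_(i <- ids N) f i * m i j.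
      rewrite [RHS](bigID (mem (L j))) /= [X in _ = _ + X]big1 ?addr0; last first.
        by move=> i /L0 ->; rewrite mulr0.
      rewrite -big_filter -[RHS]big_filter; apply: perm_big; apply: uniq_perm.
      - exact: filter_uniq.
      - exact: filter_uniq.
      by move=> i; rewrite !mem_filter andbC.
    rewrite addrAC subrr add0r; apply: le_trans (nc_sum _ _ _) _.
    apply: (@le_trans _ _ (\sum_(i <- L j | i \notin ids N) B * nc (m i j))).
      by apply: ler_sum => i _; rewrite ncM ler_wpM2r ?nc_ge0.
    apply: ler_sum_uniq_sub => // [i iL|i]; last by rewrite mulr_ge0 ?nc_ge0.
    by rewrite mem_undup; apply/flatten_mapP; exists j.
  rewrite big_seq; apply: le_trans (ler_sum _ gE) _; rewrite -big_seq.
  rewrite exchange_big /=; apply: (@le_trans _ _ (\sum_(i <- t | i \notin ids N) B * r i)).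
    by apply: ler_sum => i _; rewrite -mulr_sumr ler_wpM2l.
  by rewrite -mulr_sumr ler_wpM2l // hc.
split.
  have [|+ _] := rem 0%N s.
    by move=> t ut; apply: le_trans (rseq _ ut); rewrite big_mkcond ler_sum // => i _; case: ifP.
  by congr ell2; apply/funext => j; rewrite big_ord0 subr0.
apply/cvgrPdist_le => e e0.
have d0 : 0 < e / (B + 1) by rewrite divr_gt0 // ltr_wpDl.
have [F0 hF0] := fset_sum_tail d0.
have ids_mono N N' : (N <= N')%N -> {subset ids N <= ids N'}.
  move=> NN' i; rewrite /ids !mem_pmap => /mapP[k + ->]; rewrite mem_iota => kN.
  by rewrite map_f // mem_iota (leq_trans kN).
have key (l : seq I) : exists N0, forall i, i \in l -> r i != 0 -> i \in ids N0.
  elim: l => [|k l [N hN]]; first by exists 0%N.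
  have [rk|/idx_onto[n nk]] := eqVneq (r k) 0.
    by exists N => i; rewrite inE => /orP[/eqP->|/hN//]; rewrite rk eqxx.
  exists (maxn N n.+1) => i; rewrite inE => /orP[/eqP-> _|il ri].
    by apply: (ids_mem _ _ _ nk); rewrite leq_max ltnSn orbT.
  by apply: (ids_mono N); rewrite ?leq_maxl // hN.
have [N0 hN0] := key F0.
exists N0 => // N /= NN0.
have [|_ hN] := rem N (e / (B + 1)).
  move=> t ut; apply: le_trans (hF0 _ ut).
  rewrite big_mkcond [leRHS]big_mkcond; apply: ler_sum => i _.
  case: ifPn => [iN|_]; last by case: ifP.
  have [->|ri] := eqVneq (r i) 0; first by case: ifP.
  rewrite ifT //; apply: contra iN => iF.
  by apply: (ids_mono N0) => //; apply: hN0.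
rewrite sub0r normrN ger0_norm //; apply: le_trans hN _.
by rewrite mulrCA ger_pMr // ler_pdivrMr ?ltr_wpDl // mul1r lerDl.
Qed.

End TraceClass.

(** * Matrix entries of the Ihara operator *)

Section IharaOperator.
Variables (R : realType) (X : sgraph) (w : oedge X -> R).
Variables (out : X -> seq (oedge X)).
Hypothesis out_uniq : forall x, uniq (out x).
Hypothesis out_mem : forall x e, (e \in out x) = (orig e == x).
Local Notation C := R[i].
Local Notation nc := (@ComplexField.Normc.normc R).
Local Notation I := (X + oedge X)%type.
Local Notation om := (out_weight w out).
Local Notation bm := (back_weight w out).
Local Notation rc x := (x : R)%:C%C.

Lemma fsbig_out (x : X) (f : oedge X -> C) :
  \sum_(e \in [set e | orig e = x]%classic) f e = \sum_(e <- out x) f e.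
Proof.
rewrite [RHS]fsbig_seq ?out_uniq //; congr (\big[_/_]_(i \in _) _).
by apply/seteqP; split=> e /=; rewrite out_mem => /eqP.
Qed.

Lemma fsbig_adj (x : X) (f : X -> C) :
  \sum_(y \in [set y | adj x y]%classic) f y = \sum_(e <- out x) f (term e).
Proof.
have ut : uniq [seq term e | e <- out x].
  rewrite map_inj_in_uniq // => e e'; rewrite !out_mem => /eqP ex /eqP e'x.
  by apply: edge_eq; rewrite ex e'x.
rewrite -(big_map (@term X) xpredT f) [RHS]fsbig_seq //.
congr (\big[_/_]_(i \in _) _); apply/seteqP; split=> y /=.
  by case/edge_exists => e ex <-; apply: map_f; rewrite out_mem ex.
by case/mapP => e; rewrite out_mem => /eqP <- ->; exact: adj_edge.
Qed.

Lemma deltaE (J : choiceType) (i j : J) : delta R i j = (i == j)%:R :> C.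
Proof. by rewrite /delta eq_sym. Qed.

Lemma entry_A x y :
  \sum_(x' \in [set x' | adj x x']%classic) rc (wt w x x') * delta R x' y = rc (wt w x y).
Proof.
rewrite fsbig_adj; case: (boolP (adj x y)) => [|nxy]; last first.
  rewrite wt_nadj // big_seq big1 // => e; rewrite out_mem => /eqP ex.
  rewrite deltaE; case: eqP => [ey|_]; last by rewrite mulr0.
  by rewrite -ex -ey adj_edge in nxy.
case/edge_exists => e ex ey; rewrite (bigD1_seq e) ?out_mem ?ex //=.
rewrite deltaE ey eqxx mulr1 big_seq_cond big1 ?addr0 // => f.
rewrite out_mem => /andP[/eqP fx fe]; rewrite deltaE; case: eqP => [fy|_]; last by rewrite mulr0.
by rewrite (@edge_eq _ f e) ?eqxx ?fx ?fy in fe.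
Qed.

Lemma entry_B2 x y :
  \sum_(x' \in [set x' | adj x x']%classic) rc (W w x x') * delta R x y =
  rc (bm x) * (x == y)%:R.
Proof.
rewrite fsbig_adj -mulr_suml deltaE; congr (_ * _).
rewrite rmorph_sum; apply: eq_big_seq => e; rewrite out_mem => /eqP <-.
by rewrite /W -{2}(orig_einv e) -{2}(term_einv e) !wt_edge.
Qed.

Lemma entry_sigma x e' :
  \sum_(e \in [set e | orig e = x]%classic) rc (w e) * delta R e e' =
  rc (w e') * (orig e' == x)%:R.
Proof.
rewrite fsbig_out; case: eqP => [ex|nex].
  rewrite (bigD1_seq e') ?out_mem ?ex //= deltaE eqxx big1 ?addr0 // => f fe.
  by rewrite deltaE (negPf fe) mulr0.
rewrite mulr0 big_seq big1 // => e; rewrite out_mem => /eqP ex.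
rewrite deltaE; case: eqP => [ee|_]; last by rewrite mulr0.
by rewrite ee in ex.
Qed.

(** At a fixed coordinate [y] only the neighbours of [y] contribute to the unconditional sum, so no
    condition on [f] is needed. *)
Lemma opA_fset (f : X -> C) y (F : {fset X}) : (forall x, adj x y -> x \in F) ->
  opA w f y = \sum_(x <- F) f x * rc (wt w x y).
Proof.
move=> h; rewrite /opA /lin_ext; under eq_fun do rewrite entry_A.
apply: usum_fset => x; case: (boolP (adj x y)) => [/h->//|/wt_nadj-> _].
by rewrite mulr0.
Qed.

Lemma opB2_fset (f : X -> C) y (F : {fset X}) : y \in F ->
  opB2 w f y = \sum_(x <- F) f x * (rc (bm x) * (x == y)%:R).
Proof.
move=> h; rewrite /opB2 /lin_ext; under eq_fun do rewrite entry_B2.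
apply: usum_fset => x; case: (eqVneq x y) => [->|_ _]; first by rewrite h.
by rewrite !mulr0.
Qed.

Lemma op_sigmaE (f : X -> C) e : op_sigma w f e = f (orig e) * rc (w e).
Proof.
rewrite /op_sigma /lin_ext; under eq_fun do rewrite entry_sigma.
rewrite (usum1 (a := orig e)) ?eqxx ?mulr1 // => x.
by rewrite eq_sym => /negPf ->; rewrite !mulr0.
Qed.

Lemma opJE (f : oedge X -> C) e : opJ w f e = f (einv e) * rc (w e).
Proof.
rewrite /opJ /lin_ext (usum1 (a := einv e)) ?deltaE ?einvK ?eqxx ?mulr1 // => e' h.
rewrite deltaE; case: eqP => [ee|_]; last by rewrite !mulr0.
by rewrite -ee einvK eqxx in h.
Qed.

Lemma op_tau_fset (f : oedge X -> C) y (F : {fset oedge X}) :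
  (forall e, term e = y -> e \in F) ->
  op_tau f y = \sum_(e <- F) f e * (term e == y)%:R.
Proof.
move=> h; rewrite /op_tau /lin_ext; under eq_fun do rewrite deltaE.
apply: usum_fset => e; case: eqP => [/h->//|_ _]; by rewrite mulr0.
Qed.

(** [L] covers the support of column [j]: for a vertex, itself, its neighbours and the edges into
    it; for an edge, its origin and its reverse. *)
Lemma ihara_op_rows u j : exists L : seq I,
  [/\ uniq L, forall i, i \notin L -> ihara_mx w bm u i j = 0 &
   forall f, ihara_op w u f j = \sum_(i <- L) f i * ihara_mx w bm u i j].
Proof.
case: j => [y|e].
  pose LX : {fset X} := [fset x | x in y :: [seq term e | e <- out y]]%fset.
  pose LE : {fset oedge X} := [fset e | e in [seq einv e | e <- out y]]%fset.
  have yLX : y \in LX by rewrite in_fset /= inE eqxx.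
  have aLX x : adj x y -> x \in LX.
    rewrite adj_sym => /edge_exists[e ey ex]; rewrite in_fset /= inE; apply/orP; right.
    by apply/mapP; exists e; rewrite ?out_mem ?ey.
  have tLE e : term e = y -> e \in LE.
    move=> ey; rewrite in_fset /=; apply/mapP; exists (einv e); rewrite ?einvK //.
    by rewrite out_mem orig_einv ey.
  exists (map inl LX ++ map inr LE); split.
  - rewrite cat_uniq !map_inj_uniq ?fset_uniq //=; try by move=> ? ? [].
    by rewrite andbT; apply/hasPn => _ /mapP[e _ ->]; apply/mapP => -[].
  - move=> [x|e]; rewrite mem_cat negb_or => /andP[h1 h2] /=.
      have xLX : x \notin LX by apply: contra h1 => h; apply: map_f.
      have [xy|_] := eqVneq x y; first by rewrite xy yLX in xLX.
      rewrite wt_nadj; first by rewrite mulr0 mulr0 subr0 mulr0.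
      by apply: contra xLX; exact: aLX.
    case: eqP => [/tLE eLE|_]; last by rewrite !mulr0.
    by move/negP: h2; case; apply: map_f.
  move=> f; rewrite big_cat !big_map /= /ihara_op /scale_op /block_op /sub_op /=.
  rewrite (opB2_fset _ yLX) (opA_fset _ aLX) (op_tau_fset _ tLE).
  rewrite mulrDr mulrBr !mulr_sumr -sumrB; congr (_ + _); apply: eq_bigr => k _.
    by rewrite /=; ring.
  by rewrite !opJE einvK rmorphM /=; ring.
exists [:: inl (orig e); inr (einv e)]; split => //.
- move=> [x|f]; rewrite !inE /= ?orbF => h.
    case: eqP => [ex|_]; last by rewrite !mulr0.
    by rewrite ex eqxx in h.
  case: eqP => [ef|_]; last by rewrite !mulr0.
  by rewrite ef einvK eqxx in h.
move=> f; rewrite !big_cons big_nil /= eqxx einvK eqxx addr0.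
rewrite /ihara_op /scale_op /block_op /=.
by rewrite op_sigmaE opJE /=; ring.
Qed.

Lemma ihara_op_delta u i j : ihara_op w u (delta R i) j = ihara_mx w bm u i j.
Proof.
have [L [uL L0 ->]] := ihara_op_rows u j; have [iL|iL] := boolP (i \in L).
  rewrite (bigD1_seq i) //= deltaE eqxx mul1r big1 ?addr0 // => k ki.
  by rewrite deltaE eq_sym (negPf ki) mul0r.
rewrite L0 // big_seq big1 // => k kL; rewrite deltaE; case: eqP => [ik|_].
  by rewrite ik kL in iL.
by rewrite mul0r.
Qed.

End IharaOperator.

Section FredholmOperator.
Variables (R : realType) (I : choiceType).

Lemma inner_delta (f : I -> R[i]) j : inner f (delta R j) = f j.
Proof.
rewrite /inner (usum1 (a := j)); first by rewrite /delta eqxx rmorph1 mulr1.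
by move=> i ij; rewrite /delta (negPf ij) rmorph0 mulr0.
Qed.

(** Against basis vectors the inner product reads off a coordinate, so the determinant in
    [wedge_inner] is a principal minor. *)
Lemma fredholm_det1p_minors (S : (I -> R[i]) -> (I -> R[i])) m :
  (forall i j, S (delta R i) j = m i j) ->
  fredholm_det1p S = fredholm_minors m.
Proof.
move=> h; rewrite /fredholm_det1p /fredholm_minors.
suff -> : trace_wedge S = trace_minors m by []; apply/funext => k.
congr usum; apply/funext => F; congr determinant; apply/matrixP => a b.
by rewrite !mxE inner_delta h.
Qed.

End FredholmOperator.

(** * Words *)

Section Words.
Variable T : eqType.
Implicit Types (s t p q : seq T) (x : T).
Local Open Scope nat_scope.

Definition wpow m p : seq T := flatten (nseq m p).

Lemma wpowS m p : wpow m.+1 p = p ++ wpow m p. Proof. by []. Qed.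

Lemma wpow1 p : wpow 1 p = p. Proof. by rewrite wpowS cats0. Qed.

Lemma size_wpow m p : size (wpow m p) = m * size p.
Proof. by rewrite /wpow size_flatten /shape map_nseq sumn_nseq mulnC. Qed.

Lemma wpowD m n p : wpow (m + n) p = wpow m p ++ wpow n p.
Proof. by rewrite /wpow nseqD flatten_cat. Qed.

Lemma wpowM m n p : wpow m (wpow n p) = wpow (m * n) p.
Proof. by elim: m => [//|m IH]; rewrite wpowS IH mulSn wpowD. Qed.

Lemma wpow_commute m p : p ++ wpow m p = wpow m p ++ p.
Proof. by rewrite -{1}(wpow1 p) -wpowD -{3}(wpow1 p) -wpowD addnC. Qed.

Lemma all_wpow (a : pred T) m p : 0 < m -> all a (wpow m p) = all a p.
Proof.
case: m => // m _; elim: m => [|m IH]; first by rewrite wpow1.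
by rewrite wpowS all_cat IH andbb.
Qed.

Lemma rot_wpow m p : 0 < m -> rot (size p) (wpow m p) = wpow m p.
Proof. by case: m => // m _; rewrite wpowS rot_size_cat -wpow_commute. Qed.

Lemma take_wpow j k p : j <= k -> take (j * size p) (wpow k p) = wpow j p.
Proof.
by move=> jk; rewrite -(subnKC jk) wpowD take_size_cat // size_wpow.
Qed.

(** Commuting words are powers of a common word. As the length of [q] is a multiple of that of [p],
    copies of [p] itself can be peeled off the front of [q]. *)
Lemma commute_wpow m p q : size q = m * size p -> p ++ q = q ++ p -> q = wpow m p.
Proof.
elim: m q => [|m IH] q sq pq; first by apply/nilP; rewrite /nilp sq.
have e : take (size p) q = p.
  have := congr1 (take (size p)) pq; rewrite take_size_cat // take_cat sq mulSn.
  case: ltnP => //; rewrite -[X in _ <= X]addn0 leq_add2l leqn0 => /eqP m0.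
  by rewrite m0 addn0 subnn take0 cats0 => <-; rewrite take_size.
have qE : q = p ++ drop (size p) q by rewrite -{1}e cat_take_drop.
rewrite qE wpowS; congr (_ ++ _); apply: IH.
  by rewrite size_drop sq mulSn addKn.
by move: pq; rewrite {1 2}qE -catA => /eqP; rewrite eqseq_cat // eqxx => /eqP.
Qed.

(** Invariance under rotation by [d] says that the prefix of length [d] commutes with the rest of
    the word. *)
Lemma rot_wpow_take d t : 0 < d -> d %| size t -> rot d t = t ->
  t = wpow (size t %/ d) (take d t).
Proof.
move=> d0 dt rt; have [->|tn] := eqVneq t [::]; first by rewrite /= div0n.
have dn : d <= size t by apply: dvdn_leq => //; rewrite lt0n size_eq0.
have sd : size (take d t) = d by exact: size_takel.
have k0 : 0 < size t %/ d by rewrite divn_gt0.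
rewrite -(prednK k0) wpowS -{1}(cat_take_drop d t); congr (_ ++ _).
apply: commute_wpow; last by move: rt; rewrite /rot cat_take_drop => ->.
rewrite sd size_drop -{1}(divnK dt) -subn1 mulnBl mul1n //.
Qed.

Lemma rot_iter k s : k <= size s -> rot k s = iter k (rot 1) s.
Proof.
elim: k => [|k IH] h; first by rewrite rot0.
by rewrite rotS // IH // ltnW.
Qed.

Lemma iter_rot_fix (f : seq T -> seq T) k m s : iter k f s = s -> iter (m * k) f s = s.
Proof. by move=> h; elim: m => [//|m IH]; rewrite mulSn iterD IH h. Qed.

(** Iterates of [rot 1] replace [rot k], which is the identity beyond the length. The exponents
    whose iterate fixes [t] are closed under remainders, so the least positive one divides them all,
    including [size t]. *)
Lemma minimal_period t : t != [::] -> exists e, [/\ 0 < e, e %| size t,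
  t = wpow (size t %/ e) (take e t) &
  forall d, 0 < d <= size t -> rot d t = t -> e %| d].
Proof.
move=> tn; have nt : 0 < size t by rewrite lt0n size_eq0.
have ex : exists d, (0 < d) && (iter d (rot 1) t == t).
  by exists (size t); rewrite nt -rot_iter // rot_size eqxx.
case: (ex_minnP ex) => e /andP[e0 /eqP he] emin.
have key d : iter d (rot 1) t = t -> e %| d.
  move=> hd; apply: contraT; rewrite /dvdn -lt0n => r0.
  have : e <= d %% e.
    apply: emin; rewrite r0 /= -{2}(hd) {2}(divn_eq d e) addnC iterD.
    by rewrite (iter_rot_fix _ he) eqxx.
  by rewrite leqNgt ltn_pmod.
have et : e %| size t by apply: key; rewrite -rot_iter // rot_size.
have re : rot e t = t by rewrite rot_iter // dvdn_leq.
exists e; split => //; first exact: rot_wpow_take.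
by move=> d /andP[d0 dn]; rewrite rot_iter //; exact: key.
Qed.

(** Stated through rotations, because the count of closed words needs the [size t] rotations to be
    distinct; [rot_wpow] shows that proper powers are excluded. *)
Definition primitive t := (t != [::]) && all (fun k => rot k t != t) (iota 1 (size t).-1).

Lemma primitiveP t : t != [::] ->
  reflect (forall k, 0 < k < size t -> rot k t <> t) (primitive t).
Proof.
move=> tn; rewrite /primitive tn; have nt : 0 < size t by rewrite lt0n size_eq0.
apply: (iffP allP) => h k; last first.
  by rewrite mem_iota add1n prednK // => /h/eqP.
by move=> hk; apply/eqP/h; rewrite mem_iota add1n prednK.
Qed.

Lemma primitive_root t : t != [::] -> exists p m, [/\ primitive p, 0 < m & t = wpow m p].
Proof.
elim: {t}(size t).+1 {-2}t (ltnSn (size t)) => // n IH t tn t0.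
have [pt|npt] := boolP (primitive t); first by exists t, 1; rewrite wpow1.
have [e [e0 et tE emin]] := minimal_period t0.
have nt : 0 < size t by rewrite lt0n size_eq0.
have en : e < size t.
  rewrite ltn_neqAle dvdn_leq // andbT; apply: contra npt => /eqP en.
  apply/primitiveP => // k /andP[k0 kn] rk.
  have := emin k; rewrite k0 ltnW // => /(_ isT rk)/(dvdn_leq k0).
  by rewrite en leqNgt kn.
have sz : size (take e t) = e by rewrite size_takel // ltnW.
have [||p [m [pp m0 pE]]] := IH (take e t).
- by rewrite sz; exact: leq_trans en _.
- by rewrite -size_eq0 sz -lt0n.
exists p, (size t %/ e * m); split => //.
  by rewrite muln_gt0 m0 andbT divn_gt0 // ltnW.
by rewrite -wpowM -pE.
Qed.

(** Rotation by [size p] fixes [t], so [e] divides [size p]. If [e] were smaller, [p] would be a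
    proper power of the prefix of length [e]. Hence a word determines its primitive root. *)
Lemma primitive_period p m e t : primitive p -> 0 < m -> t = wpow m p ->
  0 < e -> e %| size t -> t = wpow (size t %/ e) (take e t) ->
  (forall d, 0 < d <= size t -> rot d t = t -> e %| d) -> p = take e t.
Proof.
move=> pp m0 tE e0 et teE emin.
have p0 : p != [::] by case/andP: pp.
have np : 0 < size p by rewrite lt0n size_eq0.
have nt : size t = m * size p by rewrite tE size_wpow.
have pn : size p <= size t by rewrite nt leq_pmull.
have /dvdnP[j pj] : e %| size p by apply: emin; rewrite ?np // tE rot_wpow.
have en : e <= size t by apply: dvdn_leq => //; rewrite nt muln_gt0 m0.
have se : size (take e t) = e by rewrite size_takel.
have pE : p = wpow j (take e t).
  have -> : p = take (1 * size p) t by rewrite tE take_wpow // wpow1.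
  have jk : j <= size t %/ e by rewrite leq_divRL // -pj.
  by have := take_wpow (take e t) jk; rewrite se -teE mul1n pj.
have j0 : 0 < j by move: np; rewrite pj muln_gt0 => /andP[].
case: (ltngtP j 1) => [|j1|j1]; first by rewrite ltnNge j0.
  have := primitiveP p0 pp e; rewrite e0 pj -{1}[e]mul1n ltn_pmul2r // j1 => /(_ isT).
  by case; have := rot_wpow (take e t) j0; rewrite se -pE.
by rewrite pE j1 wpow1.
Qed.

Lemma primitive_wpow_inj p q m n : primitive p -> primitive q -> 0 < m -> 0 < n ->
  wpow m p = wpow n q -> p = q.
Proof.
move=> pp pq m0 n0 e.
have p0 : p != [::] by case/andP: pp.
have tn : wpow m p != [::].
  by rewrite -size_eq0 size_wpow muln_eq0 negb_or -lt0n m0 size_eq0.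
have [d [d0 dt tE dmin]] := minimal_period tn.
rewrite (primitive_period pp m0 (erefl _) d0 dt tE dmin).
by rewrite -(primitive_period pq n0 e d0 dt tE dmin).
Qed.

Lemma wpow_rcons m x s : x :: wpow m (rcons s x) = rcons (wpow m (x :: s)) x.
Proof.
elim: m => [//|m IH]; rewrite !wpowS rcons_cat -IH -cats1 /= -!catA //.
Qed.

Lemma cycle_wpow (e : rel T) m p : 0 < m -> cycle e (wpow m p) = cycle e p.
Proof.
case: m => // m _; case: p => [|x s]; first by elim: m => //.
have -> : cycle e (wpow m.+1 (x :: s)) = path e x (wpow m.+1 (rcons s x)).
  rewrite wpowS /= -cats1 -catA cats1 -wpow_rcons.
  by rewrite wpowS -cats1 -catA.
elim: m => [|m IH]; first by rewrite wpow1.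
by rewrite wpowS cat_path last_rcons IH /= andbb.
Qed.

Lemma rot_inj_primitive p j k : primitive p -> j < size p -> k < size p ->
  rot j p = rot k p -> j = k.
Proof.
move=> pp; wlog jk : j k / j <= k => [h jp kp e|jp kp e].
  by case: (leqP j k) => [|/ltnW] le; [exact: h|apply/esym/h].
have p0 : p != [::] by case/andP: pp.
apply/eqP; rewrite eqn_leq jk leqNgt; apply/negP => ltjk.
apply: (primitiveP p0 pp (k - j)); first by rewrite subn_gt0 ltjk (leq_ltn_trans (leq_subr _ _)).
have kj : k - j <= size p by rewrite (leq_trans (leq_subr _ _)) // ltnW.
apply: (@rot_inj j); rewrite e (rot_iter (ltnW kp)) rot_iter ?size_rot ?(ltnW jp) //.
by rewrite rot_iter // -iterD subnKC.
Qed.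

Lemma all_rot (a : pred T) k s : all a (rot k s) = all a s.
Proof. by apply: perm_all; rewrite perm_rot. Qed.

Lemma rot_primitive k t : primitive t -> primitive (rot k t).
Proof.
move=> pt; have t0 : t != [::] by case/andP: pt.
apply/primitiveP => [|j]; first by rewrite -size_eq0 size_rot size_eq0.
rewrite size_rot => hj e; apply: (primitiveP t0 pt j hj).
by apply: (@rot_inj k); rewrite rot_rot e.
Qed.

Fixpoint words (A : seq T) n : seq (seq T) :=
  if n is n'.+1 then [seq x :: s | x <- A, s <- words A n'] else [:: [::]].

Lemma mem_words A n s : (s \in words A n) = (size s == n) && all (mem A) s.
Proof.
elim: n s => [|n IH] s; first by rewrite inE; case: s.
apply/allpairsP/idP => [[[x t] /= [xA tA ->]]|].
  by move: tA; rewrite IH /= eqSS => /andP[-> ->]; rewrite xA.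
case: s => [//|x s] /= /andP[sn /andP[xA sA]].
by exists (x, s); rewrite /= IH sA xA -eqSS sn.
Qed.

Lemma words_uniq A n : uniq A -> uniq (words A n).
Proof.
move=> uA; elim: n => [//|n IH] /=.
by apply: allpairs_uniq => // -[x s] [y t] _ _ /= [-> ->].
Qed.

End Words.

(** * Closed words as powers of rotated primitive words *)

Section PrimitiveRepresentatives.
Variables (T : choiceType) (J : choiceType) (ok : rel T) (rho : J -> seq T).
Hypothesis rho_primitive : forall c, primitive (rho c).
Hypothesis rho_cycle : forall c, cycle ok (rho c).
Hypothesis rho_onto : forall t, primitive t -> cycle ok t ->
  exists c k, t = rot k (rho c).
Hypothesis rho_inj : forall c c' k k', rot k (rho c) = rot k' (rho c') -> c = c'.

(** [J] may be infinite, but only finitely many words over [A] have length at most [N]; [g] is a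
    partial inverse of the injective map [rho]. *)
Lemma exists_representatives_in (A : seq T) N : exists G : {fset J},
  forall c, (c \in G) = (size (rho c) <= N)%N && all (mem A) (rho c).
Proof.
pose g t : option J := if pselect (exists c, rho c = t) is left h
  then Some (sval (cid h)) else None.
have gP c : g (rho c) = Some c.
  rewrite /g; case: pselect => [h|]; last by case; exists c.
  by congr Some; case: (cid h) => d /= dc; by apply: (@rho_inj d c 0 0); rewrite !rot0.
exists [fset c in pmap g (flatten [seq words A n | n <- iota 0 N.+1])]%fset => c.
rewrite in_fset mem_pmap; apply/mapP/idP => [[t tw /esym gt]|/andP[sN aA]].
  have et : rho c = t.
    move: gt; rewrite /g; case: pselect => // h [].
    by case: (cid h) => d /= <- ->.
  case/flatten_mapP: tw => n; rewrite mem_iota /= add0n ltnS et mem_words => nN.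
  by case/andP => /eqP -> ->; rewrite nN.
exists (rho c); last by rewrite gP.
apply/flatten_mapP; exists (size (rho c)); last by rewrite mem_words eqxx.
by rewrite mem_iota add0n ltnS.
Qed.

Variables (A : seq T) (N : nat) (G : {fset J}).
Hypothesis A_uniq : uniq A.
Hypothesis mem_G : forall c, (c \in G) = (size (rho c) <= N)%N && all (mem A) (rho c).

Lemma rho_size c : (0 < size (rho c))%N.
Proof. by have /andP[+ _] := rho_primitive c; rewrite lt0n size_eq0. Qed.

Lemma sum_cycle_words (K : comNzRingType) (wgt : T -> K) n : (0 < n <= N)%N ->
  \sum_(t <- words A n | cycle ok t) \prod_(e <- t) wgt e =
  \sum_(c <- G | (size (rho c) %| n)%N)
     (\prod_(e <- rho c) wgt e) ^+ (n %/ size (rho c)) *+ size (rho c).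
Proof.
case/andP=> n0 nN.
rewrite -big_filter -[RHS]big_filter.
pose GG := [seq c <- G | (size (rho c) %| n)%N].
pose L := [seq wpow (n %/ size (rho c)) (rot k (rho c)) | c <- GG, k <- iota 0 (size (rho c))].
have div0 c : c \in GG -> (0 < n %/ size (rho c))%N.
  by rewrite mem_filter => /andP[/dvdn_leq h _]; rewrite divn_gt0 ?rho_size // h.
have LE : perm_eq [seq t <- words A n | cycle ok t] L.
  apply: uniq_perm.
  - by rewrite filter_uniq // words_uniq.
  - apply: allpairs_uniq_dep.
    + by rewrite filter_uniq ?fset_uniq.
    + by move=> c _; exact: iota_uniq.
    move=> _ _ /allpairsPdep[c [k [cG kc ->]]] /allpairsPdep[c' [k' [cG' kc' ->]]] /= e.
    have := primitive_wpow_inj (rot_primitive k (rho_primitive c))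
      (rot_primitive k' (rho_primitive c')) (div0 _ cG) (div0 _ cG') e => {}e.
    have cc' := rho_inj e; rewrite -cc' in e kc' *.
    congr (Tagged _ _); apply: (rot_inj_primitive (rho_primitive c)) e.
      by move: kc; rewrite mem_iota.
    by move: kc'; rewrite mem_iota.
  move=> t; rewrite mem_filter mem_words; apply/idP/allpairsPdep.
    case/andP => ct /andP[/eqP st At].
    have tn : t != [::] by rewrite -size_eq0 st -lt0n.
    have [p [m [pp m0 tE]]] := primitive_root tn.
    have cp : cycle ok p by rewrite -(cycle_wpow _ _ m0) -tE.
    have [c [k pE]] := rho_onto pp cp.
    have sp : size p = size (rho c) by rewrite pE size_rot.
    have nE : n = (m * size (rho c))%N by rewrite -st tE size_wpow sp.
    (* [rot k] is the identity once [k] reaches the length, so an arbitrary [k] reduces to one in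
       range. *)
    have [k' kk' pE'] : exists2 k', (k' < size (rho c))%N & p = rot k' (rho c).
      have [kl|kl] := ltnP k (size (rho c)); first by exists k.
      by exists 0%N; rewrite ?rho_size // pE rot0 rot_oversize.
    exists c, k'; split.
    - rewrite mem_filter nE dvdn_mull // mem_G /=.
      have -> : all (mem A) (rho c).
        rewrite -(all_rot _ k') -pE' -(all_wpow _ _ m0) -tE //.
      by rewrite andbT (leq_trans _ nN) // nE leq_pmull.
    - by rewrite mem_iota.
    by rewrite -pE' nE mulnK ?rho_size.
  case=> c [k [cG kc tE]]; have m0 := div0 _ cG.
  move: cG; rewrite mem_filter mem_G => /andP[dv /andP[_ Ac]].
  by rewrite tE cycle_wpow // rot_cycle rho_cycle size_wpow size_rot divnK // eqxx all_wpow // all_rot.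
rewrite (perm_big _ LE) /= big_allpairs_dep /=; apply: eq_bigr => c _.
rewrite (eq_bigr (fun _ => (\prod_(e <- rho c) wgt e) ^+ (n %/ size (rho c)))).
  by rewrite big_const_seq count_predT size_iota iter_addr addr0.
move=> k _; have -> : \prod_(e <- rho c) wgt e = \prod_(e <- rot k (rho c)) wgt e.
  by apply: perm_big; rewrite perm_sym perm_rot.
elim: (n %/ size (rho c))%N => [|m IH]; first by rewrite big_nil expr0.
by rewrite wpowS big_cat /= IH exprS.
Qed.

End PrimitiveRepresentatives.

(** * Logarithmic derivatives *)

Section LogDerivative.
Variable K : numFieldType.
Implicit Types (P Q t : {poly K}).

(** [t] stands for [- X P' / P] modulo [X^(N+1)]; multiplying by [P] keeps the relation among
    polynomials, without logarithms or inverses. *)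
Definition log_deriv_mod N P t := exists r, 'X * P^`() + P * t = 'X^(N.+1) * r.

Lemma log_deriv_mod1 N : log_deriv_mod N 1 0.
Proof. by exists 0; rewrite derivC !mulr0 addr0. Qed.

Lemma log_deriv_modM N P Q t t' : log_deriv_mod N P t -> log_deriv_mod N Q t' ->
  log_deriv_mod N (P * Q) (t + t').
Proof.
move=> [r hr] [r' hr']; exists (Q * r + P * r'); rewrite derivM.
transitivity (Q * ('X * P^`() + P * t) + P * ('X * Q^`() + Q * t')); first by ring.
by rewrite hr hr'; ring.
Qed.

Lemma log_deriv_mod_prod N (I : Type) (s : seq I) (P t : I -> {poly K}) :
  (forall i, log_deriv_mod N (P i) (t i)) ->
  log_deriv_mod N (\prod_(i <- s) P i) (\sum_(i <- s) t i).
Proof.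
move=> h; elim: s => [|i s IH]; first by rewrite !big_nil; exact: log_deriv_mod1.
by rewrite !big_cons; exact: log_deriv_modM.
Qed.

(** For [y = a X^l] one has [X y' = l y], so [- X P' / P = l y / (1 - y)]. The geometric series is
    cut at [y^(N+1)], which [X^(N+1)] divides because [l > 0]. *)
Lemma log_deriv_mod_factor N (a : K) l : (0 < l)%N ->
  log_deriv_mod N (1 - a *: 'X^l) ((\sum_(k < N) (a *: 'X^l) ^+ k.+1) *+ l).
Proof.
move=> l0; set y := a *: 'X^l.
have geo : (1 - y) * \sum_(k < N) y ^+ k.+1 = y - y ^+ N.+1.
  elim: N => [|N IH]; first by rewrite big_ord0 mulr0 expr1 subrr.
  by rewrite big_ord_recr /= mulrDr IH !exprS; ring.
have dy : 'X * y^`() = y *+ l.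
  rewrite /y derivZ derivXn -scalerAr mulrnAr -scalerMnr; congr (_ *: _ *+ _).
  by rewrite -exprS prednK.
exists (- (a ^+ N.+1 *: ('X^(N.+1)) ^+ l.-1) *+ l).
rewrite derivB derivC sub0r mulrN dy mulrnAr geo.
have -> : y ^+ N.+1 = 'X^(N.+1) * (a ^+ N.+1 *: ('X^(N.+1)) ^+ l.-1).
  by rewrite /y exprZn -scalerAr -exprS prednK // -!exprM mulnC.
by rewrite mulrnAr mulrN mulrnBl -!mulNrn; ring.
Qed.

(** Newton's identities, in the form of a recursion for the coefficients of [P]. *)
Lemma coef_log_deriv_mod N P t n : log_deriv_mod N P t -> (n <= N)%N ->
  P`_n *+ n = - \sum_(i < n.+1) P`_i * t`_(n - i).
Proof.
move=> [r hr] nN; have := congr1 (fun p : {poly K} => p`_n) hr.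
rewrite coefD coefXM coefM coefXnM ltnS nN => /eqP; rewrite addr_eq0 => /eqP <-.
by case: n nN => [|n] _ /=; rewrite ?mulr0n // coef_deriv.
Qed.

(** As [t] has no constant term, the recursion expresses [n P_n] by earlier coefficients, and
    characteristic zero allows division by [n]. *)
Lemma log_deriv_mod_unique N P Q t t' : log_deriv_mod N P t -> log_deriv_mod N Q t' ->
  P`_0 = Q`_0 -> t`_0 = 0 -> t'`_0 = 0 ->
  (forall n, (0 < n <= N)%N -> t`_n = t'`_n) ->
  forall n, (n <= N)%N -> P`_n = Q`_n.
Proof.
move=> hP hQ PQ0 t0 t0' tt'; elim/ltn_ind => -[//|n] IH nN.
have := coef_log_deriv_mod hP nN; have := coef_log_deriv_mod hQ nN.
rewrite ![\sum_(i < n.+2) _]big_ord_recr /= subnn t0 t0' !mulr0 !addr0 => eQ eP.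
apply: (@pmulrnI _ n.+1) => //; rewrite eP eQ; congr (- _); apply: eq_bigr => i _.
rewrite IH ?ltn_ord // ?tt' //; last by rewrite (leq_trans _ nN) // ltnW.
by rewrite subn_gt0 ltn_ord (leq_trans (leq_subr _ _)).
Qed.

End LogDerivative.

Section DetDerivative.
Variable K : comNzRingType.

Lemma deriv_prod n (f : 'I_n -> {poly K}) :
  (\prod_i f i)^`() = \sum_i (f i)^`() * \prod_(j | j != i) f j.
Proof.
elim: n f => [|n IH] f; first by rewrite !big_ord0 derivC.
rewrite big_ord_recl derivM IH big_ord_recl /=.
congr (_ * _ + _).
  rewrite [RHS]big_mkcond [RHS]big_ord_recl eqxx /= mul1r; exact: eq_bigr.
rewrite mulr_sumr; apply: eq_bigr => i _; rewrite mulrCA; congr (_ * _).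
rewrite [RHS]big_mkcond [RHS]big_ord_recl neq_lift; congr (_ * _).
by rewrite big_mkcond /=; apply: eq_bigr => j _; rewrite (inj_eq lift_inj).
Qed.

(** Jacobi's formula: one row at a time is differentiated, and each resulting determinant is
    expanded along that row. *)
Lemma deriv_det n (A : 'M[{poly K}]_n) :
  (\det A)^`() = \tr (map_mx deriv A *m \adj A).
Proof.
have -> : \tr (map_mx deriv A *m \adj A) =
   \sum_i \det (\matrix_(k, l) if k == i then (A k l)^`() else A k l).
  apply: eq_bigr => i _; rewrite !mxE (expand_det_row _ i); apply: eq_bigr => j _.
  rewrite !mxE eqxx; congr (_ * _); rewrite /cofactor; congr (_ * \det _).
  by apply/matrixP => k l; rewrite !mxE eq_sym (negPf (neq_lift _ _)).
rewrite /determinant exchange_big /= raddf_sum; apply: eq_bigr => s _.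
rewrite -mulr_sumr /= derivM.
have -> : (((-1) ^+ odd_perm s : {poly K})^`()) = 0.
  by case: (odd_perm s); rewrite ?expr1 ?derivN derivC ?oppr0.
rewrite mul0r add0r deriv_prod; congr (_ * _); apply: eq_bigr => i _.
rewrite [RHS](bigD1 i) //= mxE eqxx; congr (_ * _); apply: eq_bigr => j /negPf ji.
by rewrite mxE ji.
Qed.

End DetDerivative.

Section DetLogDerivative.
Variables (K : numFieldType) (n : nat) (T : 'M[K]_n).
Local Notation XT := ('X *: map_mx polyC T : 'M[{poly K}]_n).

(** Jacobi's formula gives [X P' = - tr (B X T)] with [B] the adjugate. The relation
    [B (1 - X T) = P] does the work of an inverse in the geometric series; what is left over carries
    [X^(N+1)]. *)
Lemma det_log_deriv N :
  log_deriv_mod N (\det (1%:M - XT)) (\sum_(k < N) (\tr (T ^+ k.+1)) *: 'X^(k.+1)).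
Proof.
set P := \det _; set B := \adj (1%:M - XT).
have BE : B * (1 - XT) = P%:M by rewrite -mulmxE /B mul_adj_mx.
have geo : B * (1 - XT ^+ N) = P *: \sum_(k < N) XT ^+ k.
  rewrite -[X in X - _](expr1n _ N) subrXX_comm; last by rewrite /GRing.comm mul1r mulr1.
  rewrite mulrA BE -mulmxE mul_scalar_mx; congr (_ *: _); apply: eq_bigr => i _.
  by rewrite expr1n mulmxE mul1r.
have XTE k : XT ^+ k = 'X^k *: map_mx polyC (T ^+ k).
  elim: k => [|k IH]; first by rewrite !expr0 map_scalar_mx scale1r.
  by rewrite !exprS IH -!mulmxE map_mxM -scalemxAl -scalemxAr scalerA.
have dP : 'X * P^`() = - \tr (B * XT).
  have dA : map_mx deriv (1%:M - XT) = - map_mx polyC T.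
    apply/matrixP => i j; rewrite !mxE derivB derivM derivX derivC mulr0 addr0 mul1r.
    by case: (i == j); rewrite ?mulr1n ?mulr0n derivC sub0r.
  rewrite deriv_det dA mulNmx mxtrace_mulC -/B raddfN /= mulrN.
  by rewrite -scalemxAl mxtraceZ.
exists (- \tr (B * map_mx polyC (T ^+ N.+1))).
have BXT : B * XT = (P *: \sum_(k < N) XT ^+ k) * XT + B * XT ^+ N.+1.
  by rewrite -geo mulrBr mulr1 mulrBl -mulrA -exprSr subrK.
have trX k : \tr (XT ^+ k) = (\tr (T ^+ k)) *: 'X^k.
  by rewrite XTE mxtraceZ trace_map_mx mulrC mul_polyC.
have t1 : \tr ((P *: \sum_(k < N) XT ^+ k) * XT) = P * \sum_(k < N) (\tr (T ^+ k.+1)) *: 'X^(k.+1).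
  rewrite -mulmxE -scalemxAl mxtraceZ mulmx_suml [\tr _]raddf_sum /=; congr (_ * _).
  by apply: eq_bigr => k _; rewrite mulmxE -exprSr trX.
have t2 : \tr (B * XT ^+ N.+1) = 'X^(N.+1) * \tr (B * map_mx polyC (T ^+ N.+1)).
  by rewrite XTE -mulmxE -scalemxAr mxtraceZ.
by rewrite dP BXT mxtraceD t1 t2 opprD addrAC addNr add0r mulrN.
Qed.

End DetLogDerivative.

(** * Determinants and Euler factors *)

Section TraceWords.
Variables (K : comNzRingType) (T : choiceType) (ok : rel T) (wgt : T -> K).
Variable A : {fset T}.
Let phi : 'I_(size A) -> T := tnth (in_tuple A).

Definition transfer_mx : 'M[K]_(size A) := \matrix_(a, b) (wgt (phi b) * (ok (phi a) (phi b))%:R).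

Lemma sum_tnth_fset (f : T -> K) : \sum_a f (phi a) = \sum_(e <- A) f e.
Proof. by rewrite [RHS]big_tnth. Qed.

(** An entry carries the weight of its second letter, so the starting letter is not weighted and the
    final one is; on closing up, every letter counts once. *)
Lemma transfer_mx_pow n a b : (transfer_mx ^+ n.+1) a b =
  \sum_(t <- words A n | path ok (phi a) (rcons t (phi b)))
     \prod_(e <- rcons t (phi b)) wgt e.
Proof.
elim: n a => [|n IH] a.
  by rewrite expr1 big_mkcond big_seq1 /= andbT big_seq1 mxE; case: ifP; rewrite ?mulr1 ?mulr0.
rewrite exprS -mulmxE mxE.
under eq_bigr do rewrite IH mxE.
rewrite (sum_tnth_fset (fun x => wgt x * (ok (phi a) x)%:R *
   \sum_(t <- words A n | path ok x (rcons t (phi b))) \prod_(e <- rcons t (phi b)) wgt e)).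
rewrite [RHS]big_mkcond /= big_allpairs_dep; apply: eq_bigr => x _ /=.
rewrite mulr_sumr big_mkcond; apply: eq_bigr => t _; rewrite big_cons.
by case: (ok _ _); case: ifP; rewrite ?mulr1 ?mulr0 ?mul0r.
Qed.

Lemma mxtrace_transfer_pow n : (0 < n)%N ->
  \tr (transfer_mx ^+ n) = \sum_(t <- words A n | cycle ok t) \prod_(e <- t) wgt e.
Proof.
case: n => // n _; rewrite /mxtrace.
under eq_bigr do rewrite transfer_mx_pow.
rewrite (sum_tnth_fset (fun x => \sum_(t <- words A n | path ok x (rcons t x))
   \prod_(e <- rcons t x) wgt e)).
rewrite [RHS]big_mkcond /= big_allpairs_dep; apply: eq_bigr => x _ /=.
rewrite big_mkcond; apply: eq_bigr => t _; case: ifP => // _.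
by apply: perm_big; rewrite perm_rcons.
Qed.

Lemma sum_words_prod n : \sum_(t <- words A n) \prod_(e <- t) wgt e = (\sum_(e <- A) wgt e) ^+ n.
Proof.
elim: n => [|n IH] /=; first by rewrite big_seq1 big_nil expr0.
rewrite big_allpairs_dep /= exprS mulr_suml; apply: eq_bigr => x _.
by rewrite -IH mulr_sumr; apply: eq_bigr => t _; rewrite big_cons.
Qed.

End TraceWords.

Section EulerFactors.
Variables (K : numFieldType) (T J : choiceType) (ok : rel T) (wgt : T -> K) (rho : J -> seq T).
Hypothesis rho_primitive : forall c, primitive (rho c).
Hypothesis rho_cycle : forall c, cycle ok (rho c).
Hypothesis rho_onto : forall t, primitive t -> cycle ok t ->
  exists c k, t = rot k (rho c).
Hypothesis rho_inj : forall c c' k k', rot k (rho c) = rot k' (rho c') -> c = c'.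
Variables (A : {fset T}) (N : nat) (G : {fset J}).
Hypothesis mem_G : forall c, (c \in G) = (size (rho c) <= N)%N && all (mem A) (rho c).

Definition word_weight c := \prod_(e <- rho c) wgt e.
Definition euler_poly (F : {fset J}) : {poly K} :=
  \prod_(c <- F) (1 - word_weight c *: 'X^(size (rho c))).
Definition det_poly : {poly K} :=
  \det (1%:M - 'X *: map_mx polyC (transfer_mx ok wgt A)).

Lemma horner_det_poly u : det_poly.[u] = \det (1%:M - u *: transfer_mx ok wgt A).
Proof.
rewrite -[LHS]/(horner_eval u det_poly) /det_poly -det_map_mx; congr determinant.
apply/matrixP => a b; rewrite !mxE /= /horner_eval hornerD hornerN hornerM hornerX hornerC.
by case: (a == b); rewrite ?mulr1n ?mulr0n hornerC.
Qed.

Lemma horner_euler_poly F u :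
  (euler_poly F).[u] = \prod_(c <- F) (1 - word_weight c * u ^+ size (rho c)).
Proof.
rewrite /euler_poly horner_prod; apply: eq_bigr => c _.
by rewrite hornerD hornerN hornerC hornerZ hornerXn.
Qed.

Lemma coef_sum_shift (f : nat -> K) m : (0 < m <= N)%N ->
  (\sum_(k < N) f k *: 'X^(k.+1))`_m = f m.-1.
Proof.
case/andP=> m0 mN; have k0N : (m.-1 < N)%N by rewrite prednK.
rewrite coef_sum (bigD1 (Ordinal k0N)) //= big1 ?addr0; last first.
  move=> k kk0; rewrite coefZ coefXn; case: eqP => [mk|_]; last by rewrite mulr0.
  by case/eqP: kk0; apply: val_inj; rewrite /= mk.
by rewrite coefZ coefXn prednK // eqxx mulr1.
Qed.

Lemma det_poly_euler_poly n : (n <= N)%N -> det_poly`_n = (euler_poly G)`_n.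
Proof.
have l0 c : (0 < size (rho c))%N by exact: rho_size.
apply: (log_deriv_mod_unique (det_log_deriv _ N)).
- apply: log_deriv_mod_prod => c; exact: (log_deriv_mod_factor N (word_weight c) (l0 c)).
- rewrite -!horner_coef0 -[\det _]/det_poly horner_det_poly scale0r subr0 det1.
  rewrite -/(euler_poly G) horner_euler_poly big1 // => c _.
  by rewrite expr0n gtn_eqF // mulr0 subr0.
- by rewrite coef_sum big1 // => k _; rewrite coefZ coefXn mulr0.
- rewrite coef_sum big1 // => c _; rewrite coefMn coef_sum big1 ?mul0rn // => k _.
  by rewrite exprZn coefZ -exprM coefXn eq_sym muln_eq0 eqn0Ngt l0 mulr0.
move=> m mN; have /andP[m0 mN'] := mN.
rewrite (coef_sum_shift (fun k => \tr (transfer_mx ok wgt A ^+ k.+1)) mN).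
rewrite prednK // mxtrace_transfer_pow //.
rewrite (sum_cycle_words rho_primitive rho_cycle rho_onto rho_inj (fset_uniq A) mem_G) //.
(* A cycle of length [l] contributes in degree [m] only if [l] divides [m], and then only through
   the power [k + 1 = m / l]. *)
rewrite coef_sum [LHS]big_mkcond; apply: eq_bigr => c _; rewrite coefMn coef_sum.
case: ifPn => [dv|ndv]; last first.
  rewrite big1 ?mul0rn // => k _; rewrite exprZn coefZ -exprM coefXn.
  case: eqP => [mE|_]; last by rewrite mulr0.
  by rewrite mE dvdn_mulr in ndv.
have q0 : (0 < m %/ size (rho c))%N by rewrite divn_gt0 // dvdn_leq.
have qN : ((m %/ size (rho c)).-1 < N)%N.
  by rewrite prednK // (leq_trans (leq_div _ _)).
congr (_ *+ _); rewrite -/(word_weight c) (bigD1 (Ordinal qN)) //= big1 ?addr0; last first.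
  move=> k kk; rewrite exprZn coefZ -exprM coefXn; case: eqP => [mE|_]; last by rewrite mulr0.
  by case/eqP: kk; apply: val_inj; rewrite /= mE mulKn.
by rewrite prednK // exprZn coefZ -exprM coefXn mulnC divnK // eqxx mulr1.
Qed.

End EulerFactors.

(** * Cauchy estimates for determinants and finite products *)

Section CoefficientBounds.
Variable R : realType.
Local Notation C := R[i].
Local Notation nc := (@ComplexField.Normc.normc R).

(* [coef_dom p q] makes [q] a majorant of [p], so that [q.[rho]] bounds the
   coefficients of [p] as in Cauchy's estimates. *)
Definition coef_dom (p : {poly C}) (q : {poly R}) := forall n, nc p`_n <= q`_n.

Lemma coef_dom_ge0 p q : coef_dom p q -> forall n, 0 <= q`_n.
Proof. by move=> h n; apply: le_trans (h n); exact: nc_ge0. Qed.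

Lemma coef_domC a : coef_dom a%:P (nc a)%:P.
Proof. by move=> n; rewrite !coefC; case: eqP => _ //; rewrite nc0. Qed.

Lemma coef_dom_sum (I : Type) (s : seq I) (P : I -> {poly C}) Q :
  (forall i, coef_dom (P i) (Q i)) ->
  coef_dom (\sum_(i <- s) P i) (\sum_(i <- s) Q i).
Proof.
move=> h n; rewrite !coef_sum; apply: le_trans (nc_sum _ _ _) _.
by apply: ler_sum => i _; exact: h.
Qed.

Lemma coef_domM p q p' q' : coef_dom p q -> coef_dom p' q' -> coef_dom (p * p') (q * q').
Proof.
move=> h h' n; rewrite !coefM; apply: le_trans (nc_sum _ _ _) _.
by apply: ler_sum => i _; rewrite ncM ler_pM ?nc_ge0.
Qed.

Lemma coef_dom1 : coef_dom 1 1.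
Proof. by have := coef_domC 1; rewrite nc1. Qed.

Lemma coef_dom_prod (I : Type) (s : seq I) (P : I -> {poly C}) Q :
  (forall i, coef_dom (P i) (Q i)) ->
  coef_dom (\prod_(i <- s) P i) (\prod_(i <- s) Q i).
Proof.
move=> h; elim: s => [|i s IH]; first by rewrite !big_nil; exact: coef_dom1.
by rewrite !big_cons; exact: coef_domM.
Qed.

Lemma coef_dom_horner p q (x : R) n : coef_dom p q -> 0 <= x ->
  nc p`_n * x ^+ n <= q.[x].
Proof.
move=> h x0; have q0 := coef_dom_ge0 h.
apply: (@le_trans _ _ (q`_n * x ^+ n)); first by rewrite ler_wpM2r ?exprn_ge0.
rewrite horner_coef; have [nq|nq] := ltnP n (size q).
  rewrite (bigD1 (Ordinal nq)) //= lerDl sumr_ge0 // => i _.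
  by rewrite mulr_ge0 ?exprn_ge0.
by rewrite nth_default // mul0r sumr_ge0 // => i _; rewrite mulr_ge0 ?exprn_ge0.
Qed.

Lemma coef_dom_affine (a b : C) l : coef_dom (a%:P - b *: 'X^l) ((nc a)%:P + nc b *: 'X^l).
Proof.
move=> n; rewrite coefB coefD !coefC !coefZ !coefXn.
apply: le_trans (ncD _ _) _; rewrite ncN ncM nc_nat lerD2r.
by case: eqP => _ //; rewrite nc0.
Qed.

(** With signs dropped, the majorant evaluated at [x] is the permanent of [1 + x |M|], which is at
    most the product of its row sums. *)
Lemma det_coef_le n (M : 'M[C]_n) (x : R) k : 0 <= x ->
  nc (\det (1%:M - 'X *: map_mx polyC M))`_k * x ^+ k <=
  \prod_i (1 + x * \sum_j nc (M i j)).
Proof.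
move=> x0; pose Q i j : {poly R} := ((i == j)%:R)%:P + nc (M i j) *: 'X^1.
have dQ : coef_dom (\det (1%:M - 'X *: map_mx polyC M)) (\sum_(s : 'S_n) \prod_i Q i (s i)).
  apply: coef_dom_sum => s; rewrite -[X in coef_dom _ X]mul1r; apply: coef_domM.
    by case: (odd_perm s); rewrite ?expr0 ?expr1; have := coef_domC (-1); rewrite ?ncN nc1 ?polyCN //; have := coef_dom1.
  apply: coef_dom_prod => i.
  have := @coef_dom_affine ((i == s i)%:R) (M i (s i)) 1; rewrite nc_nat => h m.
  have := h m; congr (nc _`_m <= _); rewrite !mxE expr1 mulrC mul_polyC.
  by case: (i == s i).
apply: le_trans (coef_dom_horner _ dQ x0) _; rewrite horner_sum.
have QE i j : (Q i j).[x] = (i == j)%:R + x * nc (M i j).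
  by rewrite hornerD hornerC hornerZ hornerXn expr1 mulrC.
rewrite (eq_bigr (fun s : 'S_n => \prod_i ((i == s i)%:R + x * nc (M i (s i))))); last first.
  by move=> s _; rewrite horner_prod; apply: eq_bigr => i _; exact: QE.
apply: le_trans (sum_perm_prod_le (a := fun i j => (i == j)%:R + x * nc (M i j)) _) _.
  by move=> i j; rewrite addr_ge0 ?mulr_ge0 ?nc_ge0.
rewrite le_eqVlt; apply/orP; left; apply/eqP; apply: eq_bigr => i _.
rewrite big_split /= -mulr_sumr; congr (_ + _).
by rewrite (bigD1 i) //= eqxx big1 ?addr0 // => j; rewrite eq_sym => /negPf ->.
Qed.

Lemma prod_coef_le (I : Type) (s : seq I) (a : I -> C) (l : I -> nat) (x : R) k : 0 <= x ->
  nc (\prod_(i <- s) (1 - a i *: 'X^(l i)))`_k * x ^+ k <=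
  \prod_(i <- s) (1 + nc (a i) * x ^+ l i).
Proof.
move=> x0.
have h : coef_dom (\prod_(i <- s) (1 - a i *: 'X^(l i)))
    (\prod_(i <- s) (1 + nc (a i) *: 'X^(l i))).
  by apply: coef_dom_prod => i; have := @coef_dom_affine 1 (a i) (l i); rewrite nc1.
apply: le_trans (coef_dom_horner _ h x0) _.
rewrite horner_prod le_eqVlt; apply/orP; left; apply/eqP; apply: eq_bigr => i _.
by rewrite hornerD hornerC hornerZ hornerXn.
Qed.

(** Degrees up to [N] cancel. Beyond, the coefficients differ by at most [2 K / x^i], and
    [|u| <= x / 2] turns this into [2 K 2^-i]. *)
Lemma horner_close (P Q : {poly C}) (K x : R) (u : C) N : 0 <= K -> 0 < x ->
  (forall n, (n <= N)%N -> P`_n = Q`_n) ->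
  (forall n, nc P`_n * x ^+ n <= K) -> (forall n, nc Q`_n * x ^+ n <= K) ->
  nc u <= x / 2 -> nc (P.[u] - Q.[u]) <= (2 * K) * 2 * (2^-1) ^+ N.+1.
Proof.
move=> K0 x0 PQ hP hQ ux; pose m := maxn N.+1 (maxn (size P) (size Q)).
have Pm : (size P <= m)%N by rewrite !leq_max leqnn !orbT.
have Qm : (size Q <= m)%N by rewrite !leq_max leqnn !orbT.
rewrite (horner_coef_wide _ Pm) (horner_coef_wide _ Qm) -sumrB.
rewrite -(big_mkord xpredT (fun i => P`_i * u ^+ i - Q`_i * u ^+ i)).
rewrite (big_cat_nat (n := N.+1)) ?leq_maxl //= big_nat big1 ?add0r; last first.
  by move=> i; rewrite ltnS => /PQ ->; rewrite subrr.
apply: le_trans (nc_sum _ _ _) _.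
apply: (@le_trans _ _ (\sum_(N.+1 <= i < m) (2 * K) * (2^-1) ^+ i)); last first.
  by rewrite -mulr_sumr -[leRHS]mulrA ler_wpM2l ?mulr_ge0 // sum_half_pow // leq_maxl.
apply: ler_sum => i _; rewrite -mulrBl ncM ncX.
have uX : nc u ^+ i <= x ^+ i * (2^-1) ^+ i.
  by rewrite -exprMn lerXn2r ?nnegrE ?nc_ge0 // mulr_ge0 // ltW.
apply: le_trans (ler_wpM2l (nc_ge0 _) uX) _; rewrite mulrA ler_wpM2r ?exprn_ge0 ?invr_ge0 //.
apply: le_trans (ler_wpM2r _ (ncD _ _)) _; first by rewrite exprn_ge0 // ltW.
by rewrite ncN mulrDl; have := hP i; have := hQ i; lra.
Qed.

End CoefficientBounds.

(** * Cycles as words of edges *)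

Section EdgeWords.
Variable X : sgraph.
Implicit Types (e f : oedge X) (t : seq (oedge X)) (p : X * seq X).

Definition joined e f := term e == orig f.
Definition nonbacktracking e f := (term e == orig f) && (f != einv e).

(** [insub] discards pairs that are not edges; on an actual path it discards none. *)
Definition edge_word p : seq (oedge X) := pmap insub (zip (belast p.1 p.2) p.2).

Lemma edge_word_cons x y s e : orig e = x -> term e = y ->
  edge_word (x, y :: s) = e :: edge_word (y, s).
Proof.
move=> ex ey; rewrite /edge_word /= insubT /=; first by rewrite -ex -ey adj_edge.
by move=> xy; congr (_ :: _); apply: edge_eq.
Qed.

Lemma edge_words_eq t t' : map (@orig X) t = map (@orig X) t' ->
  map (@term X) t = map (@term X) t' -> t = t'.
Proof.
elim: t t' => [|e t IH] [|f t'] //= [eo ot] [et tt].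
by rewrite (edge_eq eo et) (IH t').
Qed.

Lemma edge_word_maps p : path (@adj X) p.1 p.2 ->
  map (@orig X) (edge_word p) = belast p.1 p.2 /\ map (@term X) (edge_word p) = p.2.
Proof.
case: p => x s /=; elim: s x => [//|y s IH] x /= /andP[/edge_exists[e ex ey] ys].
have [h1 h2] := IH y ys.
by rewrite (edge_word_cons s ex ey) /= ex ey h1 h2.
Qed.

Lemma path_joined e s : path joined e s ->
  map (@orig X) s = belast (term e) (map (@term X) s) /\
  path (@adj X) (term e) (map (@term X) s).
Proof.
elim: s e => [//|f s IH] e /= /andP[/eqP ef fs]; have [-> ->] := IH f fs.
by rewrite ef adj_edge.
Qed.

Lemma cycle_joined_edge_word t : t != [::] -> cycle joined t ->
  exists2 p : cpath X, edge_word (val p) = t & (val p).2 = map (@term X) t.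
Proof.
case: t => [//|e t] _ /=; rewrite -cats1 cat_path /= andbT => /andP[pt /eqP le].
have [ot at_] := path_joined pt.
have cp : closed_path (orig e, map (@term X) (e :: t)).
  by rewrite /closed_path /= adj_edge at_ /= last_map le eqxx.
exists (exist (fun p : X * seq X => closed_path p) _ cp) => //=.
have [|h1 h2] := @edge_word_maps (orig e, map (@term X) (e :: t)); first by case/and3P: cp.
by apply: edge_words_eq; rewrite ?h1 ?h2 //= ot.
Qed.

Section ClosedPath.
Variable p : cpath X.

Lemma cpath_path : path (@adj X) (val p).1 (val p).2.
Proof. by case/and3P: (valP p). Qed.

Lemma cpath_last : last (val p).1 (val p).2 = (val p).1.
Proof. by case/and3P: (valP p) => _ _ /eqP. Qed.

Lemma size_edge_word : size (edge_word (val p)) = plen (val p).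
Proof. by rewrite -(size_map (@term X)) (edge_word_maps cpath_path).2. Qed.

Lemma edge_word_neq0 : edge_word (val p) != [::].
Proof. by rewrite -size_eq0 size_edge_word -lt0n; case/and3P: (valP p). Qed.

Lemma nth_edge_word e0 j : (j < plen (val p))%N ->
  orig (nth e0 (edge_word (val p)) j) = pvtx (val p) j /\
  term (nth e0 (edge_word (val p)) j) = pvtx (val p) j.+1.
Proof.
move=> jn; have [ho ht] := edge_word_maps cpath_path.
have sw := size_edge_word.
split.
  rewrite -(nth_map _ (val p).1) ?sw // ho /pvtx lastI nth_rcons size_belast.
  by rewrite -/(plen _) jn.
by rewrite -(nth_map _ (val p).1) ?sw // ht.
Qed.

(** Pairs of consecutive letters express reducedness. The last letter followed by the first
    expresses the absence of a tail, since [x_n = x_0]. *)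
Lemma nonbacktracking_edge_word :
  cycle nonbacktracking (edge_word (val p)) <->
  reduced (val p) /\ ~ has_tail (val p).
Proof.
have := edge_word_neq0; have sw := size_edge_word; have nthw := nth_edge_word.
have x0n : pvtx (val p) (plen (val p)) = pvtx (val p) 0.
  rewrite /pvtx /= -[RHS]cpath_last /plen; by rewrite (last_nth (val p).1).
move: sw nthw; case: (edge_word (val p)) => [//|e t] sw nthw _.
have {nthw} nthw := nthw e; set n := plen (val p) in sw nthw x0n *.
have n0 : (0 < n)%N by rewrite -sw.
(* [i + 1 = n] is the wrap-around pair, where the successor is the first letter [e]. *)
have okP i : (i < n)%N -> nonbacktracking (nth e (e :: rcons t e) i) (nth e (rcons t e) i)
   <-> (if (i.+1 < n)%N then pvtx (val p) i <> pvtx (val p) i.+2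
        else pvtx (val p) 1 <> pvtx (val p) (n - 1)).
  move=> iN; have -> : nth e (e :: rcons t e) i = nth e (e :: t) i.
    by rewrite -rcons_cons nth_rcons sw iN.
  have [o1 t1] := nthw _ iN; rewrite nth_rcons.
  have -> : size t = n.-1 by rewrite -sw.
  have ltE : (i < n.-1)%N = (i.+1 < n)%N by rewrite -ltnS prednK.
  rewrite ltE; case: ltnP => [i1|i1].
    have [o2 t2] := nthw _ i1; rewrite /= in o2 t2.
    rewrite /nonbacktracking t1 o2 eqxx /=; split=> [/eqP h h'|h].
      by apply: h; apply: edge_eq; rewrite ?orig_einv ?term_einv ?o1 ?t1 ?o2 ?t2.
    by apply/eqP => h'; apply: h; rewrite -o1 -t2 h' term_einv.
  have iE : i = n.-1 by apply/eqP; rewrite eqn_leq -ltnS prednK // iN -ltnS prednK.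
  have -> : (if i == n.-1 then e else e) = e by case: ifP.
  have [o2 t2] := nthw _ n0; rewrite /= in o2 t2.
  have t1' : term (nth e (e :: t) i) = pvtx (val p) 0 by rewrite t1 iE prednK.
  rewrite subn1 -iE /nonbacktracking t1' o2 eqxx /=; split=> [/eqP h h'|h].
    by apply: h; apply: edge_eq; rewrite ?orig_einv ?term_einv ?o1 ?t1' ?o2 ?t2.
  by apply/eqP => h'; apply: h; have := congr1 (@term X) h'; rewrite term_einv t2 o1.
rewrite /=; split.
  move/(pathP e); rewrite size_rcons [(size t).+1]sw => h; split.
    move=> j /andP[j1 jn]; have jn' : (j < n)%N by rewrite (leq_ltn_trans jn) // subn1 ltn_predL.
    have jn2 : (j.-1 < n)%N by rewrite (leq_ltn_trans (leq_pred _)).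
    have := (okP _ jn2).1 (h _ jn2); rewrite prednK // jn'.
    by rewrite subn1 addn1.
  have nn : (n.-1 < n)%N by rewrite ltn_predL.
  by have := (okP _ nn).1 (h _ nn); rewrite prednK // ltnn.
case=> hr ht; apply/(pathP e) => i; rewrite size_rcons [(size t).+1]sw => iN.
apply/(okP _ iN); case: ifP => [i1|_]; last exact: ht.
have := hr i.+1; rewrite !subn1 addn1 /=; apply.
by rewrite -/n -ltnS prednK.
Qed.

End ClosedPath.

Lemma edge_word_inj (p q : cpath X) : edge_word (val p) = edge_word (val q) -> p = q.
Proof.
move=> h; have e2 : (val p).2 = (val q).2.
  by rewrite -(edge_word_maps (cpath_path p)).2 -(edge_word_maps (cpath_path q)).2 h.
have sp : (0 < size (val p).2)%N by case/and3P: (valP p).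
have e1 : (val p).1 = (val q).1.
  rewrite -(cpath_last p) -(cpath_last q) -e2; by case: (val p).2 sp.
by apply: val_inj; rewrite [val p]surjective_pairing e1 e2 -surjective_pairing.
Qed.

Lemma edge_word_shift (p q : cpath X) : val q = shift_path (val p) ->
  edge_word (val q) = rot 1 (edge_word (val p)).
Proof.
move=> h; have [hoq htq] := edge_word_maps (cpath_path q).
have [hop htp] := edge_word_maps (cpath_path p).
have lp := cpath_last p.
have sp : (0 < size (val p).2)%N by case/and3P: (valP p).
apply: edge_words_eq; rewrite map_rot ?hoq ?htq ?hop ?htp h.
  move: lp sp; case: (val p) => x [|y s] //= lp _.
  by rewrite belast_rcons rot1_cons -lp -lastI.
by move: sp; case: (val p) => x [|y s] //= _; rewrite rot1_cons.
Qed.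

Lemma closed_path_shift (p : cpath X) : closed_path (shift_path (val p)).
Proof.
have := cpath_last p; have := cpath_path p; have : (0 < size (val p).2)%N by case/and3P: (valP p).
case: (val p) => x [|y s] //= _ /andP[xy ys] lp.
by rewrite /closed_path /shift_path /plen /= size_rcons last_rcons eqxx -cats1 cat_path ys /= lp xy.
Qed.

Definition cshift (p : cpath X) : cpath X :=
  exist (fun p : X * seq X => closed_path p) _ (closed_path_shift p).

Lemma edge_word_iter_cshift (p : cpath X) k : (k <= size (edge_word (val p)))%N ->
  edge_word (val (iter k cshift p)) = rot k (edge_word (val p)).
Proof.
elim: k => [|k IH] h; first by rewrite rot0.
rewrite iterS (@edge_word_shift (iter k cshift p) (cshift (iter k cshift p)) erefl).
by rewrite [RHS]rotS // (IH (ltnW h)).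
Qed.

Lemma rot_exists (T : eqType) (s : seq T) j k : exists i, rot j (rot k s) = rot i s.
Proof.
have [jn|jn] := leqP j (size s); last first.
  by exists k; rewrite (@rot_oversize _ j) // size_rot ltnW.
have [kn|kn] := leqP k (size s); last by exists j; rewrite (@rot_oversize _ k) // ltnW.
by rewrite rot_add_mod //; eexists.
Qed.

(** The generating step acts on edge words as [rot 1], an edge word determines its closed path, and
    rotations are closed under composition and inverse. *)
Lemma cycle_equivP (p q : cpath X) :
  cycle_equiv p q <-> exists k, edge_word (val q) = rot k (edge_word (val p)).
Proof.
split=> [/asboolP|[k h]].
  elim=> {p q} [p q h|p|p q _ [k ->]|p q r _ [k hk] _ [j ->]].
  - by exists 1%N; exact: edge_word_shift.
  - by exists 0%N; rewrite rot0.
  - by exists (size (rot k (edge_word (val p))) - k)%N; rewrite -[RHS]/(rotr k _) rotK.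
  - by rewrite hk; exact: rot_exists.
have [i iN hi] : exists2 i, (i <= size (edge_word (val p)))%N &
    edge_word (val q) = rot i (edge_word (val p)).
  have [kn|kn] := leqP k (size (edge_word (val p))); first by exists k.
  by exists 0%N => //; rewrite h rot0 rot_oversize // ltnW.
have -> : q = iter i cshift p by apply: edge_word_inj; rewrite edge_word_iter_cshift.
apply/asboolP; elim: (i) => [|m IH]; first exact: rst_refl.
by apply: rst_trans IH _; apply: rst_step.
Qed.

Lemma pcycle_eqP (p q : cpath X) : \pi_(pcycle X)%qT p = \pi_(pcycle X)%qT q <->
  exists k, edge_word (val q) = rot k (edge_word (val p)).
Proof.
rewrite -cycle_equivP; split=> [/eqmodP //|h]; exact/eqmodP.
Qed.

End EdgeWords.

(** * Regular prime cycles as primitive non-backtracking words *)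

Section PrimeCycleWords.
Variable X : sgraph.
Local Notation ew := (@edge_word X).
Local Notation ok := (@nonbacktracking X).
Local Notation picyc := (\pi_(pcycle X)%qT).

Lemma nonbacktracking_joined t : cycle ok t -> cycle (@joined X) t.
Proof. by apply: sub_cycle => e f /andP[]. Qed.

Lemma path_edge_word_joined (p : X * seq X) e : path (@adj X) p.1 p.2 -> term e = p.1 ->
  path (@joined X) e (ew p).
Proof.
case: p => x s /=; elim: s x e => [//|y s IH] x e /= /andP[/edge_exists[f fx fy] ys] ex.
by rewrite (edge_word_cons s fx fy) /= /joined ex fx eqxx IH.
Qed.

Lemma edge_word_joined (p : cpath X) : cycle (@joined X) (ew (val p)).
Proof.
have pp := cpath_path p; have lp := cpath_last p.
have [ho ht] := edge_word_maps pp; have := edge_word_neq0 p.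
have := @path_edge_word_joined (val p).
case E : (ew (val p)) => [//|e t] h _.
have := h (last e t) pp; rewrite -last_map.
have -> : last (term e) (map (@term X) t) = (val p).1.
  by rewrite -[RHS]lp -ht E.
move=> /(_ erefl) /= /andP[le pt]; rewrite rcons_path pt /=.
by [].
Qed.

Lemma cycle_len_edge_word (p : cpath X) : cycle_len (picyc p) = size (ew (val p)).
Proof.
have : picyc (repr (picyc p)) = picyc p by rewrite reprK.
by move/pcycle_eqP => [k ->]; rewrite size_rot size_edge_word.
Qed.

(** The definition quantifies over all members of the class; a cyclic condition is invariant under
    rotation, so one member suffices. *)
Lemma regular_cycleP (p : cpath X) : regular_cycle (picyc p) <-> cycle ok (ew (val p)).
Proof.
split=> [h|h q]; first by apply/nonbacktracking_edge_word; exact: h.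
move/pcycle_eqP => [k hk]; apply/nonbacktracking_edge_word.
by rewrite hk rot_cycle in h.
Qed.

(** A power of a shorter cycle has an edge word fixed by a proper rotation. Conversely, the
    primitive root of an edge word is again cyclically joined, hence comes from a closed path of
    which the given one is a power. *)
Lemma prime_cycleP (p : cpath X) : prime_cycle (picyc p) <-> primitive (ew (val p)).
Proof.
have tn := edge_word_neq0 p.
split=> [pp|pp [d [lt [q [q' [m [qd q'p q'E]]]]]]]; last first.
  have eq' : ew (val q') = wpow m (ew (val q)).
    have [ho ht] := edge_word_maps (cpath_path q).
    have [ho' ht'] := edge_word_maps (cpath_path q').
    have mapw (T T' : eqType) (f : T -> T') n s : map f (wpow n s) = wpow n (map f s).
      by rewrite /wpow map_flatten map_nseq.
    apply: edge_words_eq; rewrite mapw ?ho' ?ht' ?ho ?ht q'E //= -/(wpow _ _).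
    elim: (m) => [//|n IH]; rewrite !wpowS belast_cat.
    by rewrite cpath_last IH.
  move: lt; rewrite -qd !cycle_len_edge_word => lt.
  move/esym/pcycle_eqP : q'p => [k hk].
  have pq' : primitive (ew (val q')) by rewrite hk; exact: rot_primitive.
  have sq' : size (ew (val q')) = size (ew (val p)) by rewrite hk size_rot.
  (* [is_cycle_power] admits the exponent 0; it is excluded here because edge words of closed paths
     are nonempty. *)
  have m0 : (0 < m)%N.
    case: m eq' {q'E} => // e'; have := edge_word_neq0 q'; by rewrite e'.
  apply: (primitiveP (edge_word_neq0 q') pq' (size (ew (val q)))).
    by rewrite sq' lt lt0n size_eq0 edge_word_neq0.
  by rewrite eq' rot_wpow.
have [r [m [pr m0 rE]]] := primitive_root tn.
have [m1|m1] := eqVneq m 1%N; first by rewrite rE m1 wpow1.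
exfalso; apply: pp.
have cr : cycle (@joined X) r by rewrite -(cycle_wpow _ _ m0) -rE edge_word_joined.
have r0 : r != [::] by case/andP: pr.
have [q qr q2] := cycle_joined_edge_word r0 cr.
exists (picyc q); split.
  rewrite !cycle_len_edge_word qr rE size_wpow ltn_Pmull ?lt0n ?size_eq0 //.
  by rewrite ltn_neqAle eq_sym m1 m0.
exists q, p, m; split=> //.
have [ho ht] := edge_word_maps (cpath_path p).
have p2 : (val p).2 = wpow m (val q).2.
  by rewrite -ht rE q2 /wpow map_flatten map_nseq.
rewrite [LHS]surjective_pairing /path_power -/(wpow m _) p2; congr (_, _).
rewrite -(cpath_last p) p2; case: m m0 {m1 rE p2} => // m _.
elim: m (val p).1 => [|m IH] x; first by rewrite wpow1 -[RHS]cpath_last q2; case: (r) r0.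
by rewrite wpowS last_cat.
Qed.

Definition prime_word (c : rpcycle X) : seq (oedge X) := ew (val (repr (val c))).

Lemma prime_word_primitive c : primitive (prime_word c).
Proof.
have /asboolP[_ h] := valP c; apply/prime_cycleP.
by rewrite reprK.
Qed.

Lemma prime_word_cycle c : cycle ok (prime_word c).
Proof.
have /asboolP[h _] := valP c; apply/regular_cycleP.
by rewrite reprK.
Qed.

Lemma prime_word_onto t : primitive t -> cycle ok t ->
  exists c k, t = rot k (prime_word c).
Proof.
move=> pt ct; have t0 : t != [::] by case/andP: pt.
have [p pE _] := cycle_joined_edge_word t0 (nonbacktracking_joined ct).
have rp : `[< regular_cycle (picyc p) /\ prime_cycle (picyc p) >].
  by apply/asboolP; split; [apply/regular_cycleP|apply/prime_cycleP]; rewrite pE.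
exists (exist (fun c : pcycle X => `[< regular_cycle c /\ prime_cycle c >]) _ rp).
have /pcycle_eqP[k hk] : picyc (repr (picyc p)) = picyc p by rewrite reprK.
by exists k; rewrite -pE hk.
Qed.

Lemma prime_word_inj c c' k k' : rot k (prime_word c) = rot k' (prime_word c') -> c = c'.
Proof.
move=> h; apply: val_inj; rewrite -[val c]reprK -[val c']reprK.
apply/pcycle_eqP; rewrite -!/(prime_word _).
have -> : prime_word c' = rot (size (rot k' (prime_word c')) - k') (rot k (prime_word c)).
  by rewrite h -[RHS]/(rotr k' _) rotK.
exact: rot_exists.
Qed.

Lemma size_prime_word c : size (prime_word c) = cycle_len (val c).
Proof. by rewrite /prime_word size_edge_word. Qed.

Variables (R : realType) (w : oedge X -> R).

Lemma pweight_edge_word p : path (@adj X) p.1 p.2 ->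
  pweight w p = \prod_(e <- ew p) w e.
Proof.
case: p => x s /=; elim: s x => [|y s IH] x /=.
  by rewrite /pweight /plen /= big_ord0 big_nil.
case/andP=> /edge_exists[e ex ey] ys.
rewrite (edge_word_cons s ex ey) big_cons -IH // /pweight /plen /= big_ord_recl.
congr (_ * _); first by rewrite /pvtx /= -ex -ey wt_edge.
apply: eq_bigr => j _; rewrite /pvtx /= add0n.
have js := ltn_ord j; have js' : (j < size (y :: s))%N by rewrite /= ltnW.
(* The two sides differ only in the default value of [nth], and the indices are in range. *)
by congr (wt _ _ _); [exact: set_nth_default|exact: set_nth_default].
Qed.

Lemma cycle_weight_prime_word c : cycle_weight w (val c) = \prod_(e <- prime_word c) w e.
Proof. by rewrite /cycle_weight pweight_edge_word //; exact: cpath_path. Qed.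

End PrimeCycleWords.

(** * The Euler product *)

Section ProductBounds.
Variables (R : realType) (J : choiceType).
Local Notation C := R[i].
Local Notation nc := (@ComplexField.Normc.normc R).

(** The Weierstrass product inequality; it will keep finite Euler products away from zero. *)
Lemma one_sub_sum_le_prod (s : seq J) (a : J -> R) : (forall c, 0 <= a c <= 1) ->
  1 - \sum_(c <- s) a c <= \prod_(c <- s) (1 - a c).
Proof.
move=> ha; elim: s => [|c s IH]; first by rewrite !big_nil subr0.
rewrite !big_cons; have /andP[c0 c1] := ha c.
have S0 : 0 <= \sum_(d <- s) a d by apply: sumr_ge0 => d _; case/andP: (ha d).
apply: (@le_trans _ _ ((1 - a c) * (1 - \sum_(d <- s) a d))); first by nra.
by rewrite ler_wpM2l // subr_ge0.
Qed.

Lemma nc_prod_one_sub_ge (s : seq J) (x : J -> C) : (forall c, nc (x c) <= 1) ->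
  1 - \sum_(c <- s) nc (x c) <= nc (\prod_(c <- s) (1 - x c)).
Proof.
move=> hx; apply: le_trans (one_sub_sum_le_prod _ _) _.
  by move=> c; rewrite nc_ge0 hx.
rewrite nc_prod; apply: ler_prod => c _; rewrite subr_ge0 hx /= lerBlDr.
by rewrite -{1}(nc1 R) -{1}(subrK (x c) 1); exact: ncD.
Qed.

(** Both products expand over the subsets of their index sets; the difference comes from the subsets
    not contained in [G0]. *)
Lemma prod_one_sub_tail (x : J -> C) (s : R) :
  (forall G : {fset J}, \sum_(c <- G) nc (x c) <= s) -> forall eps : R, 0 < eps ->
  exists G0 : {fset J}, forall G, (G0 `<=` G)%fset ->
    nc (\prod_(c <- G) (1 - x c) - \prod_(c <- G0) (1 - x c)) <= eps.
Proof.
move=> xs eps e0; have x0 c : 0 <= nc (x c) by exact: nc_ge0.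
have [G0 hG0] := sum_prod_tail x0 xs e0; exists G0 => G sG.
have E (F : {fset J}) : \prod_(c <- F) (1 - x c) = \sum_(H <- fpowerset F) \prod_(c <- H) (- x c).
  by rewrite sum_prod_fpowerset.
rewrite !E (bigID (fun H => H `<=` G0)%fset) /=.
rewrite [X in X + _ - _](_ : _ = \sum_(H <- fpowerset G0) \prod_(c <- H) (- x c)).
  rewrite addrAC subrr add0r; apply: le_trans (nc_sum _ _ _) _.
  apply: le_trans (hG0 (fpowerset G)); apply: ler_sum => H _.
  by rewrite nc_prod; apply: ler_prod => c _; rewrite ncN x0 lexx.
rewrite -big_filter; apply: perm_big; apply: uniq_perm.
- by rewrite filter_uniq // fset_uniq.
- exact: fset_uniq.
move=> H; rewrite mem_filter !fpowersetE andb_idr // => sH.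
exact: fsubset_trans sH sG.
Qed.

End ProductBounds.

Section EulerProduct.
Variables (R : realType) (X : sgraph) (w : oedge X -> R).
Variables (M : nat) (out : X -> seq (oedge X)) (sW : R).
Hypothesis w_gt0 : forall e, 0 < w e.
Hypothesis out_uniq : forall x, uniq (out x).
Hypothesis out_mem : forall x e, (e \in out x) = (orig e == x).
Hypothesis out_size : forall x, (size (out x) <= M)%N.
Hypothesis w_sum : forall t, uniq t -> \sum_(e <- t) w e <= sW.
Local Notation C := R[i].
Local Notation nc := (@ComplexField.Normc.normc R).
Local Notation om := (out_weight w out).
Local Notation rc x := (x : R)%:C%C.
Local Notation ok := (@nonbacktracking X).
Local Notation J := (rpcycle X).
Local Notation rho := (@prime_word X).
Let wgt (e : oedge X) : C := rc (w e).
Let W_ (c : J) : R := \prod_(e <- rho c) w e.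

Let w_ge0 e : 0 <= w e. Proof. exact: ltW. Qed.

Let W_ge0 c : 0 <= W_ c. Proof. exact: prodr_ge0. Qed.

(** The factor 4 bounds the words of length [n], weighted at this radius, by [4^-n], so that the
    Euler terms sum to at most [1/2]; the summand 1 covers [sW = 0]. *)
Definition small_radius : R := (4 * (sW + 1))^-1.
Local Notation x0 := small_radius.

Let sW0 : 0 <= sW := sW_ge0 w_sum.

Lemma small_radius_gt0 : 0 < x0.
Proof. by rewrite /small_radius invr_gt0 mulr_gt0 // ltr_wpDl. Qed.

Lemma small_radius_sW : sW * x0 <= 4^-1.
Proof.
rewrite /small_radius invfM mulrCA ler_piMr ?invr_ge0 //.
by rewrite ler_pdivrMr ?ltr_wpDl // mul1r lerDl.
Qed.

Definition letters (G : {fset J}) : seq (oedge X) := flatten [seq rho c | c <- G].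

Definition representatives_in (A : {fset oedge X}) N : {fset J} :=
  sval (cid (exists_representatives_in (@prime_word_inj X) A N)).

Lemma mem_representatives_in (A : {fset oedge X}) N c :
  (c \in representatives_in A N) = (size (rho c) <= N)%N && all (mem A) (rho c).
Proof. exact: (svalP (cid (exists_representatives_in (@prime_word_inj X) A N))). Qed.

Lemma representatives_in_sub (G : {fset J}) (A : {fset oedge X}) N :
  {subset letters G <= A} -> (\max_(c <- G) size (rho c) <= N)%N ->
  (G `<=` representatives_in A N)%fset.
Proof.
move=> sA sN; apply/fsubsetP => c cG; rewrite mem_representatives_in; apply/andP; split.
  by apply: leq_trans sN; rewrite (big_rem c) //= leq_maxl.
by apply/allP => e ec; apply: sA; apply/flatten_mapP; exists c.
Qed.

(** A prime cycle of length [n] occurs at least once among the closed words of length [n], and all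
    words of length [n] over [A] together weigh the [n]-th power of the weight of [A]. *)
Lemma sum_weight_size_le (A : {fset oedge X}) N n : (0 < n <= N)%N ->
  \sum_(c <- representatives_in A N | size (rho c) == n) W_ c <= sW ^+ n.
Proof.
move=> nN; have /andP[n0 _] := nN.
apply: (@le_trans _ _ (\sum_(t <- words A n | cycle ok t) \prod_(e <- t) w e)).
  rewrite (sum_cycle_words (@prime_word_primitive X) (@prime_word_cycle X)
    (@prime_word_onto X) (@prime_word_inj X) (fset_uniq A) (@mem_representatives_in A N)) //.
  rewrite big_mkcond [leRHS]big_mkcond; apply: ler_sum => c _.
  case: eqP => [e|_]; last by case: ifP => // _; rewrite mulrn_wge0 // exprn_ge0 // prodr_ge0.
  by rewrite e dvdnn divnn n0 expr1 -mulr_natr ler_peMr ?prodr_ge0 // ler1n.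
apply: (@le_trans _ _ ((\sum_(e <- A) w e) ^+ n)).
  rewrite -sum_words_prod big_mkcond; apply: ler_sum => t _.
  by case: ifP => // _; exact: prodr_ge0.
by rewrite lerXn2r ?nnegrE ?sumr_ge0 // w_sum ?fset_uniq.
Qed.

Lemma sum_weight_le (G : {fset J}) : \sum_(c <- G) W_ c * x0 ^+ size (rho c) <= 2^-1.
Proof.
have x00 := small_radius_gt0; have x0g := ltW x00.
have f0 c : 0 <= W_ c * x0 ^+ size (rho c) by rewrite mulr_ge0 ?exprn_ge0.
pose A : {fset oedge X} := [fset e | e in letters G]%fset.
pose N := (\max_(c <- G) size (rho c))%N.
have sG : (G `<=` representatives_in A N)%fset.
  by apply: representatives_in_sub => // e eG; rewrite in_fset.
apply: le_trans (sum_fset_le_subset xpredT f0 sG) _.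
apply: (@le_trans _ _ (\sum_(1 <= n < N.+1) \sum_(c <- representatives_in A N | size (rho c) == n)
    W_ c * x0 ^+ size (rho c))).
  under [leRHS]eq_bigr do rewrite big_mkcond.
  rewrite exchange_big /= big_seq [leRHS]big_seq; apply: ler_sum => c.
  rewrite mem_representatives_in => /andP[cN _].
  rewrite (bigD1_seq (size (rho c))) ?iota_uniq //; last first.
    rewrite mem_index_iota ltnS cN andbT; exact: rho_size (@prime_word_primitive X) c.
  by rewrite /= eqxx lerDl sumr_ge0 // => n _; case: ifP.
(* [4^-n <= 2^-1 * 2^-n] for [n >= 1], and the right sides sum to at most [1/2]. *)
apply: (@le_trans _ _ (\sum_(1 <= n < N.+1) 2^-1 * (2^-1) ^+ n)); last first.
  rewrite -mulr_sumr; apply: (@le_trans _ _ (2^-1 * (2 * (2^-1) ^+ 1))).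
    rewrite ler_wpM2l ?invr_ge0 //; have [->|N0] := eqVneq N 0%N.
      by rewrite big_geq // mulr_ge0 ?exprn_ge0 ?invr_ge0.
    by rewrite sum_half_pow.
  by rewrite expr1 divff // mulr1.
rewrite big_nat [leRHS]big_nat; apply: ler_sum => n /andP[n0 nN].
rewrite (eq_bigr (fun c => W_ c * x0 ^+ n)); last by move=> c /eqP ->.
rewrite -mulr_suml; apply: (@le_trans _ _ (sW ^+ n * x0 ^+ n)).
  by rewrite ler_wpM2r ?exprn_ge0 // sum_weight_size_le // n0.
rewrite -exprMn; apply: (@le_trans _ _ ((4^-1) ^+ n)).
  apply: lerXn2r; rewrite ?nnegrE ?(mulr_ge0 sW0 x0g) ?invr_ge0 //; exact: small_radius_sW.
have -> : (4^-1 : R) = 2^-1 * 2^-1 by lra.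
rewrite exprMn ler_wpM2r ?exprn_ge0 ?invr_ge0 //.
case: n n0 {nN} => // n _; rewrite exprS ler_piMr ?invr_ge0 //.
by rewrite exprn_ile1 ?invr_ge0 // invf_le1 ?ler1n.
Qed.

Definition spectral_det (u : C) : C :=
  fredholm_minors (fun e f => - u * edge_mx w e f).

Lemma scaled_edge_mx_dominated u :
  dominated (fun e => nc u * om (term e)) (fun e f => - u * edge_mx w e f).
Proof.
move=> f F; under eq_bigr do rewrite ncM ncN.
by rewrite -mulr_sumr ler_wpM2l ?nc_ge0 // (edge_mx_dominated w_gt0 out_mem).
Qed.

Lemma scaled_bound_sum x : 0 <= x -> forall F : {fset oedge X},
  \sum_(e <- F) x * om (term e) <= x * (M%:R * sW).
Proof.
move=> h F; rewrite -mulr_sumr ler_wpM2l //.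
exact: sum_out_weight_term_le (fset_uniq F).
Qed.

Lemma transfer_edge_mx (A : {fset oedge X}) u :
  1%:M - u *: transfer_mx ok wgt A =
  1%:M + \matrix_(a, b) (- u * edge_mx w (tnth (in_tuple A) a) (tnth (in_tuple A) b)).
Proof.
congr (_ + _); apply/matrixP => a b; rewrite !mxE mulNr; congr (- (_ * _)).
rewrite /edge_mx /nonbacktracking /wgt; case: (_ && _); rewrite ?mulr1 ?mulr0 //.
Qed.

Lemma spectral_det_approx u eps : 0 < eps -> exists F0 : {fset oedge X},
  forall A : {fset oedge X}, (F0 `<=` A)%fset ->
  nc (spectral_det u - (det_poly ok wgt A).[u]) <= eps.
Proof.
move=> e0.
have t0 e' : 0 <= nc u * om (term e') by rewrite mulr_ge0 ?nc_ge0 // out_weight_ge0.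
have [F0 hF0] := fredholm_minors_section t0 (scaled_bound_sum (nc_ge0 u)) e0.
exists F0 => A sA; rewrite horner_det_poly transfer_edge_mx.
apply: (hF0 _ _ (scaled_edge_mx_dominated u) (scaled_edge_mx_dominated u)) => //.
  exact: tnth_fset_inj.
move=> e /(fsubsetP sA) eA; have /tnthP[a ->] : e \in in_tuple A by [].
by exists a.
Qed.

(** The first summand bounds the coefficients of the determinant, the second those of the Euler
    product, both scaled at [small_radius]. *)
Let K := expR (x0 * (M%:R * sW)) + expR 1.

Lemma det_euler_close (A : {fset oedge X}) N u : nc u <= x0 / 2 ->
  nc ((det_poly ok wgt A).[u] - (euler_poly wgt rho (representatives_in A N)).[u])
    <= (2 * K) * 2 * (2^-1) ^+ N.+1.
Proof.
have x00 := small_radius_gt0; have x0g := ltW x00.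
apply: horner_close => //.
- by rewrite addr_ge0 // expR_ge0.
- move=> n; exact: (@det_poly_euler_poly _ _ _ ok wgt rho (@prime_word_primitive X)
    (@prime_word_cycle X) (@prime_word_onto X) (@prime_word_inj X) A N _
    (@mem_representatives_in A N) n).
- move=> n; apply: le_trans (det_coef_le _ _ x0g) _.
  apply: (@le_trans _ _ (expR (x0 * (M%:R * sW)))); last by rewrite lerDl expR_ge0.
  have r0 e : 0 <= x0 * om (term e) by rewrite mulr_ge0 // out_weight_ge0.
  apply: le_trans (prod_add1_le_expR r0 (scaled_bound_sum x0g) A).
  rewrite [leRHS]big_tnth; apply: ler_prod => a _; apply/andP; split.
    by rewrite addr_ge0 ?mulr_ge0 // sumr_ge0 // => b _; exact: nc_ge0.
  rewrite lerD2l ler_wpM2l //.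
  apply: le_trans (edge_mx_dominated w_gt0 out_mem (tnth (in_tuple A) a) A).
  rewrite [leRHS]big_tnth; apply: ler_sum => b _; rewrite !mxE /edge_mx /nonbacktracking.
  by case: (_ && _); rewrite ?mulr1 ?mulr0.
move=> n; apply: le_trans (prod_coef_le _ _ _ _ x0g) _.
apply: (@le_trans _ _ (expR 1)); last by rewrite lerDr expR_ge0.
have wE c : nc (word_weight wgt rho c) = W_ c.
  by rewrite /word_weight nc_prod; apply: eq_bigr => e _; rewrite nc_real_ge0.
under eq_bigr do rewrite wE.
apply: (prod_add1_le_expR (r := fun c => W_ c * x0 ^+ size (rho c))) => [c|F].
  by rewrite mulr_ge0 ?exprn_ge0.
by apply: le_trans (sum_weight_le F) _; rewrite invf_le1 ?ler1n.
Qed.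

Let term_ u c : C := word_weight wgt rho c * u ^+ size (rho c).

Lemma sum_term_le u (G : {fset J}) : nc u <= x0 / 2 -> \sum_(c <- G) nc (term_ u c) <= 2^-1.
Proof.
move=> hu; apply: le_trans (sum_weight_le G); apply: ler_sum => c _.
rewrite /term_ ncM ncX /word_weight nc_prod.
have -> : \prod_(e <- rho c) nc (wgt e) = W_ c.
  by apply: eq_bigr => e _; rewrite nc_real_ge0.
rewrite ler_wpM2l // lerXn2r ?nnegrE ?nc_ge0 ?(ltW small_radius_gt0) //.
by apply: le_trans hu _; rewrite ler_pdivrMr // ler_peMr ?ler1n // ltW // small_radius_gt0.
Qed.

(** The tail of the product fixes [G0]. For [G] above it, [A] and [N] are taken so large that
    [representatives_in A N] contains [G]; the chain runs from the determinant to its section on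
    [A], the Euler polynomial, the product over [G0] and the product over [G]. *)
Lemma euler_product_lim u : nc u <= x0 / 2 -> forall eps, 0 < eps ->
  exists G0 : {fset J}, forall G, (G0 `<=` G)%fset ->
  nc (spectral_det u - \prod_(c <- G) (1 - term_ u c)) <= eps.
Proof.
move=> hu eps e0; have e4 : 0 < eps / 4 by rewrite divr_gt0.
have [G0 hG0] := prod_one_sub_tail (fun G => sum_term_le G hu) e4.
exists G0 => G sG.
have [F0 hF0] := spectral_det_approx u e4.
have [N0 hN0] := half_pow_small ((2 * K) * 2) e4.
pose A : {fset oedge X} := [fset e in F0 ++ letters G]%fset.
pose N := maxn N0 (\max_(c <- G) size (rho c))%N.
have sA : (F0 `<=` A)%fset by apply/fsubsetP => e eF; rewrite in_fset mem_cat eF.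
have sG' : (G `<=` representatives_in A N)%fset.
  apply: representatives_in_sub; last exact: leq_maxr.
  by move=> e eG; rewrite in_fset mem_cat eG orbT.
have h1 := hF0 _ sA; have h2 := det_euler_close A N hu.
have h3 := hG0 _ (fsubset_trans sG sG'); have h4 := hG0 _ sG.
have h5 := hN0 N.+1 (leqW (leq_maxl _ _)).
have := le_trans h2 h5; rewrite horner_euler_poly => {h2 h5} h2.
rewrite ncB in h4.
set D := spectral_det u in h1 *; set P := _.[u] in h1 h2.
set Q := \prod_(c <- _) _ in h2; rewrite -[X in nc (X - _) <= _]/Q in h3.
set Q0 := \prod_(c <- G0) _ in h3 h4; set QG := \prod_(c <- G) _ in h4 *.
have -> : D - QG = (D - P) + ((P - Q) + ((Q - Q0) + (Q0 - QG))) by ring.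
apply: le_trans (ncD _ _) _; have := ncD (P - Q) ((Q - Q0) + (Q0 - QG)).
have := ncD (Q - Q0) (Q0 - QG); lra.
Qed.

Lemma zeta_partialE u (G : {fset J}) :
  zeta_partial w u G = (\prod_(c <- G) (1 - term_ u c))^-1.
Proof.
rewrite -prodfV /zeta_partial; apply: eq_bigr => c _; rewrite /zeta_factor /term_.
rewrite size_prime_word cycle_weight_prime_word; congr (1 - _ * _)^-1.
by rewrite /word_weight rmorph_prod.
Qed.

Lemma spectral_det_zeta u : nc u <= x0 / 2 ->
  zeta_converges w u /\ spectral_det u = (zeta w u)^-1.
Proof.
move=> hu; have lim_u := euler_product_lim hu.
(* The Euler terms sum to at most [1/2], so finite products have modulus at least [1/2];
   approximation within [1/4] then shows that the limit is nonzero. *)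
have lower (G : {fset J}) : 2^-1 <= nc (\prod_(c <- G) (1 - term_ u c)).
  apply: le_trans (nc_prod_one_sub_ge _ _).
    by have := sum_term_le G hu; lra.
  move=> c; have := sum_term_le [fset c]%fset hu; rewrite big_seq_fset1 => h.
  by apply: le_trans h _; rewrite invf_le1 ?ler1n.
have D0 : spectral_det u != 0.
  have q0 : 0 < (4^-1 : R) by [].
  have [G0 hG0] := lim_u _ q0.
  apply/eqP => D0; have := hG0 _ (fsubset_refl _); rewrite D0 sub0r ncN.
  by have := lower G0; lra.
have cQ : ((fun G : {fset J} => \prod_(c <- G) (1 - term_ u c) : C^o) @ totally
    --> (spectral_det u : C^o))%classic.
  apply/cvgCP => e e0; apply/near_totally.
  by have [G0 hG0] := lim_u _ e0; exists G0.
have cZ : (zeta_partial w u @ totally --> ((spectral_det u)^-1 : C^o))%classic.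
  have -> : zeta_partial w u = fun G => (\prod_(c <- G) (1 - term_ u c))^-1.
    by apply/funext => G; exact: zeta_partialE.
  exact: (cvgV D0 cQ).
have zE : zeta w u = (spectral_det u)^-1 by apply: (@cvg_lim C^o).
split; last by rewrite zE invrK.
split; first by apply/cvg_ex; exists ((spectral_det u)^-1); exact: cZ.
by rewrite zE; apply/eqP; rewrite invr_eq0.
Qed.

(** Minors of size [n] are homogeneous of degree [n], so scaling the matrix by [- u] turns the
    Fredholm series into a power series in [u]. *)
Lemma spectral_det_entire : entire spectral_det.
Proof.
have om0 e : 0 <= om (term e) by exact: out_weight_ge0.
have oms (F : {fset oedge X}) : \sum_(e <- F) om (term e) <= M%:R * sW.
  exact: sum_out_weight_term_le (fset_uniq F).
have dT := edge_mx_dominated w_gt0 out_mem.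
have -> : spectral_det = fun u => lim (series ((fun n => u ^+ n *
    ((-1) ^+ n * trace_minors (edge_mx w) n)) : C^o ^nat)%classic @ \oo)%classic.
  apply/funext => u; rewrite /spectral_det /fredholm_minors.
  suff -> : trace_minors (fun e f => - u * edge_mx w e f) =
    fun n => u ^+ n * ((-1) ^+ n * trace_minors (edge_mx w) n) by [].
  apply/funext => n; rewrite (trace_minorsZ om0 oms) //.
  by rewrite mulrA -exprMn mulrN1.
apply: entire_power_series => x hx; exists (expR (x * (M%:R * sW))) => n.
rewrite ncM ncX ncN nc1 expr1n mul1r.
exact: (trace_minors_le om0 oms).
Qed.

End EulerProduct.

Theorem theorem3p1 (R : realType) (X : sgraph) (w : oedge X -> R)
    (hconn : connected_graph X)
    (hval : bounded_valency X)
    (hpos : forall e : oedge X, 0 < w e)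
    (hfin : summable [set: oedge X] (fun e : oedge X => (w e)%:E)) :
  (forall u : R[i], trace_class (ihara_op w u)) /\
  exists Zinv : R[i] -> R[i],
    is_zeta_inverse w Zinv /\
    forall u : R[i], Zinv u = fredholm_det1p (ihara_op w u).
Proof.
have [M [out [out_uniq out_mem out_size]]] := exists_out_edges hval.
have [sW w_sum] := summable_uniq_sums (fun e => ltW (hpos e)) hfin.
pose bm := back_weight w out.
have dI u : dominated (ihara_bound w out u) (ihara_mx w bm u).
  apply: (ihara_mx_dominated hpos out_mem w_sum) => x.
  by rewrite lexx (back_weight_ge0 out hpos).
split=> [u|].
  have [s hs] := ihara_bound_sum hpos out_uniq out_mem w_sum u.
  apply: (trace_class_of_rows (ihara_bound_ge0 out hpos u) hs (dI u)).
  exact: (ihara_op_rows w out_uniq out_mem).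
exists (spectral_det w); split; last first.
  move=> u; rewrite (fredholm_det1p_minors (ihara_op_delta w out_uniq out_mem u)).
  by rewrite (fredholm_ihara hpos out_uniq out_mem out_size w_sum).
split; first exact: (spectral_det_entire hpos out_uniq out_mem out_size w_sum).
(* Half the radius at which the coefficients are estimated, so that the tails decay
   geometrically. *)
apply/nbhsCP; exists (small_radius sW / 2) => [|u].
  by rewrite divr_gt0 // (small_radius_gt0 w_sum).
rewrite subr0; exact: (spectral_det_zeta hpos out_uniq out_mem out_size w_sum).
Qed.
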